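(* Consider the robust problem $\min\{f_0(x):x\in\mathcal{X},\ \max_{z_m\in\mathcal{Z}_m}g_m(x,z_m)\le0\ \forall m\in[M]\}$ with $$\mathcal{Z}_m=\widetilde{\mathcal{Z}}_m\cap\Big(\bigcap_{i\in[I_m]}\{z_m\in\mathbb{R}^{J_m}:h_{m,i}(z_m)\le0\}\Big).$$ Suppose: (i) $\widetilde{\mathcal{Z}}_m\subseteq\mathbb{R}^{J_m}$ ($m\in[M]$) and $\mathcal{X}\subseteq\mathbb{R}^N$ are non-empty, compact and convex; (ii) $f_0:\mathbb{R}^N\to\mathbb{R}\cup\{+\infty\}$ is convex with $\mathcal{X}\subseteq\mathrm{dom}(f_0)$; each $g_m:\mathbb{R}^N\times\mathbb{R}^{J_m}\to\mathbb{R}\cup\{\pm\infty\}$ is such that $g_m(\cdot,z_m)$ is convex on $\mathbb{R}^N$ for any $z_m\in\widetilde{\mathcal{Z}}_m$, $g_m(x,\cdot)$ is concave on $\mathbb{R}^{J_m}$ for any $x\in\mathcal{X}$, and $\mathcal{X}\times\widetilde{\mathcal{Z}}_m\subseteq\mathrm{dom}(g_m)$; each $h_{m,i}:\mathbb{R}^{J_m}\to\mathbb{R}\cup\{+\infty\}$ is convex with $\widetilde{\mathcal{Z}}_m\subseteq\mathrm{dom}(h_{m,i})$; (iii) there is $\bar x\in\mathcal{X}$ with $\max_{z_m\in\widetilde{\mathcal{Z}}_m}g_m(\bar x,z_m)<0$ for all $m\in[M]$, and for each $m\in[M]$ there is $\bar z_m\in\widetilde{\mathcal{Z}}_m$ with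 $h_{m,i}(\bar z_m)<0$ for all $i\in[I_m]$; (iv) the robust problem has an optimal solution. (a) Suppose moreover that $f_0$ is subdifferentiable on $\mathcal{X}$; for all $m\in[M]$, $x\in\mathcal{X}$, $z_m\in\widetilde{\mathcal{Z}}_m$, the functions $g_m(\cdot,z_m)$ and $-g_m(x,\cdot)$ are subdifferentiable on $\mathcal{X}$ and $\widetilde{\mathcal{Z}}_m$, respectively; each $h_{m,i}$ is subdifferentiable on $\widetilde{\mathcal{Z}}_m$; and there are constants $D_0,\dots,D_M,E_1,\dots,E_M,F_1,\dots,F_M>0$ such that for all $m\in[M]$, $i\in[I_m]$, $z_m\in\widetilde{\mathcal{Z}}_m$, $x\in\mathcal{X}$, every element of $\partial f_0(x)$, $\partial_xg_m(x,z_m)$, $\partial_{z_m}(-g_m)(x,z_m)$, $\partial h_{m,i}(z_m)$ has Euclidean norm at most $D_0$, $D_m$, $E_m$, $F_m$, respectively. Then, for any $\varepsilon>0$, the oracle complexity of extended ProM$^3$ (described in the context) for achieving an $\varepsilon$-approximate optimal solution to the robust problem is $\mathcal{O}(\varepsilon^{-3})$. (b) Suppose, instead of the additional assumption in (a), that $f_0$ is differentiable on $\mathcal{X}$, each $g_m$ is differentiable on $\mathcal{X}\times\widetilde{\mathcal{Z}}_m$, each $h_{m,i}$ is differentiable on $\widetilde{\mathcal{Z}}_m$, and there are constants $D_0',\dots,D_M',E_{1,1}',E_{1,2}',\dots,E_{M,1}',E_{M,2}',F_1',\dots,F_M'>0$ such that for all $m\in[M]$, $i\in[I_m]$, $z_m,z_m'\in\widetilde{\mathcal{Z}}_m$,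 $x,x'\in\mathcal{X}$: $\|\nabla f_0(x)-\nabla f_0(x')\|_2\le D_0'\|x-x'\|_2$; $\|\nabla_xg_m(x,z_m)-\nabla_xg_m(x',z_m)\|_2\le D_m'\|x-x'\|_2$; $\|\nabla_{z_m}g_m(x,z_m)-\nabla_{z_m}g_m(x',z_m')\|_2\le E_{m,1}'\|x-x'\|_2+E_{m,2}'\|z_m-z_m'\|_2$; $\|\nabla h_{m,i}(z_m)-\nabla h_{m,i}(z_m')\|_2\le F_m'\|z_m-z_m'\|_2$. Then the oracle complexity in (a) is strengthened to $\mathcal{O}(\varepsilon^{-2})$. Here ''the oracle complexity is $\mathcal{O}(\varepsilon^{-p})$'' means: for every $\varepsilon>0$ the parameters of extended ProM$^3$ can be chosen so that its output $\bar x^K$ is an $\varepsilon$-approximate optimal solution, with the total number of oracle calls being $\mathcal{O}(\varepsilon^{-p})$ as $\varepsilon\to0$ (implied constant depending only on the problem data).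
   Context: Notation: $[M]=\{1,\dots,M\}$; $[a]_+=\max\{a,0\}$; $\widetilde{\mathcal{Z}}=\widetilde{\mathcal{Z}}_1\times\cdots\times\widetilde{\mathcal{Z}}_M$; $h_m=(h_{m,1},\dots,h_{m,I_m})$; $\mathrm{Proj}_{\mathcal{S}}$ is Euclidean projection; $\mathrm{dom}$ denotes the set where a function is finite. Subdifferentiable at a point means having a non-empty set of subgradients there; differentiable on a non-open set $\mathcal{S}$ means differentiable on an open set containing $\mathcal{S}$. Constants $G_m<0$ are fixed with $g_m(x,\bar z_m)\ge G_m$ for all $x\in\mathcal{X}$; $a_m=G_m/\max_{i\in[I_m]}h_{m,i}(\bar z_m)$; $\mathcal{M}=[0,a_1]^{I_1}\times\cdots\times[0,a_M]^{I_M}$, with elements $\mu=(\mu_1,\dots,\mu_M)$. For $\tilde x=(x,\mu)\in\mathcal{X}\times\mathcal{M}$ put $\tilde g_m(\tilde x,z_m)=g_m(x,z_m)-\mu_m^\top h_m(z_m)$. $\varepsilon$-approximate optimal solution of the robust problem: $x\in\mathcal{X}$ with $f_0(x)-f_0(x^\star)\le\varepsilon$ and $\max_{m\in[M]}[f_m(x)]_+\le\varepsilon$, where $f_m(x)=\max_{z_m\in\mathcal{Z}_m}g_m(x,z_m)$ and $x^\star$ is an optimal solution. Strong $\nu$-approximate saddle point of $\mathcal{F}:\mathcal{U}\times\mathcal{V}\to\mathbb{R}$ ($\sigma$-strongly convex in $u$, concave in $v$): $(\tilde u,\tilde v)$ with $\mathcal{F}(\tilde u,v)\le\mathcal{F}(u,\tilde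 v)-\frac\sigma2\|u-\tilde u\|_2^2+\nu$ for all $(u,v)\in\mathcal{U}\times\mathcal{V}$. Extended ProM$^3$ is the following Extended Outer Algorithm with its $\tilde x$-update computed by the Extended Inner Algorithm. Extended Outer Algorithm. Input: $K\ge1$, $\alpha,\beta,\nu,\theta>0$, $\lambda^0=0$, $x^0\in\mathcal{X}$, $\mu^0\in\mathcal{M}$. For $k=0,\dots,K-1$: (λ-update) for each $m$ find $z_m^k\in\widetilde{\mathcal{Z}}_m$ with $\max_{z_m\in\widetilde{\mathcal{Z}}_m}\tilde g_m((x^k,\mu^k),z_m)\le\tilde g_m((x^k,\mu^k),z_m^k)+\theta$ and set $\lambda_m^{k+1}=[\lambda_m^k+\beta(2\tilde g_m((x^k,\mu^k),z_m^k)-\tilde g_m((x^{k-1},\mu^{k-1}),z_m^{k-1}))]_+$, where $x^{-1}=x^0$, $\mu^{-1}=\mu^0$, $z^{-1}=z^0$; ($\tilde x$-update) compute by the Extended Inner Algorithm a strong $\nu$-approximate saddle point $((x^{k+1},\mu^{k+1}),\tilde z^{k+1})$ (with $\sigma=1/\alpha$) of $\min_{x\in\mathcal{X},\,\mu\in\mathcal{M}}\max_{z\in\widetilde{\mathcal{Z}}}\{f_0(x)+\sum_m\lambda_m^{k+1}(g_m(x,z_m)-\mu_m^\top h_m(z_m))+\frac1{2\alpha}\|x-x^k\|_2^2+\frac1{2\alpha}\|\mu-\mu^k\|_2^2\}$. Output: $\bar x^K=\frac1K\sum_{k=1}^Kx^k$. Extended Inner Algorithm. Input: $T\ge1$, $\delta,\gamma>0$,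 $x_0\in\mathcal{X}$, $\mu_0\in\mathcal{M}$, $z_0\in\widetilde{\mathcal{Z}}$, $\alpha$, $x^k$, $\mu^k$, $\lambda^{k+1}$. For $t=0,\dots,T-1$: for each $m$ and $i\in[I_m]$ compute $\zeta_{t,m}\in\partial_{z_m}(-g_m)(x_t,z_{t,m})$ and $\eta_{t,m,i}\in\partial h_{m,i}(z_{t,m})$, put $\tilde\zeta_{t,m}=\zeta_{t,m}+\sum_{i\in[I_m]}\mu_{t,m,i}\eta_{t,m,i}$ and set $z_{t+1,m}=\mathrm{Proj}_{\widetilde{\mathcal{Z}}_m}(z_{t,m}-\delta\lambda_m^{k+1}(2\tilde\zeta_{t,m}-\tilde\zeta_{t-1,m}))$, with $\tilde\zeta_{-1,m}=\tilde\zeta_{0,m}$; compute $\xi_{t,0}\in\partial f_0(x_t)$, $\xi_{t,m}\in\partial_xg_m(x_t,z_{t+1,m})$, put $\xi_t=\xi_{t,0}+\sum_m\lambda_m^{k+1}\xi_{t,m}$ and set $x_{t+1}=\mathrm{Proj}_{\mathcal{X}}(\frac{\alpha\gamma}{\alpha+\gamma}(\frac1\alpha x^k+\frac1\gamma x_t-\xi_t))$, $\mu_{t+1,m}=\mathrm{Proj}_{[0,a_m]^{I_m}}(\frac{\alpha\gamma}{\alpha+\gamma}(\frac1\alpha\mu_m^k+\frac1\gamma\mu_{t,m}+\lambda_m^{k+1}h_m(z_{t+1,m})))$. Output: $(\bar x_T,\bar\mu_T)=\frac1T\sum_{t=1}^T(x_t,\mu_t)$, $\bar z_T=\frac1T\sum_{t=1}^Tz_t$.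 Parameters: $K,\theta,\nu,\alpha,\beta$ may depend on the problem data and $\varepsilon$; $T,\gamma,\delta$ may in addition depend on the current $\lambda^{k+1}$. Oracles and counting: each subgradient computation for $f_0$, $g_m(\cdot,z_m)$, $-g_m(x,\cdot)$, $h_{m,i}$, each evaluation of $h_{m,i}$, and each projection onto $\mathcal{X}$, $\widetilde{\mathcal{Z}}_m$ or $[0,a_m]^{I_m}$ is one oracle call. Oracle calls are made only within the Extended Inner Algorithm; the points $z_m^k$ of the λ-update are regarded as available without calls to these oracles. *)

(* Defs.v *)
From HB Require Import structures.
From mathcomp Require Import all_boot all_order all_algebra.
From mathcomp Require Import all_classical all_reals all_analysis.

Set Implicit Arguments.
Unset Strict Implicit.
Unset Printing Implicit Defensive.

Import Order.TTheory GRing.Theory Num.Theory.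
Import numFieldNormedType.Exports.

Local Open Scope classical_set_scope.
Local Open Scope ring_scope.

Section ConvexAnalysis.
Context {R : realType}.

Definition dotv n (u v : 'rV[R]_n) : R := \sum_(i < n) u 0 i * v 0 i.

(* The library norm [`|u|] on row vectors is the sup norm, whence: *)
Definition enorm n (u : 'rV[R]_n) : R := Num.sqrt (dotv u u).

Definition dom n (f : 'rV[R]_n -> \bar R) : set 'rV[R]_n :=
  [set x | f x \is a fin_num].

(* Convexity of an extended-real-valued function is convexity of its epigraph,
   so that no convention is needed for +oo - oo. *)
Definition epigraph n (f : 'rV[R]_n -> \bar R) : set ('rV[R]_n * R^o)%type :=
  [set p | (f p.1 <= (p.2 : R)%:E)%E].

Definition econvex n (f : 'rV[R]_n -> \bar R) : Prop :=
  convex_set (epigraph f).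

Definition econcave n (f : 'rV[R]_n -> \bar R) : Prop :=
  econvex (fun x => - f x)%E.

Definition subdiff n (f : 'rV[R]_n -> \bar R) (x : 'rV[R]_n) : set 'rV[R]_n :=
  [set xi | forall y, (f x + (dotv xi (y - x))%:E <= f y)%E].

Definition subdifferentiable_on n (S : set 'rV[R]_n) (f : 'rV[R]_n -> \bar R) :=
  forall x, S x -> subdiff f x !=set0.

(* [S] need not be open. *)
Definition differentiable_on (V : normedModType R) (S : set V)
    (f : V -> \bar R) : Prop :=
  exists U : set V, [/\ open U, S `<=` U &
    forall x, U x ->
      f x \is a fin_num /\ differentiable (fun y => fine (f y) : R^o) x].

Definition grad n (f : 'rV[R]_n -> \bar R) (x : 'rV[R]_n) : 'rV[R]_n :=
  \row_(i < n) 'D_(delta_mx 0 i) (fun y => fine (f y) : R^o) x.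

Definition is_proj n (S : set 'rV[R]_n) (y p : 'rV[R]_n) : Prop :=
  S p /\ forall q, S q -> enorm (y - p) <= enorm (y - q).

(* The value of max_(t in S) F t; it is a supremum when the maximum is not
   attained. *)
Definition max_over (T : Type) (S : set T) (F : T -> \bar R) : \bar R :=
  ereal_sup [set F t | t in S].

(* [sqd u u'] is the squared distance ||u - u'||^2 on the minimization side. *)
Definition strong_saddle (TU TV : Type) (sqd : TU -> TU -> R)
    (U : set TU) (V : set TV) (F : TU -> TV -> R) (sigma nu : R)
    (u0 : TU) (v0 : TV) : Prop :=
  [/\ U u0, V v0 & forall u v, U u -> V v ->
    F u0 v <= F u v0 - sigma / 2 * sqd u u0 + nu].

(* (s 1 + ... + s T) / T *)
Definition average n (T : nat) (s : nat -> 'rV[R]_n) : 'rV[R]_n :=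
  T%:R^-1 *: \sum_(1 <= t < T.+1) s t.

End ConvexAnalysis.

Record problem (R : realType) := Problem {
  M : nat;
  N : nat;
  J : 'I_M -> nat;
  nI : 'I_M -> nat;
  X : set 'rV[R]_N;
  Zt : forall m : 'I_M, set 'rV[R]_(J m);
  f0 : 'rV[R]_N -> \bar R;
  g : forall m : 'I_M, 'rV[R]_N -> 'rV[R]_(J m) -> \bar R;
  h : forall m : 'I_M, 'I_(nI m) -> 'rV[R]_(J m) -> \bar R
}.

Arguments M {R} P : rename.
Arguments N {R} P : rename.
Arguments J {R P} m : rename.
Arguments nI {R P} m : rename.
Arguments X {R} P : rename.
Arguments Zt {R P} m : rename.
Arguments f0 {R} P : rename.
Arguments g {R P} m : rename.
Arguments h {R P} m i : rename.

Section RobustProblem.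
Context {R : realType}.
Variable P : problem R.

Definition xvec := 'rV[R]_(N P).
Definition zvec := forall m : 'I_(M P), 'rV[R]_(J m).
Definition muvec := forall m : 'I_(M P), 'rV[R]_(nI m).
Definition lamvec := 'rV[R]_(M P).

Definition Zrob (m : 'I_(M P)) : set 'rV[R]_(J m) :=
  Zt m `&` \bigcap_(i in [set: 'I_(nI m)]) [set z | (h m i z <= 0)%E].

Arguments Zrob m : clear implicits.

Definition frob (m : 'I_(M P)) (x : xvec) : \bar R :=
  max_over (Zrob m) (fun z => g m x z).

Definition feasible (x : xvec) : Prop :=
  X P x /\ forall m, (frob m x <= 0)%E.

Definition optimal (x : xvec) : Prop :=
  feasible x /\ forall y, feasible y -> (f0 P x <= f0 P y)%E.

Definition eps_optimal (xstar : xvec) (eps : R) (x : xvec) : Prop :=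
  [/\ X P x, (f0 P x - f0 P xstar <= eps%:E)%E
    & (\big[maxe/0]_(m < M P) maxe (frob m x) 0 <= eps%:E)%E].

Definition abound (zbar : zvec) (G : 'I_(M P) -> R) (m : 'I_(M P)) : R :=
  G m / fine (\big[maxe/-oo%E]_(i < nI m) h m i (zbar m)).

Definition box (a : 'I_(M P) -> R) (m : 'I_(M P)) : set 'rV[R]_(nI m) :=
  [set u | forall i, 0 <= u 0 i <= a m].

Arguments box a m : clear implicits.

Definition Mbox (a : 'I_(M P) -> R) : set muvec :=
  [set mu | forall m, box a m (mu m)].

Definition Ztprod : set zvec := [set z | forall m, Zt m (z m)].

Definition hvec (m : 'I_(M P)) (z : 'rV[R]_(J m)) : 'rV[R]_(nI m) :=
  \row_i fine (h m i z).

(* Only meant for x in X and z in Zt m, where g and h are finite. *)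
Definition gtilde (x : xvec) (mu : muvec) (m : 'I_(M P)) (z : 'rV[R]_(J m)) :
    R :=
  fine (g m x z) - dotv (mu m) (hvec z).

Definition sqdist (u v : xvec * muvec) : R :=
  enorm (u.1 - v.1) ^+ 2 + \sum_m enorm (u.2 m - v.2 m) ^+ 2.

Definition prox_lagrangian (alpha : R) (lam : lamvec) (xk : xvec) (muk : muvec)
    (u : xvec * muvec) (z : zvec) : R :=
  fine (f0 P u.1) + \sum_m lam 0 m * gtilde u.1 u.2 (z m)
  + (2 * alpha)^-1 * sqdist u (xk, muk).

End RobustProblem.

Arguments Zrob {R P} m.
Arguments box {R P} a m.
Arguments Ztprod {R} P.
Arguments sqdist {R} P.

Section ExtendedProM3.
Context {R : realType}.
Variable P : problem R.
Variable a : 'I_(M P) -> R.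

Record params := Params {
  pK : nat;
  palpha : R;
  pbeta : R;
  pnu : R;
  ptheta : R;
  pT : lamvec P -> nat;
  pgamma : lamvec P -> R;
  pdelta : lamvec P -> R
}.

Definition valid_params (p : params) : Prop :=
  [/\ (1 <= pK p)%N,
      [/\ 0 < palpha p, 0 < pbeta p, 0 < pnu p & 0 < ptheta p]
    & forall lam, [/\ (1 <= pT p lam)%N, 0 < pgamma p lam & 0 < pdelta p lam]].

Record inner_trace := InnerTrace {
  ix : nat -> xvec P;
  imu : nat -> muvec P;
  iz : nat -> zvec P;
  izeta : nat -> zvec P;
  ieta : nat -> forall m : 'I_(M P), 'I_(nI m) -> 'rV[R]_(J m);
  ixi0 : nat -> xvec P;
  ixi : nat -> 'I_(M P) -> xvec P
}.

Definition zetat (s : inner_trace) (t : nat) (m : 'I_(M P)) : 'rV[R]_(J m) :=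
  izeta s t m + \sum_i imu s t m 0 i *: ieta s t i.

Definition xit (lam : lamvec P) (s : inner_trace) (t : nat) : xvec P :=
  ixi0 s t + \sum_m lam 0 m *: ixi s t m.

(* The index -1 means index 0 here, which is what [t.-1] gives at [t = 0]. *)
Definition inner_step (alpha gamma delta : R) (lam : lamvec P) (xk : xvec P)
    (muk : muvec P) (s : inner_trace) (t : nat) : Prop :=
  let c := alpha * gamma / (alpha + gamma) in
  [/\ forall m : 'I_(M P),
        [/\ subdiff (fun z => - g m (ix s t) z)%E (iz s t m) (izeta s t m),
            forall i : 'I_(nI m), subdiff (h m i) (iz s t m) (ieta s t i)
          & is_proj (Zt m)
              (iz s t m
               - (delta * lam 0 m) *: (2 *: zetat s t m - zetat s t.-1 m))
              (iz s t.+1 m)],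
      subdiff (f0 P) (ix s t) (ixi0 s t),
      forall m : 'I_(M P),
        subdiff (fun x => g m x (iz s t.+1 m)) (ix s t) (ixi s t m),
      is_proj (X P)
        (c *: (alpha^-1 *: xk + gamma^-1 *: ix s t - xit lam s t))
        (ix s t.+1)
    & forall m : 'I_(M P),
        is_proj (box a m)
          (c *: (alpha^-1 *: muk m + gamma^-1 *: imu s t m
                 + lam 0 m *: hvec (iz s t.+1 m)))
          (imu s t.+1 m)].

Definition inner_run (T : nat) (alpha gamma delta : R) (lam : lamvec P)
    (xk : xvec P) (muk : muvec P) (s : inner_trace) : Prop :=
  [/\ X P (ix s 0), Mbox a (imu s 0), Ztprod P (iz s 0)
    & forall t, (t < T)%N -> inner_step alpha gamma delta lam xk muk s t].

Definition inner_x (T : nat) (s : inner_trace) : xvec P := average T (ix s).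
Definition inner_mu (T : nat) (s : inner_trace) : muvec P :=
  fun m => average T (fun t => imu s t m).
Definition inner_z (T : nat) (s : inner_trace) : zvec P :=
  fun m => average T (fun t => iz s t m).

Record trace := Trace {
  ox : nat -> xvec P;
  omu : nat -> muvec P;
  oz : nat -> zvec P;
  olam : nat -> lamvec P;
  oin : nat -> inner_trace
}.

Definition outer_step (p : params) (r : trace) (k : nat) : Prop :=
  let lam := olam r k.+1 in
  [/\ forall m : 'I_(M P),
        Zt m (oz r k m) /\
        (max_over (Zt m) (fun z => (gtilde (ox r k) (omu r k) z)%:E)
         <= (gtilde (ox r k) (omu r k) (oz r k m) + ptheta p)%:E)%E,
      forall m : 'I_(M P),
        lam 0 m = Num.max
          (olam r k 0 m
           + pbeta p * (2 * gtilde (ox r k) (omu r k) (oz r k m)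
                        - gtilde (ox r k.-1) (omu r k.-1) (oz r k.-1 m))) 0,
      inner_run (pT p lam) (palpha p) (pgamma p lam) (pdelta p lam)
        lam (ox r k) (omu r k) (oin r k),
      ox r k.+1 = inner_x (pT p lam) (oin r k)
    & omu r k.+1 = inner_mu (pT p lam) (oin r k)].

(* The starting points, subgradients and theta-maximizers of a run are
   arbitrary among the admissible ones. *)
Definition prom3_run (p : params) (r : trace) : Prop :=
  [/\ olam r 0 = 0, X P (ox r 0), Mbox a (omu r 0)
    & forall k, (k < pK p)%N -> outer_step p r k].

Definition output (p : params) (r : trace) : xvec P := average (pK p) (ox r).

Definition saddle_updates (p : params) (r : trace) : Prop :=
  forall k, (k < pK p)%N ->
    strong_saddle (sqdist P) (X P `*` Mbox a) (Ztprod P)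
      (prox_lagrangian (palpha p) (olam r k.+1) (ox r k) (omu r k))
      (palpha p)^-1 (pnu p)
      (ox r k.+1, omu r k.+1)
      (inner_z (pT p (olam r k.+1)) (oin r k)).

(* Per inner iteration: for f0 and X, one subgradient and one projection; for
   each m, one subgradient of - g_m(x, .) and one of g_m(., z), nI m subgradients
   and nI m values of the h_(m,i), one projection onto Zt m and one onto the
   box. *)
Definition calls_per_step : nat :=
  (2 + \sum_(m < M P) (2 + nI m + nI m + 2))%N.

Definition oracle_calls (p : params) (r : trace) : nat :=
  (\sum_(k < pK p) pT p (olam r k.+1) * calls_per_step)%N.

(* The constants C and eps0 are uniform in eps and in the run; the parameters
   may depend on eps, but not on the run except through lambda. The conjunct on
   existence of runs says that no step of the algorithm can get stuck. *)
Definition oracle_complexity (xstar : xvec P) (q : nat) : Prop :=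
  exists C eps0 : R, [/\ 0 < C, 0 < eps0 &
    forall eps : R, 0 < eps ->
      exists p : params, [/\ valid_params p,
        forall x mu, X P x -> Mbox a mu ->
          exists r, [/\ prom3_run p r, ox r 0 = x & omu r 0 = mu]
      & forall r, prom3_run p r ->
          [/\ saddle_updates p r, eps_optimal xstar eps (output p r)
            & eps <= eps0 -> (oracle_calls p r)%:R <= C * eps ^- q]]].

End ExtendedProM3.

Section Assumptions.
Context {R : realType}.
Variable P : problem R.

Definition bounded_subgradients : Prop :=
  exists (D0 : R) (D E F : 'I_(M P) -> R),
    [/\ 0 < D0, forall m, [/\ 0 < D m, 0 < E m & 0 < F m] &
    [/\ forall x xi, X P x -> subdiff (f0 P) x xi -> enorm xi <= D0,
        forall (m : 'I_(M P)) x (z : 'rV[R]_(J m)) xi, X P x -> Zt m z ->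
          subdiff (fun y => g m y z) x xi -> enorm xi <= D m,
        forall (m : 'I_(M P)) x (z : 'rV[R]_(J m)) zeta, X P x -> Zt m z ->
          subdiff (fun w => - g m x w)%E z zeta -> enorm zeta <= E m
      & forall (m : 'I_(M P)) (i : 'I_(nI m)) (z eta : 'rV[R]_(J m)), Zt m z ->
          subdiff (h m i) z eta -> enorm eta <= F m]].

Definition nonsmooth_case : Prop :=
  [/\ subdifferentiable_on (X P) (f0 P),
      forall (m : 'I_(M P)) x (z : 'rV[R]_(J m)), X P x -> Zt m z ->
        subdifferentiable_on (X P) (fun y => g m y z) /\
        subdifferentiable_on (Zt m) (fun w => - g m x w)%E,
      forall (m : 'I_(M P)) (i : 'I_(nI m)),
        subdifferentiable_on (Zt m) (h m i)
    & bounded_subgradients].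

Definition lipschitz_gradients : Prop :=
  exists (D0 : R) (D E1 E2 F : 'I_(M P) -> R),
    [/\ 0 < D0, forall m, [/\ 0 < D m, 0 < E1 m, 0 < E2 m & 0 < F m] &
    [/\ forall x x', X P x -> X P x' ->
          enorm (grad (f0 P) x - grad (f0 P) x') <= D0 * enorm (x - x'),
        forall (m : 'I_(M P)) x x' (z : 'rV[R]_(J m)),
          X P x -> X P x' -> Zt m z ->
          enorm (grad (fun y => g m y z) x - grad (fun y => g m y z) x')
            <= D m * enorm (x - x'),
        forall (m : 'I_(M P)) x x' (z z' : 'rV[R]_(J m)),
          X P x -> X P x' -> Zt m z -> Zt m z' ->
          enorm (grad (fun w => g m x w) z - grad (fun w => g m x' w) z')
            <= E1 m * enorm (x - x') + E2 m * enorm (z - z')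
      & forall (m : 'I_(M P)) (i : 'I_(nI m)) (z z' : 'rV[R]_(J m)),
          Zt m z -> Zt m z' ->
          enorm (grad (h m i) z - grad (h m i) z') <= F m * enorm (z - z')]].

Definition smooth_case : Prop :=
  [/\ differentiable_on (X P) (f0 P),
      forall m : 'I_(M P),
        differentiable_on (X P `*` Zt m) (fun p => g m p.1 p.2),
      forall (m : 'I_(M P)) (i : 'I_(nI m)),
        differentiable_on (Zt m) (h m i)
    & lipschitz_gradients].

End Assumptions.

(* Main.v *)
Require Import Defs.
From HB Require Import structures.
From mathcomp Require Import all_boot all_order all_algebra.
From mathcomp Require Import all_classical all_reals all_analysis.
From mathcomp Require Import ring lra.

Set Implicit Arguments.
Unset Strict Implicit.
Unset Printing Implicit Defensive.

Import Order.TTheory GRing.Theory Num.Theory.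
Import numFieldNormedType.Exports.

Local Open Scope classical_set_scope.
Local Open Scope ring_scope.


(** The idea.  Lagrangian duality over each [Zt m] turns the robust problem into
    the minimization of [f0] over [X P * Mbox a] under the convex constraints
    [worst (x, mu) m <= 0], the maximum of [gtilde x mu] over [Zt m]: the Slater
    point [zbar m] confines the multipliers [mu m] of a feasible point to the box.
    The Slater point in [x] gives multipliers [ls] for these constraints.

    The lambda-update is projected ascent on the extrapolated value
    [2 F_k - F_(k-1)], where [F_k] is [worst] at iterate [k]; the extrapolation
    makes the coupling terms [<l - lam_k, F_k - F_(k-1)>] telescope, so that
    [sum_(k <= K) (f0 x_k - f0 xstar + <l, F_k>)] stays bounded up to [K * eps / 2].
    Taking [l = ls] bounds all the multipliers of the run uniformly; taking [l = 0]
    and [l = ls + delta_j] shows that the averages are [eps]-optimal for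
    [K = O(1 / eps)].

    The inner loop extrapolates the subgradients in [z] and obeys the same
    telescoping inequality.  If subgradients are Lipschitz, a constant step size
    makes the proximal terms absorb the remainders and the averaged gap is
    [O(1 / T)]; if they are only bounded, steps of order [1 / sqrt T] give
    [O(1 / sqrt T)].  The required accuracy [eps / 4] is thus reached with
    [T = n ^ (1 + E)] for some [n = O(1 / eps)], where [E] is [0] or [1]. *)

(** * Euclidean geometry and convex sets *)

(** The obstacle is uniformity in [eps]. The constants of the inner loop grow with the multipliers,
    so a bound on these that grew with the number [K] of outer steps would spoil the exponent of the
    total count. The only a priori bound does grow like [K], and it enters through the errors of the
    [theta]-maximizers, which are weighted by the multipliers. The circle is broken by choosing
    [theta] after [K], so small that the crude bound costs at most [eps / 4] per outer step. The
    telescoped inequality, in which half of the dual distance to [ls] is retained, then returns a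
    bound free of both [K] and [eps] for [eps <= 1].

    Since the inner parameters may depend on the current multipliers, the accuracy of the inner loop
    is guaranteed for each of them separately; the uniform bound enters only in the count of oracle
    calls. *)

Section Euclid.
Context {R : realType} {n : nat}.
Implicit Types (u v w : 'rV[R]_n) (c : R).

Lemma dotvC u v : dotv u v = dotv v u.
Proof. by apply: eq_bigr => i _; rewrite mulrC. Qed.

Lemma dotvDl u v w : dotv (u + v) w = dotv u w + dotv v w.
Proof. by rewrite /dotv -big_split; apply: eq_bigr => i _; rewrite mxE mulrDl. Qed.

Lemma dotvZl c u v : dotv (c *: u) v = c * dotv u v.
Proof. by rewrite /dotv mulr_sumr; apply: eq_bigr => i _; rewrite mxE mulrA. Qed.

Lemma dotvNl u v : dotv (- u) v = - dotv u v.
Proof. by rewrite -scaleN1r dotvZl mulN1r. Qed.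

Lemma dotvDr u v w : dotv u (v + w) = dotv u v + dotv u w.
Proof. by rewrite dotvC dotvDl !(dotvC u). Qed.

Lemma dotvZr c u v : dotv u (c *: v) = c * dotv u v.
Proof. by rewrite dotvC dotvZl dotvC. Qed.

Lemma dotvNr u v : dotv u (- v) = - dotv u v.
Proof. by rewrite dotvC dotvNl dotvC. Qed.

Definition dotvE := (dotvDl, dotvDr, dotvNl, dotvNr, dotvZl, dotvZr).

Lemma dotv0l v : dotv 0 v = 0.
Proof. by rewrite -(scale0r 0) dotvZl mul0r. Qed.

Lemma dotv0r v : dotv v 0 = 0.
Proof. by rewrite dotvC dotv0l. Qed.

Lemma dotv_subZ u v c :
  dotv (u - c *: v) (u - c *: v) =
  dotv u u - 2 * c * dotv u v + c ^+ 2 * dotv v v.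
Proof. by rewrite !dotvE (dotvC v u); ring. Qed.

Lemma dotv_suml (I : finType) (F : I -> 'rV[R]_n) v :
  dotv (\sum_i F i) v = \sum_i dotv (F i) v.
Proof.
elim/big_ind2: _ => [|x a y b <- <-|//]; first exact: dotv0l.
exact: dotvDl.
Qed.

Lemma dotvv_ge0 u : 0 <= dotv u u.
Proof. by apply: sumr_ge0 => i _; rewrite -expr2 sqr_ge0. Qed.

Lemma dotvv_eq0 u : dotv u u = 0 -> u = 0.
Proof.
move=> /eqP; rewrite psumr_eq0 => [/allP u0|i _]; last by rewrite -expr2 sqr_ge0.
apply/rowP => i; rewrite mxE.
by have := u0 i; rewrite mem_index_enum => /(_ isT); rewrite mulf_eq0 orbb => /eqP.
Qed.

Lemma enorm_ge0 u : 0 <= enorm u.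
Proof. exact: sqrtr_ge0. Qed.

Lemma sqr_enorm u : enorm u ^+ 2 = dotv u u.
Proof. by rewrite sqr_sqrtr ?dotvv_ge0. Qed.

Lemma enorm0 : enorm (0 : 'rV[R]_n) = 0.
Proof. by rewrite /enorm dotv0l sqrtr0. Qed.

Lemma cauchy_schwarz u v : dotv u v <= enorm u * enorm v.
Proof.
have [u0|u0] := eqVneq (enorm u) 0.
  have /dotvv_eq0 -> : dotv u u = 0 by rewrite -sqr_enorm u0 expr0n.
  by rewrite dotv0l enorm0 mul0r.
have ug : 0 < enorm u by rewrite lt_neqAle eq_sym u0 enorm_ge0.
have [v0|v0] := eqVneq (enorm v) 0.
  have /dotvv_eq0 -> : dotv v v = 0 by rewrite -sqr_enorm v0 expr0n.
  by rewrite dotv0r enorm0 mulr0.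
have vg : 0 < enorm v by rewrite lt_neqAle eq_sym v0 enorm_ge0.
have := dotvv_ge0 (enorm v *: u - enorm u *: v).
rewrite !dotvE -!sqr_enorm (dotvC v u) => h.
rewrite -(ler_pM2l (mulr_gt0 ug vg)); nra.
Qed.

Lemma enormN u : enorm (- u) = enorm u.
Proof. by rewrite /enorm !dotvE opprK. Qed.

Lemma enormB u v : enorm (u - v) = enorm (v - u).
Proof. by rewrite -enormN opprB. Qed.

Lemma enormZ c u : enorm (c *: u) = `|c| * enorm u.
Proof.
by rewrite /enorm !dotvE mulrA -expr2 sqrtrM ?sqr_ge0// sqrtr_sqr.
Qed.

Lemma ler_enormD u v : enorm (u + v) <= enorm u + enorm v.
Proof.
rewrite -(@ler_pXn2r _ 2)// ?nnegrE ?addr_ge0 ?enorm_ge0//.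
rewrite sqr_enorm !dotvE sqrrD !sqr_enorm (dotvC v u).
have := cauchy_schwarz u v; lra.
Qed.

Lemma ler_enorm_sum (I : finType) (F : I -> 'rV[R]_n) :
  enorm (\sum_i F i) <= \sum_i enorm (F i).
Proof.
elim/big_ind2: _ => [|x a y b xa yb|//]; first by rewrite enorm0.
by rewrite (le_trans (ler_enormD _ _))// lerD.
Qed.

Lemma ler_coord_enorm u i : `|u 0 i| <= enorm u.
Proof.
rewrite -sqrtr_sqr ler_sqrt ?dotvv_ge0// /dotv (bigD1 i)//= -expr2 lerDl.
by apply: sumr_ge0 => j _; rewrite -expr2 sqr_ge0.
Qed.

Lemma enorm_continuous : continuous (@enorm R n).
Proof.
have dc : continuous (fun u : 'rV[R]_n => dotv u u).
  apply: continuous_big; first exact: add_continuous.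
  by move=> i _ x; apply: continuousM; exact: (@coord_continuous R _ _ 0 i).
by move=> u; apply: continuous_comp; [exact: dc|exact: sqrt_continuous].
Qed.

End Euclid.

Section ConvexSets.
Context {R : realType} {n : nat}.
Implicit Types (S : set 'rV[R]_n) (u v p q : 'rV[R]_n).

Lemma convex_comb S (t : R) u v : convex_set S -> 0 <= t <= 1 ->
  S u -> S v -> S (t *: u + (1 - t) *: v).
Proof.
move=> cS /andP[t0 t1] Su Sv.
pose k : {i01 R} := Itv01 t0 t1.
by have := cS u v k; rewrite !inE => /(_ Su Sv).
Qed.

Lemma convex_average S T (s : nat -> 'rV[R]_n) : convex_set S -> (0 < T)%N ->
  (forall t, (0 < t <= T)%N -> S (s t)) -> S (average T s).
Proof.
move=> cS; rewrite /average; elim: T => // T IH _ sS.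
have [->|T0] := posnP T; first by rewrite big_nat1 invr1 scale1r; exact: sS.
have T0R : (T%:R : R) != 0 by rewrite pnatr_eq0 -lt0n.
have T1R : (1 + T%:R : R) != 0 by rewrite nat1r pnatr_eq0.
rewrite big_nat_recr//= scalerDr.
have -> : T.+1%:R^-1 *: \sum_(1 <= t < T.+1) s t =
    (T%:R / T.+1%:R) *: (T%:R^-1 *: \sum_(1 <= t < T.+1) s t) :> 'rV[R]_n.
  by rewrite scalerA mulrAC divff// mul1r.
rewrite [X in _ + X *: s _](_ : _ = 1 - T%:R / T.+1%:R); last first.
  by rewrite -natr1; field; rewrite addrC.
apply: convex_comb => //; last by apply: sS; rewrite leqnn.
  by rewrite divr_ge0//= ler_pdivrMr ?mul1r ?ler_nat ?ltr0n.
by apply: IH => // t /andP[t0 tT]; apply: sS; rewrite t0 ltnW.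
Qed.

(** Convexity is asked of a real function on [S] only, so that one induction serves [fine] values of
    extended functions, negated concave functions and squared distances. The average of [T.+1]
    points combines the average of [T] points, with weight [T / T.+1], and the last point. *)
Lemma jensen_average S T (s : nat -> 'rV[R]_n) (f : 'rV[R]_n -> R) :
    convex_set S -> (0 < T)%N ->
    (forall t u v, 0 <= t <= 1 -> S u -> S v ->
      f (t *: u + (1 - t) *: v) <= t * f u + (1 - t) * f v) ->
    (forall t, (0 < t <= T)%N -> S (s t)) ->
  f (average T s) <= T%:R^-1 * \sum_(1 <= t < T.+1) f (s t).
Proof.
move=> cS T0 cf; elim: T T0 => // T IH _ sS.
have [->|T0] := posnP T.
  by rewrite /average !big_nat1 invr1 scale1r mul1r.
have T0R : (T%:R : R) != 0 by rewrite pnatr_eq0 -lt0n.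
have T1R : (1 + T%:R : R) != 0 by rewrite nat1r pnatr_eq0.
have sT t : (0 < t <= T)%N -> S (s t).
  by move=> /andP[t0 tT]; apply: sS; rewrite t0 ltnW.
have := cf (T%:R / T.+1%:R) (average T s) (s T.+1).
have -> : 1 - T%:R / T.+1%:R = T.+1%:R^-1 :> R.
  by rewrite -natr1; field; rewrite addrC.
have -> : T%:R / T.+1%:R *: average T s + T.+1%:R^-1 *: s T.+1 = average T.+1 s.
  rewrite /average [in RHS]big_nat_recr//= [in RHS]scalerDr; congr (_ + _).
  by rewrite scalerA mulrAC divff// mul1r.
move=> h; apply: le_trans (h _ _ _) _.
- by rewrite divr_ge0//= ler_pdivrMr ?mul1r ?ler_nat ?ltr0n.
- exact: convex_average.
- by apply: sS; rewrite leqnn.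
rewrite big_nat_recr//= mulrDr lerD2r.
have -> : T.+1%:R^-1 * \sum_(1 <= t < T.+1) f (s t) =
    (T%:R / T.+1%:R) * (T%:R^-1 * \sum_(1 <= t < T.+1) f (s t)).
  by rewrite mulrA; congr (_ * _); field; rewrite T0R/= nat1r pnatr_eq0.
apply: ler_wpM2l; [by rewrite divr_ge0|exact: IH].
Qed.

Lemma compact_diameter S : compact S ->
  exists2 d : R, 0 < d & forall u v, S u -> S v -> enorm (u - v) <= d.
Proof.
move=> cS; have [[u0 Su0]|S0] := pselect (S !=set0); last first.
  by exists 1 => // u v Su; case: S0; exists u.
have /= [|||w _ wmax] := @compact_EVT_max _ _ (@enorm R n) S => //.
- by exists u0.
- exact/continuous_subspaceT/enorm_continuous.
exists (enorm w + enorm w + 1) => [|u v Su Sv].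
  by rewrite ltr_wpDl// addr_ge0 ?enorm_ge0.
rewrite (le_trans (ler_enormD _ _))// enormN ler_wpDr// lerD// wmax//; exact: mem_set.
Qed.

Lemma is_proj_exists S y : S !=set0 -> compact S -> exists p, is_proj S y p.
Proof.
move=> S0 cS; have /= [|p pS pmin] := @compact_EVT_min _ _ (fun q => enorm (y - q)) S S0 cS.
  apply/continuous_subspaceT => q; apply: continuous_comp; last exact: enorm_continuous.
  by apply: continuousB => //; exact: cst_continuous.
by exists p; split=> [|q Sq]; [exact: set_mem | apply: pmin; exact: mem_set].
Qed.

(** Moving from [p] towards [q] by [t] changes the squared distance to [y] by [- 2 t d + t ^ 2 b],
    which is negative for small [t] if [d > 0]. *)
Lemma is_proj_variational S y p q : convex_set S -> is_proj S y p -> S q ->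
  dotv (y - p) (q - p) <= 0.
Proof.
move=> cS [Sp pmin] Sq; rewrite leNgt; apply/negP => d0.
set d := dotv _ _ in d0; set b := dotv (q - p) (q - p).
have b0 : 0 <= b by exact: dotvv_ge0.
have key t : 0 < t <= 1 -> 2 * d <= t * b.
  move=> /andP[t0 t1].
  have /pmin : S (t *: q + (1 - t) *: p).
    by apply: convex_comb => //; rewrite t1 ltW.
  rewrite -(@ler_pXn2r _ 2)// ?nnegrE ?enorm_ge0// !sqr_enorm.
  have -> : y - (t *: q + (1 - t) *: p) = (y - p) - t *: (q - p).
    by apply/rowP => i; rewrite !mxE; ring.
  by rewrite dotv_subZ -/d -/b -subr_ge0 => h; rewrite -(ler_pM2l t0); lra.
have b1 : 0 < b + 1 by lra.
(* [b + 1] avoids a zero denominator; this [t] gives [t * b < d], against [2 * d <= t * b]. *)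
pose t := Num.min 1 (d / (b + 1)).
have t0 : 0 < t by rewrite lt_min ltr01 divr_gt0.
have t1 : t <= 1 by rewrite ge_min lexx.
have td : t * (b + 1) <= d by rewrite -ler_pdivlMr// ge_min lexx orbT.
by have := key t; rewrite t0 t1 => /(_ isT); nra.
Qed.

End ConvexSets.

(** * Multipliers and telescoping *)

Section ConvexFarkas.
Context {R : realType} {U : Type}.
(* No law is required of [comb]: this covers [xvec P * muvec P], which has no
   canonical module structure. *)
Variable comb : R -> U -> U -> U.
Implicit Types (C : set U) (phi psi : U -> R).

Definition comb_closed C := forall t u v, 0 <= t <= 1 -> C u -> C v ->
  C (comb t u v).

Definition comb_convex C phi := forall t u v, 0 <= t <= 1 -> C u -> C v ->
  phi (comb t u v) <= t * phi u + (1 - t) * phi v.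

Lemma comb_convexD C phi psi (c : R) : 0 <= c ->
  comb_convex C phi -> comb_convex C psi ->
  comb_convex C (fun u => phi u + c * psi u).
Proof.
move=> c0 cphi cpsi t u v t01 Cu Cv.
have h1 := cphi t u v t01 Cu Cv; have h2 := cpsi t u v t01 Cu Cv.
by have := ler_wpM2l c0 h2; lra.
Qed.

(* The multiplier is the largest slope [- phi0 u / phi u] over [phi u > 0]; by
   convexity it lies below all the slopes [phi0 v / - phi v] over [phi v < 0]. *)
Lemma one_multiplier C phi0 phi : comb_closed C ->
    comb_convex C phi0 -> comb_convex C phi ->
    (exists2 u, C u & phi u < 0) ->
    (forall u, C u -> phi u <= 0 -> 0 <= phi0 u) ->
  exists2 l : R, 0 <= l & forall u, C u -> 0 <= phi0 u + l * phi u.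
Proof.
move=> cC cphi0 cphi [s Cs s0] h0.
have cross u v : C u -> 0 < phi u -> C v -> phi v < 0 ->
    - phi0 u / phi u <= phi0 v / - phi v.
  move=> Cu u0 Cv v0.
  have d0 : 0 < phi u - phi v by lra.
  (* The weight at which the upper bound [t * phi u + (1 - t) * phi v] vanishes, so that the
     combination is feasible. *)
  pose t := - phi v / (phi u - phi v).
  have tE : 1 - t = phi u / (phi u - phi v) by rewrite /t; field; lra.
  have t01 : 0 <= t <= 1.
    have : 0 <= 1 - t by rewrite tE divr_ge0//; lra.
    have : 0 <= t by rewrite /t divr_ge0//; lra.
    by lra.
  have le0 : phi (comb t u v) <= 0.
    apply: le_trans (cphi _ _ _ t01 Cu Cv) _; rewrite tE /t le_eqVlt.
    by apply/orP; left; apply/eqP; field; lra.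
  have := le_trans (h0 _ (cC _ _ _ t01 Cu Cv) le0) (cphi0 _ _ _ t01 Cu Cv).
  rewrite tE /t => h.
  rewrite ler_pdivrMr// mulrAC ler_pdivlMr; last lra.
  have := mulr_ge0 (ltW d0) h.
  rewrite [X in 0 <= X -> _](_ : _ = - phi v * phi0 u + phi u * phi0 v); last by field; lra.
  by lra.
(* Including [0] makes the supremum non-negative, and keeps [A] non-empty when no point violates the
   constraint. *)
pose A : set R := [set r | r = 0 \/ exists u, [/\ C u, 0 < phi u & r = - phi0 u / phi u]].
have A0 : A 0 by left.
have ubA v : C v -> phi v < 0 -> ubound A (phi0 v / - phi v).
  move=> Cv v0 r [->|[u [Cu u0 ->]]]; last exact: cross.
  by rewrite divr_ge0 ?oppr_ge0 ?(ltW v0)// h0// ltW.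
have supA : has_sup A by split; [exists 0|exists (phi0 s / - phi s); exact: ubA].
exists (sup A) => [|u Cu]; first exact: (ub_le_sup supA.2).
have [u0|u0|u0] := ltgtP (phi u) 0.
- have : sup A <= phi0 u / - phi u by apply: ge_sup => //; [exists 0|exact: ubA].
  by rewrite ler_pdivlMr ?oppr_gt0//; lra.
- have : - phi0 u / phi u <= sup A by apply: (ub_le_sup supA.2); right; exists u.
  by rewrite ler_pdivrMr//; lra.
- by rewrite u0 mulr0 addr0 h0// u0.
Qed.

(** Induction on the number of constraints: [one_multiplier] prices the first constraint over the
    set [C'] where the others hold, and the induction hypothesis treats the others over [C] with the
    priced objective [phi0 + l * phi ord0]. The strictly feasible point serves both times. *)
Lemma convex_multipliers n C phi0 (phi : 'I_n -> U -> R) : comb_closed C ->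
    comb_convex C phi0 -> (forall i, comb_convex C (phi i)) ->
    (exists2 u, C u & forall i, phi i u < 0) ->
    (forall u, C u -> (forall i, phi i u <= 0) -> 0 <= phi0 u) ->
  exists2 l : 'rV[R]_n, (forall i, 0 <= l 0 i) &
    forall u, C u -> 0 <= phi0 u + \sum_i l 0 i * phi i u.
Proof.
elim: n phi0 phi => [|n IH] phi0 phi cC cphi0 cphi [s Cs s0] h0.
  exists 0 => [i|u Cu]; first by rewrite mxE.
  by rewrite big_ord0 addr0 h0// => -[].
pose C' := C `&` [set u | forall i, phi (lift ord0 i) u <= 0].
have [||||| l l0 lh] := @one_multiplier C' phi0 (phi ord0).
- move=> t u v t01 [Cu u0] [Cv v0]; split=> [|i]; first exact: cC.
  apply: le_trans (cphi _ _ _ _ t01 Cu Cv) _.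
  by have := u0 i; have := v0 i; case/andP: t01 => ? ?; nra.
- by move=> t u v t01 [Cu _] [Cv _]; exact: cphi0.
- by move=> t u v t01 [Cu _] [Cv _]; exact: cphi.
- by exists s; [split=> // i; rewrite ltW|].
- move=> u [Cu ui] u0; apply: h0 => // i.
  by case: (unliftP ord0 i) => [j|] ->; [exact: ui|].
have [||||| m m0 mh] := IH (fun u => phi0 u + l * phi ord0 u) (fun i => phi (lift ord0 i)).
- by [].
- exact: comb_convexD.
- by move=> i; exact: cphi.
- by exists s.
- by move=> u Cu ui; apply: lh.
exists (\row_i (if unlift ord0 i is Some j then m 0 j else l)) => [i|u Cu].
  by rewrite mxE; case: unlift.
rewrite big_ord_recl mxE unlift_none addrA.
have := mh u Cu; congr (0 <= _ + _); apply: eq_bigr => i _.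
by rewrite mxE liftK.
Qed.

End ConvexFarkas.

Section Telescoping.
Context {R : realType}.

(* The extrapolation [2 F_k - F_(k-1)] of a primal-dual scheme turns the coupling
   term into the telescoping differences of [c] and a remainder
   [V (p k + q k) q_(k+1)] that the proximal terms [p], [q] absorb. *)
Lemma primal_dual_telescope (n : nat) (k1 k2 m1 m2 V tau : R)
    (r a b c p q : nat -> R) :
  0 <= V -> V / 2 <= m1 -> 3 * V / 2 <= m2 -> p 0%N = 0 -> q 0%N = 0 ->
  (forall k, (k < n)%N ->
    r k.+1 <= k1 * (a k - a k.+1) + k2 * (b k - b k.+1)
      - m1 * p k.+1 ^+ 2 - m2 * q k.+1 ^+ 2 + (c k.+1 - c k)
      + V * (p k + q k) * q k.+1 + tau) ->
  \sum_(1 <= k < n.+1) r k <=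
    k1 * (a 0%N - a n) + k2 * (b 0%N - b n) + (c n - c 0%N) + n%:R * tau.
Proof.
move=> V0 Vm1 Vm2 p0 q0.
(* The induction carries [V / 2] times the last squares, which pay for the two Young terms of the
   next step. On [q] this uses up [3 * V / 2]: two halves of [V] for Young's inequality and one to
   carry. *)
suff H : (forall k, (k < n)%N -> r k.+1 <= k1 * (a k - a k.+1) + k2 * (b k - b k.+1)
      - m1 * p k.+1 ^+ 2 - m2 * q k.+1 ^+ 2 + (c k.+1 - c k)
      + V * (p k + q k) * q k.+1 + tau) ->
  \sum_(1 <= k < n.+1) r k + V / 2 * (p n ^+ 2 + q n ^+ 2) <=
    k1 * (a 0%N - a n) + k2 * (b 0%N - b n) + (c n - c 0%N) + n%:R * tau.
  move=> /H; apply: le_trans; rewrite lerDl.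
  by rewrite mulr_ge0 ?divr_ge0 ?addr_ge0 ?sqr_ge0.
elim: n => [_|n IH h].
  by rewrite big_geq// p0 q0; lra.
have {}IH := IH (fun k kn => h k (ltnW kn)).
have hn := h n (ltnSn n).
have y1 : V * p n * q n.+1 <= V / 2 * (p n ^+ 2 + q n.+1 ^+ 2).
  by have := mulr_ge0 V0 (sqr_ge0 (p n - q n.+1)); lra.
have y2 : V * q n * q n.+1 <= V / 2 * (q n ^+ 2 + q n.+1 ^+ 2).
  by have := mulr_ge0 V0 (sqr_ge0 (q n - q n.+1)); lra.
have y3 : V / 2 * p n.+1 ^+ 2 <= m1 * p n.+1 ^+ 2 by rewrite ler_wpM2r ?sqr_ge0.
have y4 : 3 * V / 2 * q n.+1 ^+ 2 <= m2 * q n.+1 ^+ 2 by rewrite ler_wpM2r ?sqr_ge0.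
rewrite big_nat_recr//= -[in leRHS]natr1; lra.
Qed.

End Telescoping.

(** * Subgradients and gradients *)

Section ExtendedConvex.
Context {R : realType} {n : nat}.
Implicit Types (f : 'rV[R]_n -> \bar R) (x y v xi : 'rV[R]_n).

Lemma econvex_comb f (t a b : R) x y : econvex f -> 0 <= t <= 1 ->
  (f x <= a%:E)%E -> (f y <= b%:E)%E ->
  (f (t *: x + (1 - t) *: y)%R <= (t * a + (1 - t) * b)%:E)%E.
Proof.
move=> cf t01 fx fy.
have /andP[t0 t1] := t01.
pose k : {i01 R} := Itv01 t0 t1.
by have := cf (x, a : R^o) (y, b : R^o) k; rewrite !inE => /(_ fx fy).
Qed.

Lemma econvex_fine f (t : R) x y : econvex f -> 0 <= t <= 1 ->
    f x \is a fin_num -> f y \is a fin_num ->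
    f (t *: x + (1 - t) *: y) \is a fin_num ->
  fine (f (t *: x + (1 - t) *: y)) <= t * fine (f x) + (1 - t) * fine (f y).
Proof.
move=> cf t01 fx fy fxy; rewrite -lee_fin fineK//.
by apply: econvex_comb => //; rewrite fineK.
Qed.

Lemma subdiff_fine f x y xi : f x \is a fin_num -> f y \is a fin_num ->
  subdiff f x xi -> fine (f x) + dotv xi (y - x) <= fine (f y).
Proof. by move=> fx fy /(_ y); rewrite -{1}(fineK fx) -{1}(fineK fy) -EFinD lee_fin. Qed.

(** Difference quotients with positive [t] suffice, since differentiability provides the two-sided
    limit. *)
Lemma derive_le (f : 'rV[R]_n -> R^o) x v (c d : R) : differentiable f x -> 0 < d ->
  (forall t, 0 < t < d -> f (x + t *: v) - f x <= t * c) -> 'D_v f x <= c.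
Proof.
move=> df d0 fc; apply/ler_addgt0Pl => e e0.
have /cvgrPdist_lt /(_ e e0) := @diff_derivable R _ _ f x v df.
rewrite -/(derive f x v) => /nbhs_ballP[r /= r0 hr].
pose t := Num.min r d / 2.
have m0 : 0 < Num.min r d by rewrite lt_min r0.
have t0 : 0 < t by rewrite divr_gt0.
have tr : t < r by have : Num.min r d <= r; [rewrite ge_min lexx|rewrite /t; lra].
have td : t < d by have : Num.min r d <= d; [rewrite ge_min lexx orbT|rewrite /t; lra].
have := hr t; rewrite -ball_normE /= sub0r normrN gtr0_norm// => /(_ tr (lt0r_neq0 t0)).
have ft : f (x + t *: v) - f x <= t * c by apply: fc; rewrite t0.
rewrite ltr_norml => /andP[_]; rewrite [t *: v + x]addrC => h.
have : t^-1 * (f (x + t *: v) - f x) <= c by rewrite ler_pdivrMl.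
by move: h; rewrite /GRing.scale/=; lra.
Qed.

Lemma derive_ge (f : 'rV[R]_n -> R^o) x v (c d : R) : differentiable f x -> 0 < d ->
  (forall t, 0 < t < d -> t * c <= f (x + t *: v) - f x) -> c <= 'D_v f x.
Proof.
move=> df d0 fc; rewrite -lerN2 -deriveN; last exact: diff_derivable.
apply: (derive_le (d := d)) => //; first exact: differentiableN.
by move=> t /fc; rewrite !fctE; lra.
Qed.

Lemma near_segment (Q : set 'rV[R]_n) x v : (\forall y \near x, Q y) ->
  exists2 d : R, 0 < d & forall t, 0 < t < d -> Q (x + t *: v).
Proof.
move=> Qx; have : {for (0 : R), continuous (fun t : R => x + t *: v)}.
  by apply: continuousD; [exact: cst_continuous|exact: scalel_continuous].
move=> /(_ Q); rewrite scale0r addr0 => /(_ Qx) /nbhs_ballP[d /= d0 hd].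
exists d => // t /andP[t0 td]; apply: hd.
by rewrite -ball_normE /= sub0r normrN gtr0_norm.
Qed.

Lemma derive_grad f x v : differentiable (fun y => fine (f y) : R^o) x ->
  'D_v (fun y => fine (f y) : R^o) x = dotv (grad f x) v.
Proof.
move=> df; rewrite deriveE// {1}[v]row_sum_delta linear_sum; apply: eq_bigr => i _.
by rewrite linearZ /grad mxE deriveE// mulrC.
Qed.

(** Convexity bounds the slope at [x] along the segment to [y] by [r - f x] for every real [r] above
    [f y], and the derivative inherits the bound. *)
Lemma grad_subdiff f x : econvex f -> f x \is a fin_num ->
    (\forall y \near x, f y \is a fin_num) ->
    differentiable (fun y => fine (f y) : R^o) x ->
  subdiff f x (grad f x).
Proof.
move=> cf fx fn df y.
(* Real majorants cover the three kinds of value of [f y]: at [+oo] there is nothing to prove, and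
   at [-oo] every real would be a majorant, which is absurd. *)
suff H (r : R) : (f y <= r%:E)%E -> fine (f x) + dotv (grad f x) (y - x) <= r.
  rewrite -(fineK fx) -EFinD; have := H; case: (f y) => [r|//|] {}H.
  - by rewrite lee_fin H.
  - by rewrite leey.
  - have := H (fine (f x) + dotv (grad f x) (y - x) - 1).
    by move=> /(_ (leNye _)); rewrite lerDl oppr_ge0 ler10.
move=> fy; rewrite -lerBrDl -derive_grad//.
have [d d0 fd] := near_segment (y - x) fn.
apply: (derive_le (d := Num.min d 1)) => // [|t /andP[t0]]; first by rewrite lt_min d0/=.
rewrite lt_min => /andP[td t1].
have t01 : 0 <= t <= 1 by rewrite !ltW.
have := econvex_comb cf t01 fy (_ : (f x <= (fine (f x))%:E)%E).
rewrite fineK// => /(_ (lexx _)).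
have -> : t *: y + (1 - t) *: x = x + t *: (y - x) by apply/rowP => i; rewrite !mxE; ring.
by rewrite -(@fineK _ (f _)) ?fd ?t0// lee_fin; lra.
Qed.

(** A subgradient stays below all one-sided slopes, hence below all directional derivatives; the
    direction [xi - grad f x] then forces its own square norm to be at most [0]. *)
Lemma subdiff_gradE f x xi : f x \is a fin_num ->
    (\forall y \near x, f y \is a fin_num) ->
    differentiable (fun y => fine (f y) : R^o) x ->
  subdiff f x xi -> xi = grad f x.
Proof.
move=> fx fn df sx.
have key v : dotv xi v <= dotv (grad f x) v.
  rewrite -derive_grad//.
  have [d d0 fd] := near_segment v fn.
  apply: (derive_ge (d := d)) => // t t0d.
  have := @subdiff_fine f x (x + t *: v) xi fx; rewrite addrAC subrr add0r dotvZr.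
  by move=> /(_ (fd t t0d) sx); lra.
apply/eqP; rewrite -subr_eq0; apply/eqP/dotvv_eq0/eqP.
rewrite eq_le dotvv_ge0 andbT dotvDl dotvNl.
by have := key (xi - grad f x); lra.
Qed.

End ExtendedConvex.

(** * Uniform constants for the nonsmooth and the smooth case *)

Section Regularity.
Context {R : realType}.

Definition bounded_subdiff n (S : set 'rV[R]_n) (f : 'rV[R]_n -> \bar R) (D : R) :=
  forall x xi, S x -> subdiff f x xi -> enorm xi <= D.

Definition varying_subdiff n (S : set 'rV[R]_n) (f : 'rV[R]_n -> \bar R) (D e : R) :=
  forall x x' xi xi', S x -> S x' -> subdiff f x xi -> subdiff f x' xi' ->
    enorm (xi - xi') <= D * (enorm (x - x') + e).

(* The slack [e] is [0] in the smooth case; in the nonsmooth case it is [1], and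
   the bounds on differences then say no more than boundedness. *)
Record regular (P : problem R) (e D : R) : Prop := Regular {
  reg_gt0 : 0 < D;
  reg_f0_ex : subdifferentiable_on (X P) (f0 P);
  reg_gx_ex : forall (m : 'I_(M P)) (z : 'rV[R]_(J m)), Zt m z ->
    subdifferentiable_on (X P) (fun y => g m y z);
  reg_gz_ex : forall (m : 'I_(M P)) x, X P x ->
    subdifferentiable_on (Zt m) (fun w => - g m x w)%E;
  reg_h_ex : forall (m : 'I_(M P)) (i : 'I_(nI m)),
    subdifferentiable_on (Zt m) (h m i);
  reg_f0_bnd : bounded_subdiff (X P) (f0 P) D;
  reg_gx_bnd : forall (m : 'I_(M P)) (z : 'rV[R]_(J m)), Zt m z ->
    bounded_subdiff (X P) (fun y => g m y z) D;
  reg_gz_bnd : forall (m : 'I_(M P)) x, X P x ->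
    bounded_subdiff (Zt m) (fun w => - g m x w)%E D;
  reg_h_bnd : forall (m : 'I_(M P)) (i : 'I_(nI m)),
    bounded_subdiff (Zt m) (h m i) D;
  reg_f0_var : varying_subdiff (X P) (f0 P) D e;
  reg_gx_var : forall (m : 'I_(M P)) (z : 'rV[R]_(J m)), Zt m z ->
    varying_subdiff (X P) (fun y => g m y z) D e;
  reg_gz_var : forall (m : 'I_(M P)) x x' (z z' : 'rV[R]_(J m)) zeta zeta',
    X P x -> X P x' -> Zt m z -> Zt m z' ->
    subdiff (fun w => - g m x w)%E z zeta ->
    subdiff (fun w => - g m x' w)%E z' zeta' ->
    enorm (zeta - zeta') <= D * (enorm (x - x') + enorm (z - z') + e);
  reg_h_var : forall (m : 'I_(M P)) (i : 'I_(nI m)),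
    varying_subdiff (Zt m) (h m i) D e
}.

Lemma ler_sum_pos (I : finType) (F : I -> R) (i : I) :
  (forall j, 0 <= F j) -> F i <= \sum_j F j.
Proof. by move=> F0; rewrite (bigD1 i)//= lerDl sumr_ge0. Qed.

(** Two vectors of norm at most [B] differ by at most [2 * B], which the slack [1] covers at any
    distance of the points. [B] is the sum of all the given bounds. *)
Lemma nonsmooth_regular (P : problem R) : nonsmooth_case P ->
  exists D, regular P 1 D.
Proof.
case=> sf0 sg sh [D0 [D [E [F [D0gt /all_and3[Dgt Egt Fgt] [bf bgx bgz bh]]]]]].
pose B := D0 + \sum_m D m + \sum_m E m + \sum_m F m.
have sD0 : 0 <= \sum_m D m by apply: sumr_ge0 => m _; exact: ltW.
have sE0 : 0 <= \sum_m E m by apply: sumr_ge0 => m _; exact: ltW.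
have sF0 : 0 <= \sum_m F m by apply: sumr_ge0 => m _; exact: ltW.
have D0B : D0 <= B by rewrite /B; lra.
have DB m : D m <= B by have := ler_sum_pos m (fun j => ltW (Dgt j)); rewrite /B; lra.
have EB m : E m <= B by have := ler_sum_pos m (fun j => ltW (Egt j)); rewrite /B; lra.
have FB m : F m <= B by have := ler_sum_pos m (fun j => ltW (Fgt j)); rewrite /B; lra.
have B0 : 0 < B by lra.
have diff n (u v : 'rV[R]_n) r : enorm u <= B -> enorm v <= B -> 0 <= r ->
    enorm (u - v) <= 2 * B * (r + 1).
  move=> uB vB r0; rewrite (le_trans (ler_enormD _ _))// enormN.
  by have := mulr_ge0 (ltW B0) r0; lra.
exists (2 * B); split.
- by lra.
- exact: sf0.
- by move=> m z Zz x Xx; have [+ _] := sg m x z Xx Zz; exact.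
- by move=> m x Xx z Zz; have [_] := sg m x z Xx Zz; exact.
- exact: sh.
- by move=> x xi Xx /(bf _ _ Xx); lra.
- by move=> m z Zz x xi Xx /(bgx _ _ _ _ Xx Zz); have := DB m; lra.
- by move=> m x Xx z xi Zz /(bgz _ _ _ _ Xx Zz); have := EB m; lra.
- by move=> m i z xi Zz /(bh _ _ _ _ Zz); have := FB m; lra.
- move=> x x' xi xi' Xx Xx' /(bf _ _ Xx) h /(bf _ _ Xx') h'.
  by apply: diff; [lra|lra|exact: enorm_ge0].
- move=> m z Zz x x' xi xi' Xx Xx' /(bgx _ _ _ _ Xx Zz) h /(bgx _ _ _ _ Xx' Zz) h'.
  by have := DB m => ?; apply: diff; [lra|lra|exact: enorm_ge0].
- move=> m x x' z z' xi xi' Xx Xx' Zz Zz' /(bgz _ _ _ _ Xx Zz) h /(bgz _ _ _ _ Xx' Zz') h'.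
  by have := EB m => ?; apply: diff; [lra|lra|rewrite addr_ge0 ?enorm_ge0].
- move=> m i z z' xi xi' Zz Zz' /(bh _ _ _ _ Zz) h /(bh _ _ _ _ Zz') h'.
  by have := FB m => ?; apply: diff; [lra|lra|exact: enorm_ge0].
Qed.

(** A radius [d] common to all points of [S] is what [subgradient_bound] needs in order to move in
    any direction while [F] stays bounded. *)
Lemma compact_locally_bounded (V : normedModType R) (S U : set V) (F : V -> R) :
    compact S -> open U -> S `<=` U -> (forall x, U x -> {for x, continuous F}) ->
  exists d B : R, 0 < d /\ forall x y, S x -> `|y - x| < d -> U y /\ `|F y| <= B.
Proof.
move=> /compact_near_coveringP cS oU SU cF.
(* One parameter [B] tending to infinity serves as the bound on [F] and, inverted, as the radius, so
   that compactness yields both at once. *)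
have [] := cS _ +oo%R (fun B x => forall y : V, `|y - x| < B^-1 -> U y /\ `|F y| <= B) _.
  move=> x /SU Ux.
  have /cvgrPdist_lt /(_ 1 ltr01) F1 := cF x Ux.
  have /nbhs_ballP[d /= d0 hd] : nbhs x [set y | U y /\ `|F x - F y| < 1].
    by apply: filterI => //; exact: open_nbhs_nbhs.
  have d2 : 0 < d / 2 by rewrite divr_gt0.
  near=> x' B => y yx'.
  have B0 : 0 < B by near: B; exact: nbhs_pinfty_gt.
  have xx' : `|x - x'| < d / 2.
    have : ball x (d / 2) x' by near: x'; exact: nbhsx_ballx.
    by rewrite -ball_normE.
  have Bd : B^-1 <= d / 2.
    have : (d / 2)^-1 <= B by near: B; exact: (nbhs_pinfty_ge (num_real _)).
    by rewrite -[leRHS]invrK lef_pV2 ?posrE ?invr_gt0.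
  have xy : `|x - y| < d.
    rewrite -(subrKA x') (le_lt_trans (ler_normD _ _))// (distrC x').
    by lra.
  have [Uy Fy] : U y /\ `|F x - F y| < 1 by apply: hd; rewrite -ball_normE.
  split=> //.
  have : `|F x| + 1 <= B by near: B; exact: (nbhs_pinfty_ge (num_real _)).
  apply: le_trans; rewrite -[F y](subKr (F x)) (le_trans (ler_normB _ _))// lerD2l.
  exact: ltW.
move=> B [_ hB]; pose C := Num.max B 0 + 1.
have C0 : 0 < C by rewrite /C ltr_wpDl// le_max lexx orbT.
have BC : B < C by rewrite /C ltr_pwDr// le_max lexx.
exists C^-1, C; split; first by rewrite invr_gt0.
by move=> x y Sx yx; exact: (hB C BC x Sx y yx).
Unshelve. all: by end_near. Qed.

(** Testing the subgradient inequality at Euclidean distance [d / 2] in the direction of [xi] gives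
    [d / 2 * enorm xi <= 2 * B]. *)
Lemma subgradient_bound n (f : 'rV[R]_n -> \bar R) x xi (d B : R) : 0 < d -> 0 <= B ->
    (forall y, `|y - x| < d -> f y \is a fin_num /\ `|fine (f y)| <= B) ->
  subdiff f x xi -> enorm xi <= 4 * B / d.
Proof.
move=> d0 B0 fB sx.
have [xi0|xi0] := eqVneq (enorm xi) 0; first by rewrite xi0 divr_ge0 ?mulr_ge0 ?(ltW d0).
have xig : 0 < enorm xi by rewrite lt_neqAle eq_sym xi0 enorm_ge0.
pose y := x + (d / 2 / enorm xi) *: xi.
have c0 : 0 < d / 2 / enorm xi by rewrite !divr_gt0.
have yx : `|y - x| < d.
  rewrite addrC addKr normrZ gtr0_norm//.
  (* The ball is one of the sup norm, which the Euclidean norm dominates. *)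
  have xn : `|xi| <= enorm xi.
    rewrite -[`|xi|]/(mx_norm xi) mx_normE -[leRHS]/((NngNum (enorm_ge0 xi))%:num).
    rewrite num_le; apply/bigmax_leP; split=> [|[i j] _]; rewrite -num_le/=.
      exact: enorm_ge0.
    by rewrite (ord1 i); exact: ler_coord_enorm.
  apply: le_lt_trans (ler_wpM2l (ltW c0) xn) _.
  by rewrite divfK//; lra.
have [fy yB] := fB y yx.
have [fx xB] : f x \is a fin_num /\ `|fine (f x)| <= B by apply: fB; rewrite subrr normr0.
have := subdiff_fine fx fy sx.
have -> : y - x = (d / 2 / enorm xi) *: xi by rewrite addrC addKr.
rewrite dotvZr -sqr_enorm expr2 mulrA divfK//.
move: yB xB; rewrite !ler_norml ler_pdivlMr// => /andP[_ ?] /andP[? _] ?; lra.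
Qed.

End Regularity.

Section SmoothRegular.
Context {R : realType}.

Lemma near_slice (V W : normedModType R) (U : set (V * W)) x z : open U -> U (x, z) ->
  (\forall y \near x, U (y, z)) /\ (\forall w \near z, U (x, w)).
Proof.
move=> oU Uxz; have nU : nbhs (x, z) U by exact: open_nbhs_nbhs.
split.
- have : {for x, continuous (fun y => (y, z))} by apply: cvg_pair; [exact: cvg_id|exact: cvg_cst].
  exact.
- have : {for z, continuous (fun w => (x, w))} by apply: cvg_pair; [exact: cvg_cst|exact: cvg_id].
  exact.
Qed.

Lemma slice_differentiable (V W : normedModType R) (F : V * W -> R^o) x z :
  differentiable F (x, z) ->
  differentiable (fun y => F (y, z)) x /\ differentiable (fun w => F (x, w)) z.
Proof.
move=> dF; split.
  exact: (@differentiable_comp _ _ _ _ (fun y => (y, z)) F).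
exact: (@differentiable_comp _ _ _ _ (fun w => (x, w)) F).
Qed.

Lemma gradN n (f : 'rV[R]_n -> \bar R) x :
    differentiable (fun y => fine (f y) : R^o) x ->
  grad (fun y => - f y)%E x = - grad f x.
Proof.
move=> df; apply/rowP => i; rewrite !mxE -deriveN; last exact: diff_derivable.
by congr ('D_(_) _ x); apply/funext => y; rewrite fineN.
Qed.

Definition smooth_at n (f : 'rV[R]_n -> \bar R) x :=
  [/\ f x \is a fin_num, \forall y \near x, f y \is a fin_num &
      differentiable (fun y => fine (f y) : R^o) x].

Lemma smooth_atN n (f : 'rV[R]_n -> \bar R) x :
  smooth_at f x -> smooth_at (fun y => - f y)%E x.
Proof.
case=> fx fn df; split; first by rewrite fin_numN.
- by apply: filterS fn => y; rewrite fin_numN.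
- rewrite (_ : (fun _ => _) = - (fun y => fine (f y) : R^o)); first exact: differentiableN.
  by apply/funext => y; rewrite fineN.
Qed.

Lemma smooth_on n (S : set 'rV[R]_n) f x : differentiable_on S f -> S x -> smooth_at f x.
Proof.
case=> U [oU SU dU] Sx; have Ux := SU x Sx; split; [exact: (dU x Ux).1| |exact: (dU x Ux).2].
by apply: filterS (open_nbhs_nbhs (conj oU Ux)) => y /dU[].
Qed.

Lemma smooth_slices p n (S : set ('rV[R]_p * 'rV[R]_n)) (f : 'rV[R]_p -> 'rV[R]_n -> \bar R) x z :
  differentiable_on S (fun q => f q.1 q.2) -> S (x, z) ->
  smooth_at (fun y => f y z) x /\ smooth_at (fun w => f x w) z.
Proof.
case=> U [oU SU dU] Sx; have Ux := SU _ Sx.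
have [/= fx df] := dU _ Ux; have [n1 n2] := near_slice oU Ux.
have [d1 d2] := slice_differentiable df.
by split; split=> //; [apply: filterS n1|apply: filterS n2] => y /dU[].
Qed.

Lemma differentiable_bounded (V : normedModType R) (S : set V) (f : V -> \bar R) :
    compact S -> differentiable_on S f ->
  exists2 d : R, 0 < d & exists2 B : R, 0 <= B & forall x y, S x -> `|y - x| < d ->
    f y \is a fin_num /\ `|fine (f y)| <= B.
Proof.
move=> cS [U [oU SU dU]].
have [|d [B [d0 hB]]] := compact_locally_bounded (F := fun x => fine (f x)) cS oU SU.
  by move=> x /dU[_ df]; exact: (@differentiable_continuous _ _ _ _ (fun x => fine (f x) : R^o)).
exists d => //; exists `|B| => // x y Sx /(hB x y Sx)[Uy yB]; split; first by case: (dU y Uy).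
by rewrite (le_trans yB)// ler_norm.
Qed.

(** The Lipschitz hypotheses bound differences of gradients; bounds on the gradients themselves come
    from compactness, by [differentiable_bounded] and [subgradient_bound]. Every subgradient is the
    gradient, so the differences obey the slack [0]. *)
Lemma smooth_regular (P : problem R) :
    compact (X P) -> (forall m : 'I_(M P), compact (Zt m)) ->
    econvex (f0 P) ->
    (forall (m : 'I_(M P)) (z : 'rV[R]_(J m)), Zt m z -> econvex (fun x => g m x z)) ->
    (forall (m : 'I_(M P)) (x : xvec P), X P x ->
       econcave (fun z : 'rV[R]_(J m) => g m x z)) ->
    (forall (m : 'I_(M P)) (i : 'I_(nI m)), econvex (h m i)) ->
  smooth_case P -> exists D, regular P 0 D.
Proof.
move=> cX cZ cf0 cgx cgz ch [df0 dg dh].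
move=> [D0 [D [E1 [E2 [F [D0p /all_and4[Dp E1p E2p Fp] [lf lgx lgz lh]]]]]]].
have [r0 r0p [B0 B0p b0]] := differentiable_bounded cX df0.
have bg (m : 'I_(M P)) : exists b : R, 0 <= b /\ forall x (z : 'rV[R]_(J m)) xi, X P x -> Zt m z ->
    subdiff (fun y => g m y z) x xi -> enorm xi <= b.
  have [r rp [B Bp b]] := differentiable_bounded (compact_setX cX (cZ m)) (dg m).
  exists (4 * B / r); split; first by rewrite divr_ge0 ?mulr_ge0// ltW.
  move=> x z xi Xx Zz; apply: subgradient_bound => // y yx.
  by apply: (b (x, z) (y, z)) => //; rewrite prod_normE /= subrr normr0 max_l.
have bz (m : 'I_(M P)) : exists b : R, 0 <= b /\
    forall x (z : 'rV[R]_(J m)) zeta, X P x -> Zt m z ->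
    subdiff (fun w => - g m x w)%E z zeta -> enorm zeta <= b.
  have [r rp [B Bp b]] := differentiable_bounded (compact_setX cX (cZ m)) (dg m).
  exists (4 * B / r); split; first by rewrite divr_ge0 ?mulr_ge0// ltW.
  move=> x z xi Xx Zz; apply: subgradient_bound => // w wz.
  rewrite fin_numN fineN normrN.
  by apply: (b (x, z) (x, w)) => //; rewrite prod_normE /= subrr normr0 max_r.
have bh (m : 'I_(M P)) : exists b : R, 0 <= b /\ forall i (z : 'rV[R]_(J m)) eta, Zt m z ->
    subdiff (h m i) z eta -> enorm eta <= b.
  have hi (i : 'I_(nI m)) : exists b : R, 0 <= b /\ forall (z : 'rV[R]_(J m)) eta, Zt m z ->
      subdiff (h m i) z eta -> enorm eta <= b.
    have [r rp [B Bp b]] := differentiable_bounded (cZ m) (dh m i).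
    exists (4 * B / r); split; first by rewrite divr_ge0 ?mulr_ge0// ltW.
    by move=> z eta Zz; apply: subgradient_bound => // w; exact: b.
  have [b hb] := choice hi; exists (\sum_i b i); split.
    by apply: sumr_ge0 => i _; case: (hb i).
  move=> i z eta Zz /((hb i).2 _ _ Zz) /le_trans; apply; apply: ler_sum_pos => j.
  by case: (hb j).
have [bG hG] := choice bg; have [bZ hZ] := choice bz; have [bH hH] := choice bh.
pose T := D0 + 4 * B0 / r0 + \sum_m (D m + E1 m + E2 m + F m + bG m + bZ m + bH m).
have sp m : 0 <= D m + E1 m + E2 m + F m + bG m + bZ m + bH m.
  have := Dp m; have := E1p m; have := E2p m; have := Fp m.
  by have := (hG m).1; have := (hZ m).1; have := (hH m).1; lra.
have Bp : 0 <= 4 * B0 / r0 by rewrite divr_ge0 ?mulr_ge0// ltW.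
have sT m : D m + E1 m + E2 m + F m + bG m + bZ m + bH m <= T.
  by have := ler_sum_pos m sp; rewrite /T; lra.
have s0 : 0 <= \sum_m (D m + E1 m + E2 m + F m + bG m + bZ m + bH m) by exact: sumr_ge0.
have T0 : 0 < T by rewrite /T; lra.
have le m : [/\ D m <= T, E1 m <= T, E2 m <= T, F m <= T & [/\ bG m <= T, bZ m <= T & bH m <= T]].
  have := Dp m; have := E1p m; have := E2p m; have := Fp m; have := sT m.
  have := (hG m).1; have := (hZ m).1; have := (hH m).1.
  by move=> *; split; [lra|lra|lra|lra|split; lra].
have sgx (m : 'I_(M P)) x (z : 'rV[R]_(J m)) : X P x -> Zt m z -> smooth_at (fun y => g m y z) x.
  by move=> Xx Zz; case: (smooth_slices (x := x) (z := z) (dg m)).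
have sgz (m : 'I_(M P)) x (z : 'rV[R]_(J m)) : X P x -> Zt m z -> smooth_at (fun w => g m x w) z.
  by move=> Xx Zz; case: (smooth_slices (x := x) (z := z) (dg m)).
have gradP n (f : 'rV[R]_n -> \bar R) x xi : smooth_at f x -> subdiff f x xi -> xi = grad f x.
  by case=> fx fn df; exact: subdiff_gradE.
have gradN_P n (f : 'rV[R]_n -> \bar R) x xi : smooth_at f x ->
    subdiff (fun w => - f w)%E x xi -> xi = - grad f x.
  by move=> sf /(gradP _ _ _ _ (smooth_atN sf)) ->; rewrite gradN//; case: sf.
have ex n (f : 'rV[R]_n -> \bar R) x : econvex f -> smooth_at f x -> subdiff f x !=set0.
  by move=> cf [fx fn df]; exists (grad f x); exact: grad_subdiff.
exists T; split => //.
- by move=> x Xx; apply: ex => //; exact: smooth_on df0 _.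
- by move=> m z Zz x Xx; apply: ex; [exact: cgx|exact: sgx].
- by move=> m x Xx z Zz; apply: ex; [exact: cgz|apply: smooth_atN; exact: sgz].
- by move=> m i z Zz; apply: ex => //; exact: smooth_on (dh m i) _.
- move=> x xi Xx sx; apply: (@le_trans _ _ (4 * B0 / r0)); last by rewrite /T; lra.
  by apply: subgradient_bound sx => // y; exact: b0.
- by move=> m z Zz x xi Xx /((hG m).2 _ _ _ Xx Zz) /le_trans; apply; case: (le m) => _ _ _ _ [].
- by move=> m x Xx z xi Zz /((hZ m).2 _ _ _ Xx Zz) /le_trans; apply; case: (le m) => _ _ _ _ [].
- by move=> m i z xi Zz /((hH m).2 _ _ _ Zz) /le_trans; apply; case: (le m) => _ _ _ _ [].
- move=> x x' xi xi' Xx Xx' /gradP -> //; last exact: smooth_on df0 _.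
  move=> /gradP -> //; last exact: smooth_on df0 _.
  rewrite addr0 (le_trans (lf _ _ Xx Xx'))// ler_wpM2r ?enorm_ge0//.
  by rewrite /T; lra.
- move=> m z Zz x x' xi xi' Xx Xx' /(gradP _ _ _ _ (sgx _ _ _ Xx Zz)) ->.
  move=> /(gradP _ _ _ _ (sgx _ _ _ Xx' Zz)) ->.
  by rewrite addr0 (le_trans (lgx _ _ _ _ Xx Xx' Zz))// ler_wpM2r ?enorm_ge0//; case: (le m).
- move=> m x x' z z' xi xi' Xx Xx' Zz Zz' /(gradN_P _ _ _ _ (sgz _ _ _ Xx Zz)) ->.
  move=> /(gradN_P _ _ _ _ (sgz _ _ _ Xx' Zz')) ->.
  rewrite addr0 -opprD enormN (le_trans (lgz _ _ _ _ _ Xx Xx' Zz Zz'))//.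
  by rewrite mulrDr lerD// ler_wpM2r ?enorm_ge0//; case: (le m).
- move=> m i z z' xi xi' Zz Zz' /(gradP _ _ _ _ (smooth_on (dh m i) Zz)) ->.
  move=> /(gradP _ _ _ _ (smooth_on (dh m i) Zz')) ->.
  by rewrite addr0 (le_trans (lh _ _ _ _ Zz Zz'))// ler_wpM2r ?enorm_ge0//; case: (le m).
Qed.

End SmoothRegular.

(** * The inner loop *)

Section Steps.
Context {R : realType} {n : nat}.
Implicit Types (S : set 'rV[R]_n) (x y z p q : 'rV[R]_n).

Lemma sqr_enormB x y : enorm (x - y) ^+ 2 = dotv x x - 2 * dotv x y + dotv y y.
Proof. by rewrite sqr_enorm -{1 2}(scale1r y) dotv_subZ; lra. Qed.

Lemma three_points x y z :
  2 * dotv (x - y) (z - y) =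
  enorm (y - x) ^+ 2 + enorm (z - y) ^+ 2 - enorm (z - x) ^+ 2.
Proof. by rewrite !sqr_enormB !dotvE (dotvC y x) (dotvC z x) (dotvC z y); lra. Qed.

Lemma proj_step S (d : R) (v y p q : 'rV[R]_n) : convex_set S -> 0 < d ->
    is_proj S (y - d *: v) p -> S q ->
  dotv v (p - q) <=
  (2 * d)^-1 * (enorm (q - y) ^+ 2 - enorm (q - p) ^+ 2 - enorm (p - y) ^+ 2).
Proof.
move=> cS d0 pj Sq; have := is_proj_variational cS pj Sq.
rewrite addrAC dotvDl dotvNl dotvZl => h.
have := three_points y p q; rewrite ler_pdivlMl ?mulr_gt0//.
by rewrite -(opprB q p) dotvNr; lra.
Qed.

(** The projected point minimizes over [S] the linear form [dotv v] plus the two proximal terms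
    centred at [y] and [z]; its optimality condition splits by [three_points]. *)
Lemma prox_step S (alpha gamma : R) (v y z p q : 'rV[R]_n) :
    convex_set S -> 0 < alpha -> 0 < gamma ->
    is_proj S ((alpha * gamma / (alpha + gamma)) *:
               (alpha^-1 *: y + gamma^-1 *: z - v)) p -> S q ->
  dotv v (p - q) <=
  (2 * alpha)^-1 * (enorm (q - y) ^+ 2 - enorm (q - p) ^+ 2 - enorm (p - y) ^+ 2)
  + (2 * gamma)^-1 * (enorm (q - z) ^+ 2 - enorm (q - p) ^+ 2 - enorm (p - z) ^+ 2).
Proof.
move=> cS a0 g0 pj Sq; have := is_proj_variational cS pj Sq.
have c0 : 0 < alpha * gamma / (alpha + gamma) by rewrite divr_gt0 ?mulr_gt0 ?addr_gt0.
(* The factor is the inverse of [alpha^-1 + gamma^-1], so subtracting [p] distributes over the two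
   centres. *)
have -> : (alpha * gamma / (alpha + gamma)) *: (alpha^-1 *: y + gamma^-1 *: z - v) - p =
    (alpha * gamma / (alpha + gamma)) *:
      (alpha^-1 *: (y - p) + gamma^-1 *: (z - p) - v).
  by apply/rowP => i; rewrite !mxE; field; lra.
rewrite dotvZl pmulr_rle0// !dotvDl !dotvZl dotvNl.
have := three_points y p q; have := three_points z p q.
rewrite -(opprB q p) dotvNr [(2 * _)^-1]invfM [(2 * gamma)^-1]invfM.
set A := dotv (y - p) _; set B := dotv (z - p) _ => hB hA.
have -> : 2^-1 * alpha^-1 * (enorm (q - y) ^+ 2 - enorm (q - p) ^+ 2 - enorm (p - y) ^+ 2)
   = - (alpha^-1 * A) by rewrite (_ : _ - _ - _ = - (2 * A)); [field; lra|lra].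
have -> : 2^-1 * gamma^-1 * (enorm (q - z) ^+ 2 - enorm (q - p) ^+ 2 - enorm (p - z) ^+ 2)
   = - (gamma^-1 * B) by rewrite (_ : _ - _ - _ = - (2 * B)); [field; lra|lra].
by lra.
Qed.

(** A substitute for integrating the gradient: a subgradient at the new point [z] bounds
    [f z - f y], and its deviation from [xi] is at most [D * (enorm (z - y) + e)]. Hence the
    constant [D] in place of the classical [D / 2]. *)
Lemma descent S (f : 'rV[R]_n -> \bar R) (D e : R) x y z xi :
    subdifferentiable_on S f -> varying_subdiff S f D e ->
    (forall x, S x -> f x \is a fin_num) ->
    S x -> S y -> S z -> subdiff f y xi ->
  fine (f z) - fine (f x) <=
  dotv xi (z - x) + D * (enorm (z - y) + e) * enorm (z - y).
Proof.
move=> sf vf ff Sx Sy Sz sy; have [xi' sz] := sf z Sz.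
have h1 := subdiff_fine (ff _ Sz) (ff _ Sy) sz.
have h2 := subdiff_fine (ff _ Sy) (ff _ Sx) sy.
have h3 := ler_wpM2r (enorm_ge0 (z - y)) (vf _ _ _ _ Sz Sy sz sy).
have h4 := cauchy_schwarz (xi' - xi) (z - y).
have E : dotv xi (z - x) = dotv xi' (z - y) - dotv (xi' - xi) (z - y) - dotv xi (x - y).
  by rewrite !dotvE; lra.
have E' : dotv xi' (y - z) = - dotv xi' (z - y) by rewrite -(opprB z y) dotvNr.
by lra.
Qed.

Lemma young (c V e q : R) : 0 < c -> V * e * q <= c / 4 * q ^+ 2 + V ^+ 2 * e ^+ 2 / c.
Proof.
move=> c0; have := sqr_ge0 (c / 2 * q - V * e) => h.
rewrite -subr_ge0.
have -> : c / 4 * q ^+ 2 + V ^+ 2 * e ^+ 2 / c - V * e * q = (c / 2 * q - V * e) ^+ 2 / c.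
  by field; lra.
by rewrite divr_ge0// ltW.
Qed.

End Steps.

Record convex_problem (R : realType) (P : problem R) : Prop := ConvexProblem {
  X_nonempty : X P !=set0;
  X_compact : compact (X P);
  X_convex : convex_set (X P);
  Zt_nonempty : forall m : 'I_(M P), Zt m !=set0;
  Zt_compact : forall m : 'I_(M P), compact (Zt m);
  Zt_convex : forall m : 'I_(M P), convex_set (Zt m);
  f0_econvex : econvex (f0 P);
  f0_fin : forall x, X P x -> f0 P x \is a fin_num;
  g_econvex : forall (m : 'I_(M P)) (z : 'rV[R]_(J m)), Zt m z ->
    econvex (fun x => g m x z);
  g_econcave : forall (m : 'I_(M P)) (x : xvec P), X P x ->
    econcave (fun z : 'rV[R]_(J m) => g m x z);
  g_fin : forall (m : 'I_(M P)) (x : xvec P) (z : 'rV[R]_(J m)),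
    X P x -> Zt m z -> g m x z \is a fin_num;
  h_econvex : forall (m : 'I_(M P)) (i : 'I_(nI m)), econvex (h m i);
  h_fin : forall (m : 'I_(M P)) (i : 'I_(nI m)) z, Zt m z -> h m i z \is a fin_num
}.

Section Lagrangian.
Context {R : realType} (P : problem R) (a : 'I_(M P) -> R) (e D : R).
Hypothesis cvxP : convex_problem P.
Hypothesis regP : regular P e D.
Hypothesis a_gt0 : forall m, 0 < a m.

Lemma box_convex (m : 'I_(M P)) : convex_set (box a m).
Proof.
move=> u v k; rewrite !inE => bu bv i; have /andP[u0 u1] := bu i; have /andP[v0 v1] := bv i.
have k0 : 0 <= k%:num by [].
have k1 : k%:num <= 1 by [].
rewrite -[conv k u v]/(k%:num *: (u : 'rV[R]_(nI m)) + (1 - k%:num) *: (v : 'rV[R]_(nI m))) !mxE.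
have := mulr_ge0 k0 u0; have : 0 <= (1 - k%:num) * v 0 i by rewrite mulr_ge0// subr_ge0.
have : 0 <= (1 - k%:num) * (a m - v 0 i) by rewrite mulr_ge0// subr_ge0.
have : 0 <= k%:num * (a m - u 0 i) by rewrite mulr_ge0// subr_ge0.
by move=> *; apply/andP; split; lra.
Qed.

Lemma box_compact (m : 'I_(M P)) : compact (box a m).
Proof.
apply: (@rV_compact _ _ (fun=> `[0, a m]%classic)) => i; exact: segment_compact.
Qed.

Lemma box_nonempty (m : 'I_(M P)) : box a m !=set0.
Proof. by exists 0 => i; rewrite mxE lexx ltW. Qed.

Lemma diameter : exists2 d : R, 0 < d &
  [/\ forall x x', X P x -> X P x' -> enorm (x - x') <= d,
      forall (m : 'I_(M P)) (z z' : 'rV[R]_(J m)), Zt m z -> Zt m z' -> enorm (z - z') <= d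
    & forall (m : 'I_(M P)) u u', box a m u -> box a m u' -> enorm (u - u') <= d].
Proof.
have [dX dX0 hX] := compact_diameter (X_compact cvxP).
have hz (m : 'I_(M P)) : exists d : R, 0 < d /\
    forall (z z' : 'rV[R]_(J m)), Zt m z -> Zt m z' -> enorm (z - z') <= d.
  by have [d d0 hd] := compact_diameter (@Zt_compact _ _ cvxP m); exists d.
have hb (m : 'I_(M P)) : exists d : R, 0 < d /\
    forall u u', box a m u -> box a m u' -> enorm (u - u') <= d.
  by have [d d0 hd] := compact_diameter (@box_compact m); exists d.
have [dZ hZ] := choice hz; have [dB hB] := choice hb.
have sZ : 0 <= \sum_m dZ m by apply: sumr_ge0 => m _; have [/ltW] := hZ m.
have sB : 0 <= \sum_m dB m by apply: sumr_ge0 => m _; have [/ltW] := hB m.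
exists (dX + \sum_m dZ m + \sum_m dB m); first by lra.
split=> [x x' Xx Xx'|m z z' Zz Zz'|m u u' bu bu'].
- by have := hX _ _ Xx Xx'; lra.
- have := (hZ m).2 _ _ Zz Zz'.
  by have := @ler_sum_pos _ _ dZ m (fun j => ltW (hZ j).1); lra.
- have := (hB m).2 _ _ bu bu'.
  by have := @ler_sum_pos _ _ dB m (fun j => ltW (hB j).1); lra.
Qed.

(** As the entries of [mu m] are non-negative, the combined vector is a subgradient at [w] of the
    negated [gtilde]. *)
Lemma gtilde_concave_bound (m : 'I_(M P)) x mu (z w zeta : 'rV[R]_(J m))
    (eta : 'I_(nI m) -> 'rV[R]_(J m)) :
    X P x -> box a m (mu m) -> Zt m z -> Zt m w ->
    subdiff (fun z => - g m x z)%E w zeta ->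
    (forall i, subdiff (h m i) w (eta i)) ->
  gtilde x mu z - gtilde x mu w <=
  dotv (zeta + \sum_i mu m 0 i *: eta i) (w - z).
Proof.
move=> Xx bmu Zz Zw sz se.
have fz := g_fin cvxP Xx Zz; have fw := g_fin cvxP Xx Zw.
have := @subdiff_fine _ _ (fun z => - g m x z)%E w z zeta.
rewrite !fin_numN !fineN => /(_ fw fz sz) hg.
have hh : \sum_i mu m 0 i * fine (h m i w) - \sum_i mu m 0 i * fine (h m i z)
    <= \sum_i mu m 0 i * dotv (eta i) (w - z).
  rewrite -sumrB; apply: ler_sum => i _; rewrite -mulrBr ler_wpM2l//.
    by case/andP: (bmu i).
  have := subdiff_fine (h_fin cvxP i Zw) (h_fin cvxP i Zz) (se i).
  by rewrite -(opprB w z) dotvNr; lra.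
rewrite /gtilde dotvDl dotv_suml.
under [in leRHS]eq_bigr do rewrite dotvZl.
have E v : dotv (mu m) (hvec v) = \sum_i mu m 0 i * fine (h m i v).
  by apply: eq_bigr => i _; rewrite mxE.
by rewrite !E; move: hg hh; rewrite -(opprB w z) dotvNr; lra.
Qed.

(** [gtilde] is affine in [mu], so that part is exact and the remainder involves [x] alone. *)
Lemma gtilde_descent (m : 'I_(M P)) x y x' mu mu' (z : 'rV[R]_(J m)) xi :
    X P x -> X P y -> X P x' -> Zt m z -> subdiff (fun x => g m x z) y xi ->
  gtilde x' mu' z - gtilde x mu z <=
  dotv xi (x' - x) - dotv (hvec z) (mu' m - mu m)
  + D * (enorm (x' - y) + e) * enorm (x' - y).
Proof.
move=> Xx Xy Xx' Zz sy.
have := descent (reg_gx_ex regP Zz) (reg_gx_var regP Zz) 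
  (fun x Xx => g_fin cvxP Xx Zz) Xx Xy Xx' sy.
have -> : dotv (hvec z) (mu' m - mu m) = dotv (mu' m) (hvec z) - dotv (mu m) (hvec z).
  by rewrite dotvDr dotvNr !(dotvC (hvec z)).
by rewrite /gtilde; lra.
Qed.

End Lagrangian.

(** [v], [v'], [v''] stand for the subgradients at three successive times, and [w], [w'] for the
    iterates at the last two. Up to a telescoping difference, the extrapolation error is a product
    of an increment of the subgradient and one of the iterate. *)
Lemma extrapolationE (R : realType) n (v v' v'' w w' z : 'rV[R]_n) :
  dotv v'' (w' - z) - dotv (2 *: v' - v) (w' - z)
    - (dotv (v'' - v') (w' - z) - dotv (v' - v) (w - z)) =
  - dotv (v' - v) (w' - w).
Proof. by rewrite !dotvE; ring. Qed.

(** * Jensen inequalities for averaged iterates *)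

Section Averages.
Context {R : realType} (P : problem R).
Hypothesis cvxP : convex_problem P.

Lemma sqr_enorm_convex n (w u v : 'rV[R]_n) (t : R) : 0 <= t <= 1 ->
  enorm (t *: u + (1 - t) *: v - w) ^+ 2 <=
  t * enorm (u - w) ^+ 2 + (1 - t) * enorm (v - w) ^+ 2.
Proof.
move=> t01; have -> : t *: u + (1 - t) *: v - w = (u - w) - (1 - t) *: (u - v).
  by apply/rowP => i; rewrite !mxE; ring.
have -> : v - w = (u - w) - 1 *: (u - v) by apply/rowP => i; rewrite !mxE; ring.
rewrite !sqr_enorm !dotv_subZ; have := dotvv_ge0 (u - v).
set d := dotv (u - v) _ => d0; have : 0 <= (1 - t) * t * d by rewrite !mulr_ge0//; lra.
by lra.
Qed.

Lemma gtilde_convex (m : 'I_(M P)) (z : 'rV[R]_(J m)) (t : R) x x' (mu mu' nu : muvec P) :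
    0 <= t <= 1 -> Zt m z -> X P x -> X P x' ->
    nu m = t *: mu m + (1 - t) *: mu' m ->
  gtilde (t *: x + (1 - t) *: x') nu z <= t * gtilde x mu z + (1 - t) * gtilde x' mu' z.
Proof.
move=> t01 Zz Xx Xx' nuE; rewrite /gtilde nuE dotvDl !dotvZl.
have := @econvex_fine _ _ (fun x => g m x z) t x x' (g_econvex cvxP Zz) t01
  (g_fin cvxP Xx Zz) (g_fin cvxP Xx' Zz) (g_fin cvxP (convex_comb (X_convex cvxP) t01 Xx Xx') Zz).
by lra.
Qed.

Lemma gtilde_concave (m : 'I_(M P)) (z z' : 'rV[R]_(J m)) (t : R) x (mu : muvec P) :
    0 <= t <= 1 -> Zt m z -> Zt m z' -> X P x -> (forall i, 0 <= mu m 0 i) ->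
  t * gtilde x mu z + (1 - t) * gtilde x mu z' <= gtilde x mu (t *: z + (1 - t) *: z').
Proof.
move=> t01 Zz Zz' Xx mu0; have Zw := convex_comb (@Zt_convex _ _ cvxP m) t01 Zz Zz'.
have := @econvex_fine _ _ (fun z => - g m x z)%E t z z' (g_econcave cvxP Xx) t01.
rewrite !fin_numN !fineN => /(_ (g_fin cvxP Xx Zz) (g_fin cvxP Xx Zz') (g_fin cvxP Xx Zw)).
have : dotv (mu m) (hvec (t *: z + (1 - t) *: z')) <=
    t * dotv (mu m) (hvec z) + (1 - t) * dotv (mu m) (hvec z').
  rewrite /dotv !mulr_sumr -big_split; apply: ler_sum => i _; rewrite !mxE /=.
  rewrite !(mulrCA _ (mu m 0 i)) -mulrDr ler_wpM2l//.
  by apply: econvex_fine; [exact: h_econvex|..|exact: h_fin] => //; exact: h_fin.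
by rewrite /gtilde; lra.
Qed.

Section Average.
Variables (T : nat).
Hypothesis T_gt0 : (0 < T)%N.

Definition mean (f : nat -> R) : R := T%:R^-1 * \sum_(1 <= t < T.+1) f t.

Lemma meanD f f' : mean (fun t => f t + f' t) = mean f + mean f'.
Proof. by rewrite /mean big_split mulrDr. Qed.

Lemma meanZ c f : mean (fun t => c * f t) = c * mean f.
Proof. by rewrite /mean -mulr_sumr mulrCA. Qed.

Lemma meanN f : mean (fun t => - f t) = - mean f.
Proof. by rewrite /mean sumrN mulrN. Qed.

Lemma mean_sum (I : finType) (f : I -> nat -> R) :
  mean (fun t => \sum_i f i t) = \sum_i mean (f i).
Proof. by rewrite /mean exchange_big mulr_sumr. Qed.

Lemma mean_cst c : mean (fun=> c) = c.
Proof.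
by rewrite /mean sumr_const_nat subn1 /= -[c *+ T]mulr_natl mulKf// pnatr_eq0 -lt0n.
Qed.

Lemma dotv_average n (s : nat -> 'rV[R]_n) v :
  dotv (average T s) v = mean (fun t => dotv (s t) v).
Proof.
rewrite /average dotvZl /mean; congr (_ * _).
elim/big_ind2: _ => [|u r u' r' <- <-|//]; [exact: dotv0l|exact: dotvDl].
Qed.

Lemma f0_average (s : nat -> xvec P) : (forall t, (0 < t <= T)%N -> X P (s t)) ->
  fine (f0 P (average T s)) <= mean (fun t => fine (f0 P (s t))).
Proof.
move=> Xs; apply: (@jensen_average _ _ (X P) T s (fun x => fine (f0 P x))) => //.
  exact: X_convex.
move=> t u v t01 Xu Xv; apply: econvex_fine => //; try exact: f0_fin.
- exact: f0_econvex.
- exact: f0_fin (convex_comb (X_convex cvxP) t01 Xu Xv).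
Qed.

Lemma gtilde_average_x (m : 'I_(M P)) (s : nat -> xvec P) (mus : nat -> muvec P)
    (z : 'rV[R]_(J m)) :
    Zt m z -> (forall t, (0 < t <= T)%N -> X P (s t)) ->
  gtilde (average T s) (fun m => average T (fun t => mus t m)) z <=
  mean (fun t => gtilde (s t) (mus t) z).
Proof.
move=> Zz Xs; rewrite /gtilde dotv_average.
have -> : mean (fun t => fine (g m (s t) z) - dotv (mus t m) (hvec z)) =
    mean (fun t => fine (g m (s t) z)) - mean (fun t => dotv (mus t m) (hvec z)).
  by rewrite -mulN1r -meanZ -meanD; congr mean; apply/funext => t; rewrite mulN1r.
rewrite lerD2r; apply: (@jensen_average _ _ (X P) T s (fun x => fine (g m x z))) => //.
  exact: X_convex.
move=> t u v t01 Xu Xv; apply: (@econvex_fine _ _ (fun x => g m x z)) => //; try exact: g_fin.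
- exact: g_econvex.
- exact: g_fin (convex_comb (X_convex cvxP) t01 Xu Xv) Zz.
Qed.

Lemma gtilde_average_z (m : 'I_(M P)) (s : nat -> 'rV[R]_(J m)) x (mu : muvec P) :
    X P x -> (forall i, 0 <= mu m 0 i) -> (forall t, (0 < t <= T)%N -> Zt m (s t)) ->
  mean (fun t => gtilde x mu (s t)) <= gtilde x mu (average T s).
Proof.
move=> Xx mu0 Zs; rewrite -lerN2 -meanN.
apply: (@jensen_average _ _ (Zt m) T s (fun z => - gtilde x mu z)) => //.
  exact: Zt_convex.
by move=> t u v t01 Zu Zv; have := gtilde_concave t01 Zu Zv Xx mu0; lra.
Qed.

Lemma sqr_enorm_average n (s : nat -> 'rV[R]_n) w :
  enorm (average T s - w) ^+ 2 <= mean (fun t => enorm (s t - w) ^+ 2).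
Proof.
apply: (@jensen_average _ _ setT T s (fun u => enorm (u - w) ^+ 2)) => //.
by move=> t u v t01 _ _; exact: sqr_enorm_convex.
Qed.

Lemma sqdist_average (s : nat -> xvec P) (mus : nat -> muvec P) w :
  sqdist P (average T s, fun m => average T (fun t => mus t m)) w <=
  mean (fun t => sqdist P (s t, mus t) w).
Proof.
rewrite /sqdist /= meanD mean_sum lerD ?sqr_enorm_average//.
by apply: ler_sum => m _; exact: sqr_enorm_average.
Qed.

End Average.
End Averages.

Section InnerLoop.
Context {R : realType} (P : problem R) (a : 'I_(M P) -> R) (e D : R).
Hypothesis cvxP : convex_problem P.
Hypothesis regP : regular P e D.
Hypothesis a_gt0 : forall m, 0 < a m.
Hypothesis e_ge0 : 0 <= e.

Let D_gt0 : 0 < D := reg_gt0 regP.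

(** Lipschitz constant of [zetat]. The [1] in front accounts for [zeta]; each [i] contributes [a m]
    for the variation of [eta] under a multiplier at most [a m], and [1] for the variation of the
    multiplier against a bounded [eta]. *)
Definition kappa : R := D * (1 + \sum_m (nI m)%:R * (a m + 1)).

Lemma kappa_ge : D <= kappa.
Proof.
rewrite /kappa ler_peMr ?(ltW D_gt0)// lerDl; apply: sumr_ge0 => m _.
by rewrite mulr_ge0// addr_ge0// ltW.
Qed.

Lemma kappa_gt0 : 0 < kappa.
Proof. exact: lt_le_trans D_gt0 kappa_ge. Qed.

Lemma zetat_varying (m : 'I_(M P)) x x' (mu mu' : 'rV[R]_(nI m)) (z z' zeta zeta' : 'rV[R]_(J m))
    (eta eta' : 'I_(nI m) -> 'rV[R]_(J m)) :
    X P x -> X P x' -> box a m mu -> Zt m z -> Zt m z' ->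
    subdiff (fun z => - g m x z)%E z zeta -> subdiff (fun z => - g m x' z)%E z' zeta' ->
    (forall i, subdiff (h m i) z (eta i)) -> (forall i, subdiff (h m i) z' (eta' i)) ->
  enorm ((zeta + \sum_i mu 0 i *: eta i) - (zeta' + \sum_i mu' 0 i *: eta' i)) <=
  kappa * (enorm (x - x') + enorm (mu - mu') + enorm (z - z') + e).
Proof.
move=> Xx Xx' bmu Zz Zz' sz sz' se se'.
(* Product rule: the variation of [eta] is weighted by [mu], bounded by the box, and that of [mu] by
   the bounded [eta']. *)
have -> : (zeta + \sum_i mu 0 i *: eta i) - (zeta' + \sum_i mu' 0 i *: eta' i) =
    (zeta - zeta') + (\sum_i mu 0 i *: (eta i - eta' i) + \sum_i (mu 0 i - mu' 0 i) *: eta' i).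
  rewrite opprD addrACA; congr (_ + _); rewrite -big_split -sumrB; apply: eq_bigr => i _.
  by rewrite /= scalerBr scalerBl addrA subrK.
have csum (r : R) : \sum_(i < nI m) r = (nI m)%:R * r.
  by rewrite sumr_const card_ord mulr_natl.
have h0 := reg_gz_var regP Xx Xx' Zz Zz' sz sz'.
have h1 : enorm (\sum_i mu 0 i *: (eta i - eta' i)) <=
    (nI m)%:R * (a m * (D * (enorm (z - z') + e))).
  apply: le_trans (ler_enorm_sum _) _; rewrite -csum.
  apply: ler_sum => i _; rewrite enormZ; have /andP[m0 m1] := bmu i.
  by rewrite ger0_norm// ler_pM ?enorm_ge0//; exact: (reg_h_var regP Zz Zz' (se i) (se' i)).
have h2 : enorm (\sum_i (mu 0 i - mu' 0 i) *: eta' i) <= (nI m)%:R * (enorm (mu - mu') * D).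
  apply: le_trans (ler_enorm_sum _) _; rewrite -csum.
  apply: ler_sum => i _; rewrite enormZ ler_pM ?enorm_ge0//.
    by have := ler_coord_enorm (mu - mu') i; rewrite !mxE.
  exact: (reg_h_bnd regP Zz' (se' i)).
apply: le_trans (ler_enormD _ _) _; apply: le_trans (lerD h0 (ler_enormD _ _)) _.
apply: le_trans (lerD (lexx _) (lerD h1 h2)) _.
have := enorm_ge0 (x - x'); have := enorm_ge0 (mu - mu'); have := enorm_ge0 (z - z').
move: (enorm (x - x')) (enorm (mu - mu')) (enorm (z - z')) => dx dm dz z0 m0 x0.
have k1 : (nI m)%:R * (a m + 1) <= \sum_m (nI m)%:R * (a m + 1).
  by apply: (@ler_sum_pos _ _ (fun m => (nI m)%:R * (a m + 1))) => j;
    rewrite mulr_ge0 ?addr_ge0// ltW.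
have : D * (1 + (nI m)%:R * (a m + 1)) * (dx + dm + dz + e) <= kappa * (dx + dm + dz + e).
  by rewrite ler_wpM2r ?addr_ge0// ler_wpM2l ?(ltW D_gt0)// lerD2l.
apply: le_trans.
have n0 : 0 <= (nI m)%:R :> R by [].
rewrite -subr_ge0.
have -> : D * (1 + (nI m)%:R * (a m + 1)) * (dx + dm + dz + e) -
    (D * (dx + dz + e) + ((nI m)%:R * (a m * (D * (dz + e))) + (nI m)%:R * (dm * D))) =
    D * dm + D * (nI m)%:R * (a m * (dx + dm) + (dx + dz + e)) by ring.
have := ltW (a_gt0 m) => am0.
by rewrite addr_ge0// ?mulr_ge0 ?addr_ge0 ?mulr_ge0 ?addr_ge0// ltW.
Qed.

Lemma enorm_le_sqdist_x (u v : xvec P * muvec P) : enorm (u.1 - v.1) <= Num.sqrt (sqdist P u v).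
Proof.
rewrite -[leLHS]ger0_norm ?enorm_ge0// -sqrtr_sqr ler_sqrt; last first.
  by rewrite addr_ge0 ?sqr_ge0// sumr_ge0// => m _; exact: sqr_ge0.
by rewrite lerDl sumr_ge0// => m _; exact: sqr_ge0.
Qed.

Lemma enorm_le_sqdist_mu (u v : xvec P * muvec P) m :
  enorm (u.2 m - v.2 m) <= Num.sqrt (sqdist P u v).
Proof.
have s0 : 0 <= \sum_m enorm (u.2 m - v.2 m) ^+ 2 by apply: sumr_ge0 => j _; exact: sqr_ge0.
rewrite -[leLHS]ger0_norm ?enorm_ge0// -sqrtr_sqr ler_sqrt ?addr_ge0 ?sqr_ge0//.
apply: (@le_trans _ _ (\sum_m enorm (u.2 m - v.2 m) ^+ 2)); last by rewrite lerDr sqr_ge0.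
by apply: (@ler_sum_pos _ _ (fun m => enorm (u.2 m - v.2 m) ^+ 2)) => j; exact: sqr_ge0.
Qed.

Lemma sqdist_ge0 (u v : xvec P * muvec P) : 0 <= sqdist P u v.
Proof. by rewrite addr_ge0 ?sqr_ge0// sumr_ge0// => m _; exact: sqr_ge0. Qed.

Definition zdist (z w : zvec P) : R := \sum_m enorm (z m - w m) ^+ 2.

Lemma zdist_ge0 z w : 0 <= zdist z w.
Proof. by apply: sumr_ge0 => m _; exact: sqr_ge0. Qed.

Lemma enorm_le_zdist (z w : zvec P) m : enorm (z m - w m) <= Num.sqrt (zdist z w).
Proof.
rewrite -[leLHS]ger0_norm ?enorm_ge0// -sqrtr_sqr ler_sqrt ?zdist_ge0//.
by apply: (@ler_sum_pos _ _ (fun m => enorm (z m - w m) ^+ 2)) => j; exact: sqr_ge0.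
Qed.

Lemma inner_run_dom T alpha gamma delta lam xk muk (tr : inner_trace P) t :
    inner_run a T alpha gamma delta lam xk muk tr -> (t <= T)%N ->
  [/\ X P (ix tr t), Mbox a (imu tr t) & Ztprod P (iz tr t)].
Proof.
case=> X0 b0 Z0 st; case: t => [//|t tT].
have [hz _ _ [Xx _] hmu] := st t tT; split=> //.
- by move=> m; case: (hmu m).
- by move=> m; case: (hz m) => _ _ [].
Qed.

Lemma inner_output_dom T alpha gamma delta lam xk muk (tr : inner_trace P) : (0 < T)%N ->
    inner_run a T alpha gamma delta lam xk muk tr ->
  [/\ X P (inner_x T tr), Mbox a (inner_mu T tr) & Ztprod P (inner_z T tr)].
Proof.
move=> T0 run; have dom t : (0 < t <= T)%N ->
    [/\ X P (ix tr t), Mbox a (imu tr t) & Ztprod P (iz tr t)].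
  by move=> /andP[_]; exact: inner_run_dom run.
split=> [|m|m]; apply: convex_average => //.
- exact: X_convex.
- by move=> t /dom[].
- exact: box_convex.
- by move=> t /dom[_ + _]; exact.
- exact: Zt_convex.
- by move=> t /dom[_ _]; exact.
Qed.

Section Trace.
Variables (alpha s : R) (lam : lamvec P) (xk : xvec P) (muk : muvec P).
Variables (T : nat) (tr : inner_trace P).
Hypotheses (alpha_gt0 : 0 < alpha) (s_gt0 : 0 < s) (lam_ge0 : forall m, 0 <= lam 0 m).
Hypothesis run : inner_run a T alpha s s lam xk muk tr.

Let st t (tT : (t < T)%N) : inner_step a alpha s s lam xk muk tr t.
Proof. by case: run => _ _ _; apply. Qed.

Let run_dom t (tT : (t <= T)%N) := inner_run_dom run tT.

(* The run provides subgradients up to time [T - 1]; the estimates use one more. *)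
Let zs t m : 'rV[R]_(J m) := if (t < T)%N then izeta tr t m
  else xget 0 (subdiff (fun z => - g m (ix tr t) z)%E (iz tr t m)).
Let es t m (i : 'I_(nI m)) : 'rV[R]_(J m) := if (t < T)%N then ieta tr t i
  else xget 0 (subdiff (h m i) (iz tr t m)).
Let vv t m := zs t m + \sum_i imu tr t m 0 i *: es t i.

Let vvE t m : (t < T)%N -> vv t m = zetat tr t m.
Proof. by move=> tT; rewrite /vv /zs /es tT. Qed.

Let zsP t m : (t <= T)%N -> subdiff (fun z => - g m (ix tr t) z)%E (iz tr t m) (zs t m).
Proof.
move=> tT; have [Xx _ Zz] := run_dom tT; rewrite /zs; case: ifPn => [lt|_].
  by have [+ _ _ _ _] := st lt => /(_ m)[].
by have [v hv] := reg_gz_ex regP Xx (Zz m); exact: (xgetPex 0 (ex_intro _ v hv)).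
Qed.

Let esP t m (i : 'I_(nI m)) : (t <= T)%N -> subdiff (h m i) (iz tr t m) (es t i).
Proof.
move=> tT; have [_ _ Zz] := run_dom tT; rewrite /es; case: ifPn => [lt|_].
  by have [+ _ _ _ _] := st lt => /(_ m)[].
by have [v hv] := reg_h_ex regP i (Zz m); exact: (xgetPex 0 (ex_intro _ v hv)).
Qed.

Let U t := (ix tr t, imu tr t).
Let p t := Num.sqrt (sqdist P (U t) (U t.-1)).
Let q t := Num.sqrt (zdist (iz tr t) (iz tr t.-1)).
(** Smoothness constant of the Lagrangian for fixed multipliers: weight [1] for [f0] and [lam 0 m]
    for constraint [m]. *)
Let L := kappa * (1 + \sum_m lam 0 m).

Let Phi (u : xvec P * muvec P) (z : zvec P) : R :=
  fine (f0 P u.1) + \sum_m lam 0 m * gtilde u.1 u.2 (z m).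

Let p_ge0 t : 0 <= p t. Proof. exact: sqrtr_ge0. Qed.
Let q_ge0 t : 0 <= q t. Proof. exact: sqrtr_ge0. Qed.

Let lams_ge0 : 0 <= \sum_m lam 0 m. Proof. exact: sumr_ge0. Qed.

Let L_gt0 : 0 < L.
Proof. by rewrite mulr_gt0 ?kappa_gt0//; move: lams_ge0; lra. Qed.

(** [p t] bounds the increments of [x] and of [mu] separately, hence the factor [2]. *)
Let vv_var t m : (t <= T)%N -> enorm (vv t m - vv t.-1 m) <= kappa * (2 * p t + q t + e).
Proof.
move=> tT; have tT' : (t.-1 <= T)%N := leq_trans (leq_pred _) tT.
have [Xx bm Zz] := run_dom tT; have [Xx' bm' Zz'] := run_dom tT'.
have := zetat_varying (imu tr t.-1 m) Xx Xx' (bm m) (Zz m) (Zz' m) (zsP tT) (zsP tT')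
  (fun i => esP i tT) (fun i => esP i tT').
move=> /le_trans; apply; rewrite ler_wpM2l ?(ltW kappa_gt0)// lerD2r lerD//; last first.
  exact: enorm_le_zdist.
have := enorm_le_sqdist_x (U t) (U t.-1); have := enorm_le_sqdist_mu (U t) (U t.-1) m.
by rewrite /= -/(p t); lra.
Qed.

Let ler_sum_lam (F : 'I_(M P) -> R) c : 0 <= c -> (forall m, F m <= kappa * c) ->
  \sum_m lam 0 m * F m <= L * c.
Proof.
move=> c0 Fc; apply: (@le_trans _ _ (\sum_m lam 0 m * (kappa * c))).
  by apply: ler_sum => m _; rewrite ler_wpM2l.
rewrite -mulr_suml /L mulrCA mulrA ler_wpM2r// ler_wpM2l ?(ltW kappa_gt0)//; lra.
Qed.

Let concave_gap t (z : zvec P) : (t <= T)%N -> Ztprod P z ->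
  Phi (U t) z - Phi (U t) (iz tr t) <= \sum_m lam 0 m * dotv (vv t m) (iz tr t m - z m).
Proof.
move=> tT Zz; have [Xx bm Zw] := run_dom tT.
rewrite /Phi opprD addrACA subrr add0r -sumrB; apply: ler_sum => m _.
rewrite -mulrBr ler_wpM2l//.
exact: (gtilde_concave_bound cvxP Xx (bm m) (Zz m) (Zw m) (zsP tT) (fun i => esP i tT)).
Qed.

Let convex_gap t (u : xvec P * muvec P) : (t < T)%N -> X P u.1 ->
  Phi (U t.+1) (iz tr t.+1) - Phi u (iz tr t.+1) <=
  dotv (xit lam tr t) (ix tr t.+1 - u.1)
  - \sum_m lam 0 m * dotv (hvec (iz tr t.+1 m)) (imu tr t.+1 m - u.2 m)
  + L * ((p t.+1 + e) * p t.+1).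
Proof.
move=> tT Xu; have [Xx bm _] := run_dom (ltnW tT).
have [Xx' bm' Zz'] := run_dom tT.
have [_ s0 sx _ _] := st tT.
have h0 := descent (reg_f0_ex regP) (reg_f0_var regP) (f0_fin cvxP) Xu Xx Xx' s0.
set d := enorm (ix tr t.+1 - ix tr t) in h0.
have dp : d <= p t.+1 by exact: (enorm_le_sqdist_x (U t.+1) (U t)).
have d0 : 0 <= d by exact: enorm_ge0.
have dd : (d + e) * d <= (p t.+1 + e) * p t.+1.
  by rewrite ler_pM ?addr_ge0// lerD2r.
have hg m := gtilde_descent cvxP regP u.2 (imu tr t.+1) Xu Xx Xx' (Zz' m) (sx m).
have hs : \sum_m lam 0 m * gtilde (ix tr t.+1) (imu tr t.+1) (iz tr t.+1 m)
    - \sum_m lam 0 m * gtilde u.1 u.2 (iz tr t.+1 m) <=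
    dotv (\sum_m lam 0 m *: ixi tr t m) (ix tr t.+1 - u.1)
    - \sum_m lam 0 m * dotv (hvec (iz tr t.+1 m)) (imu tr t.+1 m - u.2 m)
    + \sum_m lam 0 m * (D * ((d + e) * d)).
  rewrite dotv_suml -!sumrB -big_split; apply: ler_sum => m _ /=.
  by rewrite dotvZl -!mulrBr -mulrDr ler_wpM2l// mulrA; exact: hg.
have hD : D * ((d + e) * d) + \sum_m lam 0 m * (D * ((d + e) * d)) <= L * ((p t.+1 + e) * p t.+1).
  rewrite -mulr_suml -{1}[D * _]mul1r -mulrDl mulrA ler_pM//.
  - by rewrite mulr_ge0 ?(ltW D_gt0)// addr_ge0.
  - by rewrite mulr_ge0// addr_ge0.
  - by rewrite mulrC ler_wpM2r ?kappa_ge// addr_ge0.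
by rewrite /Phi /xit dotvDl; move: h0 hs hD; rewrite /= mulrA; lra.
Qed.

Let prox_gap t (u : xvec P * muvec P) : (t < T)%N -> X P u.1 -> Mbox a u.2 ->
  dotv (xit lam tr t) (ix tr t.+1 - u.1)
  - \sum_m lam 0 m * dotv (hvec (iz tr t.+1 m)) (imu tr t.+1 m - u.2 m) <=
  (2 * alpha)^-1 * (sqdist P u (xk, muk) - sqdist P u (U t.+1) - sqdist P (U t.+1) (xk, muk))
  + (2 * s)^-1 * (sqdist P u (U t) - sqdist P u (U t.+1) - sqdist P (U t.+1) (U t)).
Proof.
move=> tT Xu bu; have [_ _ _ hx hmu] := st tT.
have h1 := prox_step (X_convex cvxP) alpha_gt0 s_gt0 hx Xu.
have h2 : - \sum_m lam 0 m * dotv (hvec (iz tr t.+1 m)) (imu tr t.+1 m - u.2 m) <=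
    \sum_m ((2 * alpha)^-1 * (enorm (u.2 m - muk m) ^+ 2 - enorm (u.2 m - imu tr t.+1 m) ^+ 2
              - enorm (imu tr t.+1 m - muk m) ^+ 2)
            + (2 * s)^-1 * (enorm (u.2 m - imu tr t m) ^+ 2 - enorm (u.2 m - imu tr t.+1 m) ^+ 2
              - enorm (imu tr t.+1 m - imu tr t m) ^+ 2)).
  rewrite -sumrN; apply: ler_sum => m _; rewrite -dotvZl -dotvNl.
  have hm := hmu m; rewrite -(opprK (lam 0 m *: _)) in hm.
  apply: (prox_step (@box_convex _ _ a m) alpha_gt0 s_gt0 hm (bu m)).
apply: le_trans (lerD h1 h2) _; rewrite big_split /= -!mulr_sumr !sumrB /sqdist /=; lra.
Qed.

Let proj_gap t (z : zvec P) : (t < T)%N -> Ztprod P z ->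
  \sum_m lam 0 m * dotv (2 *: vv t m - vv t.-1 m) (iz tr t.+1 m - z m) <=
  (2 * s)^-1 * (zdist z (iz tr t) - zdist z (iz tr t.+1) - zdist (iz tr t.+1) (iz tr t)).
Proof.
move=> tT Zz; have tT' : (t.-1 < T)%N := leq_ltn_trans (leq_pred _) tT.
rewrite /zdist -!sumrB mulr_sumr; apply: ler_sum => m _.
rewrite -dotvZl !vvE//; have [+ _ _ _ _] := st tT => /(_ m)[_ _].
by rewrite -scalerA => pj; exact: proj_step (@Zt_convex _ _ cvxP m) s_gt0 pj (Zz m).
Qed.

(** The telescoping coupling term; it vanishes at [t = 0], where [t.-1 = t]. *)
Let c (z : zvec P) t := \sum_m lam 0 m * dotv (vv t m - vv t.-1 m) (iz tr t m - z m).

Let cross t (z : zvec P) : (t < T)%N ->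
  \sum_m lam 0 m * dotv (vv t.+1 m) (iz tr t.+1 m - z m) <=
  \sum_m lam 0 m * dotv (2 *: vv t m - vv t.-1 m) (iz tr t.+1 m - z m)
  + (c z t.+1 - c z t) + L * ((2 * p t + q t + e) * q t.+1).
Proof.
move=> tT; have h : \sum_m lam 0 m * - dotv (vv t m - vv t.-1 m) (iz tr t.+1 m - iz tr t m) <=
    L * ((2 * p t + q t + e) * q t.+1).
  apply: ler_sum_lam => [|m]; first by rewrite mulr_ge0// !addr_ge0// mulr_ge0.
  rewrite -dotvNl (le_trans (cauchy_schwarz _ _))// enormN mulrA ler_pM ?enorm_ge0//.
    by apply: vv_var; exact: ltnW.
  exact: enorm_le_zdist.
rewrite -lerBlDl; apply: le_trans h; rewrite /c opprD addrA -!sumrB.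
by apply: ler_sum => m _; rewrite -!mulrBr ler_wpM2l// extrapolationE.
Qed.

Let F := prox_lagrangian alpha lam xk muk.

(** The last term is left over by the proximal inequality and is what makes the averaged point a
    strong saddle point. *)
Let gap u z t := F (U t) z - F u (iz tr t) + alpha^-1 / 2 * sqdist P u (U t).


Let sqr_p t : p t ^+ 2 = sqdist P (U t) (U t.-1).
Proof. by rewrite sqr_sqrtr ?sqdist_ge0. Qed.

Let sqr_q t : q t ^+ 2 = zdist (iz tr t) (iz tr t.-1).
Proof. by rewrite sqr_sqrtr ?zdist_ge0. Qed.

Let gap_step t (u : xvec P * muvec P) (z : zvec P) : (t < T)%N ->
    X P u.1 -> Mbox a u.2 -> Ztprod P z ->
  gap u z t.+1 <= (2 * s)^-1 * (sqdist P u (U t) - sqdist P u (U t.+1))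
    + (2 * s)^-1 * (zdist z (iz tr t) - zdist z (iz tr t.+1))
    - (2 * s)^-1 * p t.+1 ^+ 2 - (2 * s)^-1 * q t.+1 ^+ 2 + (c z t.+1 - c z t)
    + L * ((p t.+1 + e) * p t.+1) + L * ((2 * p t + q t + e) * q t.+1).
Proof.
move=> tT Xu bu Zz; rewrite sqr_p sqr_q.
have h1 := concave_gap tT Zz; have h2 := convex_gap tT Xu.
have h3 := prox_gap tT Xu bu; have h4 := proj_gap tT Zz; have h5 := cross z tT.
have -> : gap u z t.+1 = Phi (U t.+1) z - Phi u (iz tr t.+1)
    + (2 * alpha)^-1 * (sqdist P (U t.+1) (xk, muk) - sqdist P u (xk, muk) + sqdist P u (U t.+1)).
  by rewrite /gap /F /prox_lagrangian -[(2 * alpha)^-1]mulr1 invfM /Phi; lra.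
by lra.
Qed.

(** Of each proximal weight [(2 * s)^-1], a quarter absorbs the slack [e] by Young's inequality; on
    the primal side the descent remainder takes [L] more. The coupling has [V = 2 * L], and the
    resulting dual threshold [3 * L] is exactly what [s * (8 * L) <= 1] provides. *)
Lemma inner_gap_sum (u : xvec P * muvec P) (z : zvec P) (d : R) : 0 <= d ->
    (forall u u' : xvec P * muvec P, X P u.1 -> Mbox a u.2 -> X P u'.1 -> Mbox a u'.2 ->
       sqdist P u u' <= d ^+ 2) ->
    (forall z z', Ztprod P z -> Ztprod P z' -> zdist z z' <= d ^+ 2) ->
    s * (8 * L) <= 1 -> X P u.1 -> Mbox a u.2 -> Ztprod P z ->
  \sum_(1 <= t < T.+1) gap u z t <=
  d ^+ 2 / s + L * ((3 * d + e) * d) + T%:R * (4 * s * L ^+ 2 * e ^+ 2).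
Proof.
move=> d0 hU hZ sL Xu bu Zz.
have iE : (2 * s)^-1 = s^-1 / 2 by rewrite invfM mulrC.
have sL' : 8 * L <= s^-1 by rewrite -[s^-1]mul1r ler_pdivlMr// mulrC.
have := @primal_dual_telescope _ T (2 * s)^-1 (2 * s)^-1
  ((2 * s)^-1 - L - (2 * s)^-1 / 4) ((2 * s)^-1 - (2 * s)^-1 / 4) (2 * L)
  (4 * s * L ^+ 2 * e ^+ 2) (gap u z) (fun t => sqdist P u (U t)) (fun t => zdist z (iz tr t))
  (c z) p q.
have p0 : p 0%N = 0.
  apply/eqP; rewrite -sqrf_eq0 sqr_p /sqdist /= subrr enorm0 expr0n add0r big1// => m _.
  by rewrite subrr enorm0 expr0n.
have q0 : q 0%N = 0.
  apply/eqP; rewrite -sqrf_eq0 sqr_q /zdist /= big1// => m _.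
  by rewrite subrr enorm0 expr0n.
move=> H; apply: le_trans (H _ _ _ p0 q0 _) _; clear H.
- by rewrite mulr_ge0// ltW.
- by rewrite iE; move: L_gt0 sL'; move: (s^-1) (L) => *; lra.
- by rewrite iE; move: L_gt0 sL'; move: (s^-1) (L) => *; lra.
- move=> t tT; apply: le_trans (gap_step tT Xu bu Zz) _.
  have s20 : 0 < (2 * s)^-1 by rewrite invr_gt0 mulr_gt0.
  have yp := young L e (p t.+1) s20; have yq := young L e (q t.+1) s20.
  have iV : L ^+ 2 * e ^+ 2 / (2 * s)^-1 = 2 * s * L ^+ 2 * e ^+ 2.
    by rewrite invrK; ring.
  rewrite {}iV in yp yq; have hq := mulr_ge0 (mulr_ge0 (ltW L_gt0) (q_ge0 t)) (q_ge0 t.+1).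
  by lra.
have c0 : c z 0%N = 0 by rewrite /c big1// => m _; rewrite subrr dotv0l mulr0.
(* Boundary term of the telescope: the last increments are at most the diameter [d], whence
   [3 * d + e]. *)
have cT : c z T <= L * ((3 * d + e) * d).
  have [XT bT ZT] := run_dom (leqnn T).
  have [XT' bT' ZT'] := run_dom (leq_pred T).
  have pT : p T <= d.
    rewrite -(ler_pXn2r (ltn0Sn 1)) ?nnegrE// sqr_p; exact: hU.
  have qT : q T <= d.
    rewrite -(ler_pXn2r (ltn0Sn 1)) ?nnegrE// sqr_q; exact: hZ.
  apply: ler_sum_lam => [|m]; first by rewrite mulr_ge0// !addr_ge0// mulr_ge0.
  rewrite (le_trans (cauchy_schwarz _ _))// mulrA ler_pM ?enorm_ge0//.
    apply: le_trans (vv_var m (leqnn T)) _; rewrite ler_wpM2l ?(ltW kappa_gt0)//.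
    by move: pT qT; move: (p T) (q T) => *; lra.
  apply: le_trans (enorm_le_zdist _ _ m) _.
  by rewrite -(ler_pXn2r (ltn0Sn 1)) ?nnegrE ?sqrtr_ge0// sqr_sqrtr ?zdist_ge0//; exact: hZ.
have [X0 b0 Z0] := run_dom (leq0n T).
have A0 := hU u (U 0%N) Xu bu X0 b0; have B0 := hZ z (iz tr 0%N) Zz Z0.
rewrite c0 subr0; apply: lerD => //; apply: lerD => //.
rewrite -mulrDr iE [leRHS]mulrC -mulrA ler_wpM2l ?invr_ge0 ?(ltW s_gt0)//.
have := sqdist_ge0 u (U T); have := zdist_ge0 z (iz tr T); move: A0 B0; lra.
Qed.

(** Jensen in both arguments: the Lagrangian is convex in [(x, mu)] and, as the entries of [u.2] are
    non-negative, concave in [z]; the strong convexity term is convex in its moving point. *)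
Lemma inner_average (u : xvec P * muvec P) (z : zvec P) : (0 < T)%N ->
    X P u.1 -> Mbox a u.2 -> Ztprod P z ->
  F (inner_x T tr, inner_mu T tr) z <=
  F u (inner_z T tr) - alpha^-1 / 2 * sqdist P u (inner_x T tr, inner_mu T tr)
  + T%:R^-1 * \sum_(1 <= t < T.+1) gap u z t.
Proof.
move=> T0 Xu bu Zz.
have dom t : (0 < t <= T)%N -> [/\ X P (ix tr t), Mbox a (imu tr t) & Ztprod P (iz tr t)].
  by move=> /andP[_]; exact: run_dom.
have f0a := f0_average cvxP T0 (fun t tT => let: And3 Xt _ _ := dom t tT in Xt).
have sqa w := sqdist_average T0 (ix tr) (imu tr) w.
have ga : \sum_m lam 0 m * gtilde (inner_x T tr) (inner_mu T tr) (z m) <=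
    mean T (fun t => \sum_m lam 0 m * gtilde (ix tr t) (imu tr t) (z m)).
  rewrite mean_sum; apply: ler_sum => m _; rewrite meanZ ler_wpM2l//.
  by apply: gtilde_average_x => // t /dom[].
have gz : mean T (fun t => \sum_m lam 0 m * gtilde u.1 u.2 (iz tr t m)) <=
    \sum_m lam 0 m * gtilde u.1 u.2 (inner_z T tr m).
  rewrite mean_sum; apply: ler_sum => m _; rewrite meanZ ler_wpM2l//.
  apply: (gtilde_average_z cvxP T0 (s := fun t => iz tr t m)) => // [i|t /dom[_ _]]; last exact.
  by have /andP[] := bu m i.
have sqC (v w : xvec P * muvec P) : sqdist P v w = sqdist P w v.
  by rewrite /sqdist enormB; congr (_ + _); apply: eq_bigr => m _; rewrite enormB.
have -> : T%:R^-1 * \sum_(1 <= t < T.+1) gap u z t =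
    mean T (fun t => fine (f0 P (ix tr t)))
    + mean T (fun t => \sum_m lam 0 m * gtilde (ix tr t) (imu tr t) (z m))
    + (2 * alpha)^-1 * mean T (fun t => sqdist P (U t) (xk, muk))
    - (fine (f0 P u.1) + mean T (fun t => \sum_m lam 0 m * gtilde u.1 u.2 (iz tr t m))
       + (2 * alpha)^-1 * sqdist P u (xk, muk))
    + alpha^-1 / 2 * mean T (fun t => sqdist P (U t) u).
  rewrite -!meanZ -[fine (f0 P u.1)](mean_cst T0) -[_ * sqdist P u (xk, muk)](mean_cst T0).
  rewrite -!meanD -[- mean T _]mulN1r -!meanZ -!meanD; congr (_ * _).
  apply: eq_bigr => t _; by rewrite /gap /F /prox_lagrangian mulN1r [sqdist P u (U t)]sqC.
have a0 : 0 <= (2 * alpha)^-1 by rewrite invr_ge0 mulr_ge0// ltW.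
have a1 : 0 <= alpha^-1 / 2 by rewrite divr_ge0 ?invr_ge0// ltW.
have := ler_wpM2l a0 (sqa (xk, muk)); have := ler_wpM2l a1 (sqa u).
rewrite /F /prox_lagrangian /= [sqdist P u (inner_x _ _, _)]sqC.
move: f0a ga gz; rewrite -/(inner_x T tr) -/(inner_mu T tr); lra.
Qed.

End Trace.
End InnerLoop.

(** * The outer loop *)

Section WorstCase.
Context {R : realType} (P : problem R) (a : 'I_(M P) -> R) (e D : R).
Hypothesis cvxP : convex_problem P.
Hypothesis regP : regular P e D.
Hypothesis a_gt0 : forall m, 0 < a m.

Lemma subdiff_lipschitz n (S : set 'rV[R]_n) f x y :
    subdifferentiable_on S f -> bounded_subdiff S f D ->
    (forall x, S x -> f x \is a fin_num) -> S x -> S y ->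
  `|fine (f x) - fine (f y)| <= D * enorm (x - y).
Proof.
move=> sf bf ff Sx Sy.
have half u v : S u -> S v -> fine (f u) - fine (f v) <= D * enorm (u - v).
  move=> Su Sv; have [xi su] := sf u Su.
  have := subdiff_fine (ff u Su) (ff v Sv) su; rewrite -(opprB u v) dotvNr.
  have := cauchy_schwarz xi (u - v); have := ler_wpM2r (enorm_ge0 (u - v)) (bf u xi Su su).
  by lra.
have := half x y Sx Sy; have := half y x Sy Sx; rewrite (enormB y x).
by rewrite ler_norml => *; apply/andP; split; lra.
Qed.

Lemma dotv_le_coords n (u v : 'rV[R]_n) : `|dotv u v| <= enorm u * \sum_i `|v 0 i|.
Proof.
apply: le_trans (ler_norm_sum _ _ _) _; rewrite mulr_sumr; apply: ler_sum => i _.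
by rewrite normrM ler_wpM2r// ler_coord_enorm.
Qed.

(** Lipschitz bounds propagate the values at one base point [(x0, z0)] over the compact sets. *)
Lemma problem_bounds : exists d H B : R, [/\ 0 < d, 0 <= H, 0 <= B &
  [/\ forall u u' : xvec P * muvec P, X P u.1 -> Mbox a u.2 -> X P u'.1 -> Mbox a u'.2 ->
        sqdist P u u' <= d ^+ 2,
      forall z z', Ztprod P z -> Ztprod P z' -> zdist z z' <= d ^+ 2,
      forall (m : 'I_(M P)) (z : 'rV[R]_(J m)), Zt m z -> \sum_i `|hvec z 0 i| <= H
    & forall (m : 'I_(M P)) x mu (z : 'rV[R]_(J m)), X P x -> Mbox a mu -> Zt m z ->
        `|gtilde x mu z| <= B]].
Proof.
have [d d0 [dX dZ dB]] := @diameter _ P a cvxP.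
have zE (m : 'I_(M P)) : exists z : 'rV[R]_(J m), Zt m z by exact: Zt_nonempty.
pose z0 (m : 'I_(M P)) := projT1 (cid (zE m)).
have Zz0 m : Zt m (z0 m) by exact: (projT2 (cid (zE m))).
have [x0 Xx0] := X_nonempty cvxP.
have D0 := ltW (reg_gt0 regP).
have MR0 : 0 <= (M P)%:R :> R by [].
have csum r : \sum_(m < M P) r = (M P)%:R * r :> R by rewrite sumr_const card_ord mulr_natl.
pose Hm (m : 'I_(M P)) := \sum_(i < nI m) (`|hvec (z0 m) 0 i| + D * d).
have Hm0 m : 0 <= Hm m by apply: sumr_ge0 => i _; rewrite addr_ge0// mulr_ge0// ltW.
have hH (m : 'I_(M P)) (z : 'rV[R]_(J m)) : Zt m z -> \sum_i `|hvec z 0 i| <= \sum_m Hm m.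
  move=> Zz; apply: le_trans (ler_sum_pos m Hm0); apply: ler_sum => i _; rewrite !mxE.
  have hi := subdiff_lipschitz (reg_h_ex regP i) (reg_h_bnd regP (i := i))
    (@h_fin _ _ cvxP _ i) Zz (Zz0 m).
  have := le_trans hi (ler_wpM2l D0 (dZ _ _ _ Zz (Zz0 m))).
  move/(le_trans (lerB_dist _ _)); lra.
pose Bm m := `|fine (g m x0 (z0 m))| + D * d + D * d + d * \sum_m Hm m.
have S0 : 0 <= \sum_m Hm m by exact: sumr_ge0.
have Bm0 m : 0 <= Bm m by rewrite /Bm !addr_ge0// ?mulr_ge0// ltW.
(* At most [1 + M P] blocks contribute [d ^ 2] each, and [1 + M P] is below its square. *)
exists ((1 + (M P)%:R) * d), (\sum_m Hm m), (\sum_m Bm m); split=> //.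
- by rewrite mulr_gt0// ltr_wpDr.
- exact: sumr_ge0.
have sqd (r : R) : 0 <= r <= d -> r ^+ 2 <= d ^+ 2 by move=> rd; rewrite ler_pXn2r ?nnegrE//; lra.
have dd : 0 <= (M P)%:R * d ^+ 2 by rewrite mulr_ge0// sqr_ge0.
have dd2 : 0 <= (M P)%:R ^+ 2 * d ^+ 2 by rewrite mulr_ge0 ?sqr_ge0.
split=> //.
- move=> u u' Xu bu Xu' bu'; apply: (@le_trans _ _ (d ^+ 2 + \sum_(m < M P) d ^+ 2)).
    apply: lerD; first by rewrite sqd// enorm_ge0 dX.
    by apply: ler_sum => m _; rewrite sqd// enorm_ge0 dB.
  by rewrite csum exprMn sqrrD; lra.
- move=> z z' Zz Zz'; apply: (@le_trans _ _ (\sum_(m < M P) d ^+ 2)).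
    by apply: ler_sum => m _; rewrite sqd// enorm_ge0 dZ.
  by rewrite csum exprMn sqrrD; have := sqr_ge0 d; lra.
- move=> m x mu z Xx bmu Zz; apply: le_trans (ler_sum_pos m Bm0); rewrite /Bm.
  have h1 := le_trans (subdiff_lipschitz (reg_gx_ex regP Zz) (reg_gx_bnd regP Zz)
    (fun x Xx => g_fin cvxP Xx Zz) Xx Xx0) (ler_wpM2l D0 (dX _ _ Xx Xx0)).
  have h2 := subdiff_lipschitz (reg_gz_ex regP Xx0) (reg_gz_bnd regP Xx0) (x := z) (y := z0 m).
  have {}h2 : `|fine (g m x0 z) - fine (g m x0 (z0 m))| <= D * d.
    rewrite -normrN opprB [X in `|X|](_ : _ = fine (- g m x0 z) - fine (- g m x0 (z0 m)));
      last by rewrite !fineN; lra.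
    apply: le_trans (h2 _ Zz (Zz0 m)) (ler_wpM2l D0 (dZ _ _ _ Zz (Zz0 m))).
    by move=> w Zw; rewrite fin_numN; exact: g_fin.
  have h3 : `|dotv (mu m) (hvec z)| <= d * \sum_m Hm m.
    apply: le_trans (dotv_le_coords _ _) _; rewrite ler_pM ?enorm_ge0 ?sumr_ge0 ?hH//.
    by rewrite -[mu m]subr0 dB// => i; rewrite mxE lexx ltW.
  rewrite /gtilde; apply: le_trans (ler_normB _ _) (lerD _ h3).
  move: h1 h2; rewrite !ler_norml => /andP[? ?] /andP[? ?].
  have norm_itv (r : R) : - `|r| <= r <= `|r| by rewrite -ler_norml.
  have /andP[? ?] := norm_itv (fine (g m x0 (z0 m))).
  by apply/andP; split; lra.
Qed.

Definition worst (u : xvec P * muvec P) (m : 'I_(M P)) : R :=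
  sup [set gtilde u.1 u.2 z | z in Zt m].

Section WorstBounds.
Variables H B : R.
Hypothesis hH : forall (m : 'I_(M P)) (z : 'rV[R]_(J m)), Zt m z -> \sum_i `|hvec z 0 i| <= H.
Hypothesis gB : forall (m : 'I_(M P)) x mu (z : 'rV[R]_(J m)),
  X P x -> Mbox a mu -> Zt m z -> `|gtilde x mu z| <= B.

Lemma worst_has_sup u m : X P u.1 -> Mbox a u.2 ->
  has_sup [set gtilde u.1 u.2 z | z in Zt m].
Proof.
move=> Xu bu; split; first by have [z Zz] := @Zt_nonempty _ _ cvxP m; exists (gtilde u.1 u.2 z), z.
by exists B => _ [z Zz <-]; rewrite (le_trans (ler_norm _))// gB.
Qed.

Lemma worst_ub u (m : 'I_(M P)) (z : 'rV[R]_(J m)) : X P u.1 -> Mbox a u.2 -> Zt m z ->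
  gtilde u.1 u.2 z <= worst u m.
Proof. by move=> Xu bu Zz; apply: (ub_le_sup (@worst_has_sup u m Xu bu).2); exists z. Qed.

Lemma worst_le u m c : (forall z : 'rV[R]_(J m), Zt m z -> gtilde u.1 u.2 z <= c) ->
  worst u m <= c.
Proof.
move=> h; apply: ge_sup => [|_ [z Zz <-]]; last exact: h.
by have [z Zz] := @Zt_nonempty _ _ cvxP m; exists (gtilde u.1 u.2 z), z.
Qed.

Lemma worst_adherent u m (r : R) : X P u.1 -> Mbox a u.2 -> 0 < r ->
  exists2 z : 'rV[R]_(J m), Zt m z & worst u m - r < gtilde u.1 u.2 z.
Proof.
move=> Xu bu r0; have [_ [z Zz <-] zr] := sup_adherent r0 (@worst_has_sup u m Xu bu).
by exists z.
Qed.

Lemma worst_norm u m : X P u.1 -> Mbox a u.2 -> `|worst u m| <= B.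
Proof.
move=> Xu bu; have [z Zz] := @Zt_nonempty _ _ cvxP m.
have := worst_ub Xu bu Zz; have := gB Xu bu Zz; rewrite !ler_norml => /andP[B1 _] zw.
rewrite (le_trans B1 zw)/=; apply: worst_le => w Zw.
by rewrite (le_trans (ler_norm _))// gB.
Qed.

(** A supremum of functions with a common Lipschitz constant: [D] in [x], and [H] in [mu], whose
    coefficients are values of [h]. *)
Lemma worst_lipschitz u u' m : X P u.1 -> Mbox a u.2 -> X P u'.1 -> Mbox a u'.2 ->
  `|worst u m - worst u' m| <= (D + H) * Num.sqrt (sqdist P u u').
Proof.
have D0 := ltW (reg_gt0 regP).
have half v v' : X P v.1 -> Mbox a v.2 -> X P v'.1 -> Mbox a v'.2 ->
    worst v m - worst v' m <= (D + H) * Num.sqrt (sqdist P v v').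
  move=> Xv bv Xv' bv'; rewrite lerBlDr; apply: worst_le => z Zz.
  have := worst_ub Xv' bv' Zz.
  have := le_trans (ler_norm _) (subdiff_lipschitz (reg_gx_ex regP Zz) (reg_gx_bnd regP Zz)
    (fun x Xx => g_fin cvxP Xx Zz) Xv Xv').
  have := le_trans (ler_norm _) (dotv_le_coords (v'.2 m - v.2 m) (hvec z)).
  rewrite dotvDl dotvNl enormB.
  have s0 : 0 <= \sum_i `|hvec z 0 i| by exact: sumr_ge0.
  have := ler_pM (enorm_ge0 _) s0 (enorm_le_sqdist_mu v v' m) (hH Zz).
  have := ler_wpM2l D0 (enorm_le_sqdist_x v v').
  by rewrite /gtilde; lra.
move=> Xu bu Xu' bu'; have := half _ _ Xu bu Xu' bu'; have := half _ _ Xu' bu' Xu bu.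
have -> : sqdist P u' u = sqdist P u u'.
  by rewrite /sqdist enormB; congr (_ + _); apply: eq_bigr => i _; rewrite enormB.
by rewrite ler_norml => *; apply/andP; split; lra.
Qed.

Lemma worst_convex u u' v m (t : R) : 0 <= t <= 1 ->
    X P u.1 -> Mbox a u.2 -> X P u'.1 -> Mbox a u'.2 ->
    v.1 = t *: u.1 + (1 - t) *: u'.1 -> v.2 m = t *: u.2 m + (1 - t) *: u'.2 m ->
  worst v m <= t * worst u m + (1 - t) * worst u' m.
Proof.
move=> t01 Xu bu Xu' bu' v1 v2; apply: worst_le => z Zz; rewrite v1.
apply: le_trans (gtilde_convex cvxP t01 Zz Xu Xu' v2) _.
by apply: lerD; rewrite ler_wpM2l ?worst_ub//; lra.
Qed.

Lemma worst_average T (s : nat -> xvec P) (mus : nat -> muvec P) m : (0 < T)%N ->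
    (forall t, (0 < t <= T)%N -> X P (s t) /\ Mbox a (mus t)) ->
  worst (average T s, fun m => average T (fun t => mus t m)) m <=
  mean T (fun t => worst (s t, mus t) m).
Proof.
move=> T0 dom; apply: worst_le => z Zz /=.
apply: le_trans (gtilde_average_x cvxP T0 mus Zz (fun t tT => (dom t tT).1)) _.
rewrite /mean ler_wpM2l ?invr_ge0// !big_nat; apply: ler_sum => t tT.
by have [Xt bt] := dom t tT; exact: (worst_ub (u := (s t, mus t)) Xt bt Zz).
Qed.

End WorstBounds.
End WorstCase.

Section OuterLoop.
Context {R : realType} (P : problem R) (a : 'I_(M P) -> R) (e D H B d : R).
Hypothesis cvxP : convex_problem P.
Hypothesis regP : regular P e D.
Hypothesis hH : forall (m : 'I_(M P)) (z : 'rV[R]_(J m)), Zt m z -> \sum_i `|hvec z 0 i| <= H.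
Hypothesis gB : forall (m : 'I_(M P)) x mu (z : 'rV[R]_(J m)),
  X P x -> Mbox a mu -> Zt m z -> `|gtilde x mu z| <= B.
Hypothesis H_ge0 : 0 <= H.
Hypothesis B_ge0 : 0 <= B.
Hypothesis hU : forall u u' : xvec P * muvec P, X P u.1 -> Mbox a u.2 -> X P u'.1 -> Mbox a u'.2 ->
  sqdist P u u' <= d ^+ 2.
Hypothesis M_gt0 : (0 < M P)%N.

Variables (p : params P) (r : trace P).
Hypothesis valid : valid_params p.
Hypothesis run : prom3_run a p r.
Hypothesis saddle : saddle_updates a p r.

Let K := pK p.
Let alpha := palpha p.
Let beta := pbeta p.
Let nu := pnu p.
Let theta := ptheta p.

Let alpha_gt0 : 0 < alpha. Proof. by case: valid => _ []. Qed.
Let beta_gt0 : 0 < beta. Proof. by case: valid => _ []. Qed.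
Let theta_gt0 : 0 < theta. Proof. by case: valid => _ []. Qed.

(** Lipschitz constant of the coupling, summed over the constraints. Step sizes [1 / (3 * V)] make
    the proximal weights [3 * V / 2], the dual threshold of [primal_dual_telescope]. *)
Let V : R := (M P)%:R * (D + H).

Let V_gt0 : 0 < V.
Proof. by rewrite mulr_gt0 ?ltr0n// ltr_wpDr// (reg_gt0 regP). Qed.

Hypothesis alphaE : 3 * V * alpha = 1.
Hypothesis betaE : 3 * V * beta = 1.

Let st k (kK : (k < K)%N) : outer_step a p r k.
Proof. by case: run => _ _ _; apply. Qed.

Let W k : xvec P * muvec P := (ox r k, omu r k).
Let lam k : 'I_(M P) -> R := fun m => olam r k 0 m.
Let Fk k := worst (W k).
Let gk k m := gtilde (ox r k) (omu r k) (oz r k m).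

Lemma outer_run_dom k : (k <= K)%N -> X P (ox r k) /\ Mbox a (omu r k).
Proof.
case: k => [_|k kK]; first by case: run.
by have [[? ?] _ _] := saddle kK.
Qed.

Let gkP k m : (k < K)%N -> Fk k m - theta <= gk k m <= Fk k m.
Proof.
move=> kK; have [Xk bk] := outer_run_dom (ltnW kK); have [hz _ _ _ _] := st kK.
have [Zz hmax] := hz m; apply/andP; split; last exact: (worst_ub cvxP gB (u := W k)).
rewrite lerBlDr; apply: (worst_le cvxP) => z Zz'; rewrite -lee_fin; apply: le_trans hmax.
by apply: ereal_sup_ubound; exists z.
Qed.

Let lamS k m : (k < K)%N -> lam k.+1 m = Num.max (lam k m + beta * (2 * gk k m - gk k.-1 m)) 0.
Proof. by move=> kK; have [_ hl _ _ _] := st kK; exact: hl. Qed.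

Let lam0 m : lam 0 m = 0.
Proof. by rewrite /lam; case: run => -> *; rewrite mxE. Qed.

Lemma olam_ge0 k m : (k <= K)%N -> 0 <= olam r k 0 m.
Proof.
case: k => [_|k kK]; first by rewrite -/(lam 0 m) lam0.
by rewrite -/(lam k.+1 m) lamS// le_max lexx orbT.
Qed.

Let gk_norm k m : (k < K)%N -> `|gk k m| <= B.
Proof.
move=> kK; have [Xk bk] := outer_run_dom (ltnW kK); have [hz _ _ _ _] := st kK.
by apply: gB => //; case: (hz m).
Qed.

(* Growing with [k], but harmless: [theta] may be chosen after [K]. *)
Let lam_crude k m : (k <= K)%N -> lam k m <= k%:R * (3 * beta * B).
Proof.
elim: k => [|k IH] kK; first by rewrite lam0 mul0r.
have kB : 0 <= 3 * beta * B by rewrite !mulr_ge0// ltW.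
have kE : k.+1%:R * (3 * beta * B) = k%:R * (3 * beta * B) + 3 * beta * B.
  by set x := 3 * beta * B; rewrite -natr1 mulrDl mul1r.
rewrite lamS// ge_max mulr_ge0// andbT kE; apply: lerD; first exact: IH (ltnW kK).
have := gk_norm m kK; have := gk_norm m (leq_ltn_trans (leq_pred k) kK).
rewrite !ler_norml => /andP[? ?] /andP[? ?].
have : beta * (2 * gk k m - gk k.-1 m) <= beta * (3 * B) by rewrite ler_pM2l//; lra.
by lra.
Qed.

Let Lam := K%:R * (3 * beta * B).

Let lam_le k m : (k <= K)%N -> lam k m <= Lam.
Proof.
move=> kK; apply: le_trans (lam_crude m kK) _.
by rewrite ler_wpM2r ?ler_nat// !mulr_ge0// ltW.
Qed.

(** The saddle inequality is tested at a [z] that nearly maximizes every constraint at the new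
    iterate; on the other side the inner average of [z] is replaced by the worst case at [w]. *)
Let saddle_step k (w : xvec P * muvec P) : (k < K)%N -> X P w.1 -> Mbox a w.2 ->
  fine (f0 P (ox r k.+1)) + \sum_m lam k.+1 m * Fk k.+1 m
    + (2 * alpha)^-1 * sqdist P (W k.+1) (W k) <=
  fine (f0 P w.1) + \sum_m lam k.+1 m * worst w m + (2 * alpha)^-1 * sqdist P w (W k)
    - (2 * alpha)^-1 * sqdist P w (W k.+1) + nu.
Proof.
move=> kK Xw bw; have [X1 b1] := outer_run_dom kK.
have [_ Zz hs] := saddle kK.
have l0 m : 0 <= lam k.+1 m by exact: olam_ge0.
have s0 : 0 <= \sum_m lam k.+1 m by exact: sumr_ge0.
(* The supremum in [worst] is approached up to [c'], so that the loss weighted by the multipliers is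
   at most [c]. *)
apply/ler_addgt0Pr => c c0; pose c' := c / (1 + \sum_m lam k.+1 m).
have c'0 : 0 < c' by rewrite divr_gt0// ltr_wpDr.
have zE m : exists z : 'rV[R]_(J m), Zt m z /\ Fk k.+1 m - c' < gtilde (ox r k.+1) (omu r k.+1) z.
  by have [z Zz' hz] := worst_adherent cvxP gB m (u := W k.+1) X1 b1 c'0; exists z.
pose z m := projT1 (cid (zE m)).
have zP m : Zt m (z m) /\ Fk k.+1 m - c' < gtilde (ox r k.+1) (omu r k.+1) (z m).
  exact: (projT2 (cid (zE m))).
have := hs w z (conj Xw bw) (fun m => (zP m).1); rewrite /prox_lagrangian /=.
have h1 : \sum_m lam k.+1 m * Fk k.+1 m - c <=
    \sum_m lam k.+1 m * gtilde (ox r k.+1) (omu r k.+1) (z m).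
  apply: (@le_trans _ _ (\sum_m lam k.+1 m * (Fk k.+1 m - c'))); last first.
    by apply: ler_sum => m _; rewrite ler_wpM2l// ltW// (zP m).2.
  under [leRHS]eq_bigr do rewrite mulrBr.
  rewrite sumrB lerD2l lerN2 -mulr_suml /c' mulrCA ger_pMr// ler_pdivrMr; lra.
have h2 : \sum_m lam k.+1 m * gtilde w.1 w.2 (inner_z (pT p (olam r k.+1)) (oin r k) m) <=
    \sum_m lam k.+1 m * worst w m.
  by apply: ler_sum => m _; rewrite ler_wpM2l// (worst_ub cvxP gB).
have -> : alpha^-1 / 2 = (2 * alpha)^-1 by rewrite invfM mulrC.
by move: h1 h2; rewrite -/alpha -/nu -/(lam k.+1) -/(W k) -/(W k.+1); lra.
Qed.

Definition lsq (l l' : 'I_(M P) -> R) : R := \sum_m (l m - l' m) ^+ 2.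

Lemma lsq_ge0 l l' : 0 <= lsq l l'.
Proof. by apply: sumr_ge0 => m _; exact: sqr_ge0. Qed.

(** Coordinatewise: where the truncation at [0] is inactive both sides agree; where it is active,
    [lam k.+1 m = 0] and the claim reduces to [l m * (lam k m + beta * G) <= 0]. *)
Let dual_step k (l : 'I_(M P) -> R) : (k < K)%N -> (forall m, 0 <= l m) ->
  \sum_m (l m - lam k.+1 m) * (2 * gk k m - gk k.-1 m) <=
  (2 * beta)^-1 * (lsq l (lam k) - lsq l (lam k.+1) - lsq (lam k.+1) (lam k)).
Proof.
move=> kK l0; rewrite /lsq -!sumrB mulr_sumr; apply: ler_sum => m _.
rewrite ler_pdivlMl ?mulr_gt0// lamS//; set G := 2 * gk k m - _.
have := l0 m; case: (leP 0 (lam k m + beta * G)) => [y0|y0] lm0.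
  by lra.
have : l m * (lam k m + beta * G) <= 0 by rewrite mulr_ge0_le0// ltW.
by lra.
Qed.

Let q k := Num.sqrt (lsq (lam k) (lam k.-1)).
Let pk k := Num.sqrt (sqdist P (W k) (W k.-1)).
Let c l k := \sum_m (l m - lam k m) * (Fk k m - Fk k.-1 m).

Let sqr_q k : q k ^+ 2 = lsq (lam k) (lam k.-1).
Proof. by rewrite sqr_sqrtr ?lsq_ge0. Qed.
Let sqr_p k : pk k ^+ 2 = sqdist P (W k) (W k.-1).
Proof. by rewrite sqr_sqrtr ?sqdist_ge0. Qed.

Let q_coord k m : `|lam k m - lam k.-1 m| <= q k.
Proof.
rewrite -sqrtr_sqr ler_sqrt ?lsq_ge0//.
by apply: (@ler_sum_pos _ _ (fun m => (lam k m - lam k.-1 m) ^+ 2)) => j; exact: sqr_ge0.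
Qed.

Let F_varying k m : (k <= K)%N -> `|Fk k m - Fk k.-1 m| <= (D + H) * pk k.
Proof.
move=> kK; have [Xk bk] := outer_run_dom kK.
have [Xk' bk'] := outer_run_dom (leq_trans (leq_pred k) kK).
exact: (worst_lipschitz cvxP regP hH gB m (u := W k) (u' := W k.-1)).
Qed.

Let csum (x : R) : \sum_(m < M P) x = (M P)%:R * x.
Proof. by rewrite sumr_const card_ord mulr_natl. Qed.

Let coupling k : (k < K)%N ->
  \sum_m (lam k.+1 m - lam k m) * (Fk k m - Fk k.-1 m) <= V * (pk k + q k) * q k.+1.
Proof.
move=> kK; have p0 : 0 <= pk k := sqrtr_ge0 _; have q0 : 0 <= q k := sqrtr_ge0 _.
have q1 : 0 <= q k.+1 := sqrtr_ge0 _.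
apply: (@le_trans _ _ (V * pk k * q k.+1)); last first.
  by rewrite ler_wpM2r// ler_wpM2l ?(ltW V_gt0)//; lra.
rewrite /V -!mulrA -csum; apply: ler_sum => m _; apply: le_trans (ler_norm _) _.
rewrite normrM mulrA mulrC ler_pM//; exact: F_varying (ltnW kK).
Qed.

(** Cost of using [gk] for the worst values: the deviations lie in [[0, theta]], so the extrapolated
    one has size at most [2 * theta], and it is weighted by [l m - lam k.+1 m], of size at most
    [l m + Lam]. *)
Let err (l : 'I_(M P) -> R) := 2 * theta * \sum_m (l m + Lam).

Let errP k l : (k < K)%N -> (forall m, 0 <= l m) ->
  \sum_m (l m - lam k.+1 m) * ((Fk k m - gk k m) * 2 - (Fk k.-1 m - gk k.-1 m)) <= err l.
Proof.
move=> kK l0; rewrite /err mulr_sumr; apply: ler_sum => m _.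
have lk0 : 0 <= lam k.+1 m by exact: olam_ge0.
have := lam_le m kK; have := l0 m.
have /andP[? ?] := gkP m kK; have /andP[? ?] := gkP m (leq_ltn_trans (leq_pred k) kK).
set x := _ * 2 - _ => lm0 lamle.
have x2 : `|x| <= 2 * theta.
  by rewrite ler_norml /x; have := theta_gt0; move=> ?; apply/andP; split; lra.
apply: le_trans (ler_norm _) _; rewrite normrM mulrC ler_pM//.
by rewrite ler_norml; apply/andP; split; lra.
Qed.

Let gap (l : 'I_(M P) -> R) (w : xvec P * muvec P) k :=
  fine (f0 P (ox r k)) - fine (f0 P w.1) + \sum_m l m * Fk k m - \sum_m lam k m * worst w m.

Let gap_step k l w : (k < K)%N -> (forall m, 0 <= l m) -> X P w.1 -> Mbox a w.2 ->
  gap l w k.+1 <= (2 * alpha)^-1 * (sqdist P w (W k) - sqdist P w (W k.+1))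
    + (2 * beta)^-1 * (lsq l (lam k) - lsq l (lam k.+1))
    - (2 * alpha)^-1 * pk k.+1 ^+ 2 - (2 * beta)^-1 * q k.+1 ^+ 2 + (c l k.+1 - c l k)
    + V * (pk k + q k) * q k.+1 + (nu + err l).
Proof.
move=> kK l0 Xw bw; rewrite sqr_q sqr_p.
have h1 := saddle_step kK Xw bw; have h2 := dual_step kK l0.
have h3 := coupling kK; have h4 := errP kK l0.
have E : \sum_m l m * Fk k.+1 m - \sum_m lam k.+1 m * Fk k.+1 m =
    \sum_m (l m - lam k.+1 m) * (2 * gk k m - gk k.-1 m) + (c l k.+1 - c l k)
    + \sum_m (lam k.+1 m - lam k m) * (Fk k m - Fk k.-1 m)
    + \sum_m (l m - lam k.+1 m) * ((Fk k m - gk k m) * 2 - (Fk k.-1 m - gk k.-1 m)).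
  by rewrite /c -!sumrB -!big_split; apply: eq_bigr => m _ /=; ring.
by rewrite /gap; lra.
Qed.

(** Half of the dual distance absorbs the boundary coupling [c l n]; the other half stays on the
    left, where it will bound the multipliers. Feasibility of [w] allows the terms
    [lam k m * worst w m] to be dropped. *)
Lemma outer_bound l (w : xvec P * muvec P) n : (n <= K)%N -> (forall m, 0 <= l m) ->
    X P w.1 -> Mbox a w.2 -> (forall m, worst w m <= 0) ->
  \sum_(1 <= k < n.+1) (fine (f0 P (ox r k)) - fine (f0 P w.1)
      + \sum_m l m * worst (ox r k, omu r k) m)
    + (4 * beta)^-1 * lsq l (fun m => olam r n 0 m) <=
  (2 * alpha)^-1 * d ^+ 2 + (2 * beta)^-1 * \sum_m l m ^+ 2 + 4 * beta * (M P)%:R * B ^+ 2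
  + n%:R * (nu + 2 * theta * \sum_m (l m + K%:R * (3 * beta * B))).
Proof.
move=> nK l0 Xw bw w0.
have vE t : 0 < t -> 3 * V * t = 1 -> (2 * t)^-1 = 3 * V / 2.
  move=> /lt0r_neq0 t0 tE; have tV : t^-1 = 3 * V by rewrite -[RHS](mulfK t0) tE mul1r.
  by rewrite invfM tV mulrC.
have h : \sum_(1 <= k < n.+1) gap l w k <= (2 * alpha)^-1 * (sqdist P w (W 0) - sqdist P w (W n))
    + (2 * beta)^-1 * (lsq l (lam 0) - lsq l (lam n)) + (c l n - c l 0) + n%:R * (nu + err l).
  apply: (@primal_dual_telescope _ n _ _ (2 * alpha)^-1 (2 * beta)^-1 V _ (gap l w)
    (fun k => sqdist P w (W k)) (fun k => lsq l (lam k)) (c l) pk q).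
  - exact: ltW.
  - by rewrite vE//; have := V_gt0; lra.
  - by rewrite vE.
  - apply/eqP; rewrite -sqrf_eq0 sqr_p /sqdist /= subrr enorm0 expr0n add0r big1// => m _.
    by rewrite subrr enorm0 expr0n.
  - by apply/eqP; rewrite -sqrf_eq0 sqr_q /lsq big1// => m _; rewrite subrr expr0n.
  - by move=> k kn; apply: gap_step => //; exact: leq_trans kn nK.
have c0 : c l 0 = 0 by rewrite /c big1// => m _; rewrite subrr mulr0.
have l0E : lsq l (lam 0) = \sum_m l m ^+ 2.
  by apply: eq_bigr => m _; rewrite lam0 subr0.
have [Xn bn] := outer_run_dom nK; have [Xn' bn'] := outer_run_dom (leq_trans (leq_pred n) nK).
have cn : c l n <= (4 * beta)^-1 * lsq l (lam n) + 4 * beta * (M P)%:R * B ^+ 2.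
  rewrite mulr_sumr -[4 * beta * _]mulrC -!mulrA -csum -big_split; apply: ler_sum => m _ /=.
  have := worst_norm cvxP gB m (u := W n) Xn bn.
  have := worst_norm cvxP gB m (u := W n.-1) Xn' bn'.
  rewrite -/(Fk n m) -/(Fk n.-1 m); set x := l m - lam n m; set y := Fk n m - Fk n.-1 m => y1 y2.
  have yB : `|y| <= 2 * B.
    by apply: le_trans (ler_normB _ _) _; rewrite [leRHS]mulr_natl mulr2n lerD.
  apply: (@le_trans _ _ (`|x| * (2 * B))).
    by apply: le_trans (ler_norm _) _; rewrite normrM ler_wpM2l.
  rewrite -subr_ge0 -[x ^+ 2]real_normK ?num_real//.
  rewrite (_ : _ - _ = (4 * beta)^-1 * (`|x| - 4 * beta * B) ^+ 2).
    by rewrite mulr_ge0 ?sqr_ge0// invr_ge0 mulr_ge0// ltW.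
  by field; rewrite gt_eqF.
have g1 : \sum_(1 <= k < n.+1) (fine (f0 P (ox r k)) - fine (f0 P w.1)
      + \sum_m l m * worst (ox r k, omu r k) m) <= \sum_(1 <= k < n.+1) gap l w k.
  rewrite !big_nat; apply: ler_sum => k /andP[_ kn]; rewrite /gap lerDl oppr_ge0.
  by apply: sumr_le0 => m _; rewrite mulr_ge0_le0// olam_ge0// (leq_trans _ nK).
have [X0 b0] := outer_run_dom (leq0n K).
have s0 : (2 * alpha)^-1 * (sqdist P w (W 0) - sqdist P w (W n)) <= (2 * alpha)^-1 * d ^+ 2.
  rewrite ler_wpM2l ?invr_ge0 ?mulr_ge0 ?(ltW alpha_gt0)// lerBlDr ler_wpDr ?sqdist_ge0//.
  exact: hU.
have bE : (2 * beta)^-1 = 2 * (4 * beta)^-1 by field; rewrite gt_eqF.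
move: h g1 s0 cn; rewrite c0 l0E -/(lam n) bE /err -/Lam.
have : 0 <= (4 * beta)^-1 * lsq l (lam n) by rewrite mulr_ge0 ?lsq_ge0// invr_ge0 mulr_ge0// ltW.
by lra.
Qed.

End OuterLoop.

(** * Existence of runs *)

Section RunExistence.
Context {R : realType} (P : problem R) (a : 'I_(M P) -> R) (e D B : R).
Hypothesis cvxP : convex_problem P.
Hypothesis regP : regular P e D.
Hypothesis a_gt0 : forall m, 0 < a m.
Hypothesis gB : forall (m : 'I_(M P)) x mu (z : 'rV[R]_(J m)),
  X P x -> Mbox a mu -> Zt m z -> `|gtilde x mu z| <= B.

Definition proj n (S : set 'rV[R]_n) y := xget 0 [set q | is_proj S y q].

Lemma projP n (S : set 'rV[R]_n) y : S !=set0 -> compact S -> is_proj S y (proj S y).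
Proof.
by move=> S0 cS; have [q hq] := is_proj_exists y S0 cS; exact: (xgetPex 0 (ex_intro _ q hq)).
Qed.

Definition subgrad n (f : 'rV[R]_n -> \bar R) x := xget 0 (subdiff f x).

Lemma subgradP n (S : set 'rV[R]_n) f x : subdifferentiable_on S f -> S x ->
  subdiff f x (subgrad f x).
Proof. by move=> sf Sx; have [q hq] := sf x Sx; exact: (xgetPex 0 (ex_intro _ q hq)). Qed.

Definition inner_state : Type := xvec P * muvec P * zvec P.

Definition state_zeta (u : inner_state) m : 'rV[R]_(J m) :=
  subgrad (fun z => - g m u.1.1 z)%E (u.2 m).

Definition state_zetat (u : inner_state) m : 'rV[R]_(J m) :=
  state_zeta u m + \sum_i u.1.2 m 0 i *: subgrad (h m i) (u.2 m).

Definition inner_next (alpha gamma delta : R) (lam : lamvec P) (xk : xvec P) (muk : muvec P)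
    (u v : inner_state) : inner_state :=
  let c := alpha * gamma / (alpha + gamma) in
  let z m := proj (Zt m) (u.2 m - (delta * lam 0 m) *: (2 *: state_zetat u m - state_zetat v m)) in
  (proj (X P) (c *: (alpha^-1 *: xk + gamma^-1 *: u.1.1
     - (subgrad (f0 P) u.1.1 + \sum_m lam 0 m *: subgrad (fun x => g m x (z m)) u.1.1))),
   fun m => proj (box a m) (c *: (alpha^-1 *: muk m + gamma^-1 *: u.1.2 m + lam 0 m *: hvec (z m))),
   z).

(** Pairs of successive states, because the extrapolation reads the previous one; the initial pair
    [(u0, u0)] encodes that index [-1] means index [0]. *)
Definition inner_states alpha gamma delta lam xk muk t : inner_state * inner_state :=
  let u0 := (xk, muk, fun m => xget 0 (Zt m)) in
  iter t (fun w => (inner_next alpha gamma delta lam xk muk w.1 w.2, w.1)) (u0, u0).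

Definition inner_execution alpha gamma delta lam xk muk : inner_trace P :=
  let u t := (inner_states alpha gamma delta lam xk muk t).1 in
  InnerTrace (fun t => (u t).1.1) (fun t => (u t).1.2) (fun t => (u t).2)
    (fun t => state_zeta (u t)) (fun t m i => subgrad (h m i) ((u t).2 m))
    (fun t => subgrad (f0 P) (u t).1.1)
    (fun t m => subgrad (fun x => g m x ((u t.+1).2 m)) (u t).1.1).

Lemma inner_execution_run T alpha gamma delta lam xk muk : X P xk -> Mbox a muk ->
  inner_run a T alpha gamma delta lam xk muk (inner_execution alpha gamma delta lam xk muk).
Proof.
move=> Xk bk; pose S := inner_states alpha gamma delta lam xk muk; pose u t := (S t).1.
have zP (m : 'I_(M P)) y : is_proj (Zt m) y (proj (Zt m) y).
  by apply: projP; [exact: Zt_nonempty|exact: Zt_compact].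
have xP y : is_proj (X P) y (proj (X P) y).
  by apply: projP; [exact: X_nonempty|exact: X_compact].
have bP (m : 'I_(M P)) y : is_proj (box a m) y (proj (box a m) y).
  by apply: projP; [exact: box_nonempty|exact: box_compact].
have dom t : [/\ X P (u t).1.1, Mbox a (u t).1.2 & Ztprod P (u t).2].
  case: t => [|t]; rewrite /u /S /=; split=> //.
  - by move=> m; have [z Zz] := @Zt_nonempty _ _ cvxP m; exact: (xgetPex 0 (ex_intro _ z Zz)).
  - exact: (xP _).1.
  - by move=> m; exact: (bP m _).1.
  - by move=> m; exact: (zP m _).1.
have [X0 b0 Z0] := dom 0%N.
split; [exact: X0|exact: b0|exact: Z0|move=> t _].
have [Xt bt Zt'] := dom t; have [_ _ Z1] := dom t.+1; split.
- move=> m; split=> [|i|].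
  + exact: (subgradP (reg_gz_ex regP Xt) (Zt' m)).
  + exact: (subgradP (reg_h_ex regP i) (Zt' m)).
  + by case: t {Xt bt Zt' Z1} => [|t]; exact: zP.
- exact: (subgradP (reg_f0_ex regP) Xt).
- by move=> m; exact: (subgradP (reg_gx_ex regP (Z1 m)) Xt).
- exact: xP.
- by move=> m; exact: bP.
Qed.

Definition near_maximizer (theta : R) x (mu : muvec P) : zvec P :=
  fun m => xget 0 [set z | Zt m z /\ forall z', Zt m z' -> gtilde x mu z' <= gtilde x mu z + theta].

Lemma near_maximizerP theta x mu m (z := near_maximizer theta x mu m) :
    0 < theta -> X P x -> Mbox a mu ->
  Zt m z /\ forall z', Zt m z' -> gtilde x mu z' <= gtilde x mu z + theta.
Proof.
move=> t0 Xx bmu; have [w Zw hw] := worst_adherent cvxP gB m (u := (x, mu)) Xx bmu t0.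
have : Zt m w /\ forall z', Zt m z' -> gtilde x mu z' <= gtilde x mu w + theta.
  split=> // z' Zz'; have := worst_ub cvxP gB (u := (x, mu)) Xx bmu Zz'; move: hw => /=; lra.
by move=> hw'; exact: (xgetPex 0 (ex_intro (fun w => Zt m w /\ forall z', _) w hw')).
Qed.

Variable p : params P.
Hypothesis valid : valid_params p.

(** The maximizers are chosen as a function of [(x, mu)] and therefore not stored; equal initial
    states then give the same maximizer at indices [-1] and [0]. *)
Definition outer_state : Type := xvec P * muvec P * lamvec P.

Definition state_g (u : outer_state) m :=
  gtilde u.1.1 u.1.2 (near_maximizer (ptheta p) u.1.1 u.1.2 m).

Definition next_lam (u v : outer_state) : lamvec P :=
  \row_m Num.max (u.2 0 m + pbeta p * (2 * state_g u m - state_g v m)) 0.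

Definition next_inner (u : outer_state) (lam : lamvec P) : inner_trace P :=
  inner_execution (palpha p) (pgamma p lam) (pdelta p lam) lam u.1.1 u.1.2.

Definition outer_states (x : xvec P) (mu : muvec P) k : outer_state * outer_state :=
  let u0 := (x, mu, 0) in
  iter k (fun w => let lam := next_lam w.1 w.2 in let tr := next_inner w.1 lam in
    ((inner_x (pT p lam) tr, inner_mu (pT p lam) tr, lam), w.1)) (u0, u0).

Definition execution x mu : trace P :=
  let u k := (outer_states x mu k).1 in
  Trace (fun k => (u k).1.1) (fun k => (u k).1.2)
    (fun k => near_maximizer (ptheta p) (u k).1.1 (u k).1.2)
    (fun k => (u k).2) (fun k => next_inner (u k) (u k.+1).2).

Lemma execution_run x mu : X P x -> Mbox a mu -> prom3_run a p (execution x mu).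
Proof.
move=> Xx bmu; pose u k := (outer_states x mu k).1.
have [_ [_ _ _ theta0] hT] := valid.
have dom k : X P (u k).1.1 /\ Mbox a (u k).1.2.
  elim: k => [//|k [Xk bk]]; rewrite /u /=.
  set lam := next_lam _ _; have [T1 _ _] := hT lam.
  have ir := inner_execution_run (pT p lam) (palpha p) (pgamma p lam) (pdelta p lam) lam Xk bk.
  by have [] := inner_output_dom cvxP T1 ir.
split=> // k kK; have [Xk bk] := dom k; split.
- move=> m; have [Zz hz] := near_maximizerP m theta0 Xk bk; split=> //.
  by apply: ge_ereal_sup => _ [z' Zz' <-]; rewrite lee_fin; exact: hz.
- by move=> m; rewrite [LHS]mxE; case: (k).
- exact: inner_execution_run.
- by [].
- by [].
Qed.

End RunExistence.

(** * Duality and complexity *)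

Section RobustDuality.
Context {R : realType} (P : problem R).
Hypothesis cvxP : convex_problem P.
Hypothesis nI_pos : forall m : 'I_(M P), (0 < nI m)%N.
Variables (zbar : zvec P) (G : 'I_(M P) -> R).
Hypothesis slater_z : forall m : 'I_(M P),
  Zt m (zbar m) /\ forall i : 'I_(nI m), (h m i (zbar m) < 0)%E.
Hypothesis G_neg : forall m, G m < 0.
Hypothesis G_bound : forall (m : 'I_(M P)) (x : xvec P), X P x ->
  ((G m)%:E <= g m x (zbar m))%E.

Let a := abound zbar G.

(** [r] is the largest [h m i (zbar m)]: real because some index [i] exists, negative as a maximum
    of finitely many negative values. *)
Lemma abound_spec (m : 'I_(M P)) : exists2 r : R, r < 0 &
  a m = G m / r /\ forall i, fine (h m i (zbar m)) <= r.
Proof.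
have [Zz hz] := slater_z m; set b := \big[maxe/-oo%E]_(i < nI m) h m i (zbar m).
have b0 : (b < 0)%E by apply: bigmax_lt => //; exact: ltNy0.
have hb i : (h m i (zbar m) <= b)%E by exact: le_bigmax.
have bfin : b \is a fin_num.
  rewrite fin_real// (lt_trans b0) ?ltry// andbT.
  by apply: lt_le_trans (hb (Ordinal (nI_pos m))); rewrite ltNye_eq h_fin.
exists (fine b); first by rewrite -lte_fin fineK.
by split=> // i; rewrite -lee_fin !fineK// h_fin.
Qed.

Lemma abound_gt0 m : 0 < a m.
Proof.
have [r r0 [-> _]] := abound_spec m.
by rewrite -mulrNN mulr_gt0 ?oppr_gt0// invr_lt0.
Qed.

Lemma frob_ge (m : 'I_(M P)) x (z : 'rV[R]_(J m)) : X P x -> Zt m z ->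
    (forall i, fine (h m i z) <= 0) -> (frob m x <= 0)%E -> fine (g m x z) <= 0.
Proof.
move=> Xx Zz hz; rewrite -lee_fin fineK ?g_fin//; apply: le_trans.
apply: ereal_sup_ubound; exists z => //; split=> // i _ /=.
by rewrite -(fineK (h_fin cvxP i Zz)) lee_fin.
Qed.

(** The Slater point provides multipliers [l], and the dual inequality at that point reads [G m <=
    \sum_i l 0 i * h m i (zbar m) <= (\sum_i l 0 i) * r]. Dividing by [r < 0] bounds their sum,
    hence each of them, by [a m]: this is the origin of the box. *)
Lemma robust_dual (m : 'I_(M P)) x : feasible x ->
  exists2 mu : 'rV[R]_(nI m), box a m mu &
    forall z : 'rV[R]_(J m), Zt m z -> fine (g m x z) - dotv mu (hvec z) <= 0.
Proof.
move=> [Xx fx]; pose comb t (u v : 'rV[R]_(J m)) := t *: u + (1 - t) *: v.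
have [Zzb hzb] := slater_z m.
have comb_fin t u v : 0 <= t <= 1 -> Zt m u -> Zt m v -> Zt m (comb t u v).
  exact: convex_comb (@Zt_convex _ _ cvxP m).
have [||||| l l0 hl] := @convex_multipliers _ _ comb (nI m) (Zt m)
  (fun z => - fine (g m x z)) (fun i z => fine (h m i z)).
- by move=> t u v; exact: comb_fin.
- move=> t u v t01 Zu Zv.
  have := @econvex_fine _ _ (fun z => - g m x z)%E t u v (g_econcave cvxP Xx) t01.
  rewrite !fin_numN !fineN; apply; [exact: g_fin|exact: g_fin|].
  by apply: g_fin => //; exact: comb_fin.
- move=> i t u v t01 Zu Zv; apply: econvex_fine => //; try exact: h_fin.
  + exact: h_econvex.
  + exact: (h_fin cvxP i (comb_fin t u v t01 Zu Zv)).
- by exists (zbar m) => // i; rewrite -lte_fin fineK ?h_fin.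
- by move=> z Zz hz; rewrite oppr_ge0; exact: (frob_ge Xx Zz hz (fx m)).
have lE z : dotv l (hvec z) = \sum_i l 0 i * fine (h m i z).
  by apply: eq_bigr => i _; rewrite mxE.
exists l => [i|z Zz]; last by rewrite lE; have := hl z Zz; lra.
rewrite l0 /=; apply: le_trans (@ler_sum_pos _ _ (fun i => l 0 i) i l0) _.
have [r r0 [-> hr]] := abound_spec m.
rewrite ler_ndivlMr//; apply: le_trans (_ : fine (g m x (zbar m)) <= _).
  by rewrite -lee_fin fineK ?g_fin// G_bound.
have := hl _ Zzb; rewrite addrC subr_ge0 => /le_trans; apply.
by rewrite mulr_suml; apply: ler_sum => j _; rewrite ler_wpM2l.
Qed.

(** Weak duality: over [Zrob m] the term subtracted in [gtilde] is non-positive. *)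
Lemma worst_frob (u : xvec P * muvec P) (m : 'I_(M P)) (c : R) :
    X P u.1 -> (forall i, 0 <= u.2 m 0 i) ->
    (forall z : 'rV[R]_(J m), Zt m z -> gtilde u.1 u.2 z <= c) -> (frob m u.1 <= c%:E)%E.
Proof.
move=> Xu u0 hc; apply: ge_ereal_sup => _ [z [Zz hz] <-].
rewrite -(fineK (g_fin cvxP Xu Zz)) lee_fin; apply: le_trans (hc z Zz).
rewrite /gtilde lerDl oppr_ge0; apply: sumr_le0 => i _; rewrite mxE mulr_ge0_le0//.
by rewrite -lee_fin fineK ?h_fin//; exact: hz.
Qed.

Variables (B : R).
Hypothesis gB : forall (m : 'I_(M P)) x mu (z : 'rV[R]_(J m)),
  X P x -> Mbox a mu -> Zt m z -> `|gtilde x mu z| <= B.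
Hypothesis slater_x : exists2 xbar : xvec P, X P xbar &
  forall m : 'I_(M P), (max_over (Zt m) (fun z => g m xbar z) < 0)%E.
Variable xstar : xvec P.
Hypothesis xstar_optimal : optimal xstar.

Lemma optimal_mu : exists2 mu : muvec P, Mbox a mu & forall m, worst (xstar, mu) m <= 0.
Proof.
have ex (m : 'I_(M P)) : exists mu : 'rV[R]_(nI m), box a m mu /\
    forall z : 'rV[R]_(J m), Zt m z -> fine (g m xstar z) - dotv mu (hvec z) <= 0.
  by have [mu bm hm] := robust_dual m xstar_optimal.1; exists mu.
exists (fun m => projT1 (cid (ex m))) => m; have [bm hm] := projT2 (cid (ex m)) => //.
exact: (worst_le cvxP).
Qed.

(** Multipliers of the lifted problem in [(x, mu)], whose feasible points project to feasible points
    of the robust problem by [worst_frob]. *)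
Lemma outer_multipliers : exists2 l : 'I_(M P) -> R, (forall m, 0 <= l m) &
  forall u : xvec P * muvec P, X P u.1 -> Mbox a u.2 ->
    0 <= fine (f0 P u.1) - fine (f0 P xstar) + \sum_m l m * worst u m.
Proof.
pose comb t (u v : xvec P * muvec P) : xvec P * muvec P :=
  (t *: u.1 + (1 - t) *: v.1, fun m => t *: u.2 m + (1 - t) *: v.2 m).
pose C : set (xvec P * muvec P) := [set u | X P u.1 /\ Mbox a u.2].
have [[Xs fs] opt] := xstar_optimal.
have Cc t u v : 0 <= t <= 1 -> C u -> C v -> C (comb t u v).
  move=> t01 [Xu bu] [Xv bv]; split=> [|m]; first exact: convex_comb (X_convex cvxP) _ _ _.
  exact: convex_comb (@box_convex _ _ a m) _ _ _.
have [||||| l l0 hl] := @convex_multipliers _ _ comb (M P) C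
  (fun u => fine (f0 P u.1) - fine (f0 P xstar)) (fun m u => worst u m).
- by move=> t u v; exact: Cc.
- move=> t u v t01 Cu Cv; have [Xu bu] := Cu; have [Xv bv] := Cv.
  have [Xc _] := Cc t u v t01 Cu Cv.
  have := econvex_fine (f0_econvex cvxP) t01 (f0_fin cvxP Xu) (f0_fin cvxP Xv) (f0_fin cvxP Xc).
  by rewrite /comb /=; lra.
- by move=> m t u v t01 [Xu bu] [Xv bv]; exact: (worst_convex cvxP gB).
(* With [mu = 0] the function [gtilde] is [g] itself, so the Slater point in [x] lifts to a strictly
   feasible one. *)
- have [xbar Xb hb] := slater_x; exists (xbar, fun=> 0).
    by split=> // m i; rewrite mxE lexx ltW ?abound_gt0.
  move=> m; have [z Zz] := @Zt_nonempty _ _ cvxP m.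
  have ub (w : 'rV[R]_(J m)) : Zt m w -> (g m xbar w <= max_over (Zt m) (fun z => g m xbar z))%E.
    by move=> Zw; apply: ereal_sup_ubound; exists w.
  have sfin : max_over (Zt m) (fun z => g m xbar z) \is a fin_num.
    rewrite fin_real// (lt_trans (hb m)) ?ltry// andbT.
    by apply: lt_le_trans (ub z Zz); rewrite ltNye_eq g_fin.
  apply: (@le_lt_trans _ _ (fine (max_over (Zt m) (fun z => g m xbar z)))).
    apply: (worst_le cvxP) => w Zw; rewrite /gtilde dotv0l subr0.
    by rewrite -lee_fin !fineK ?g_fin// ub.
  by rewrite -lte_fin fineK.
- move=> u [Xu bu] hu; rewrite subr_ge0 -lee_fin !fineK ?(f0_fin cvxP)//.
  apply: opt; split=> // m; apply: worst_frob => // [i|z Zz].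
    by case/andP: (bu m i).
  exact: le_trans (worst_ub cvxP gB Xu bu Zz) (hu m).
exists (fun m => l 0 m) => // u Xu bu; exact: hl.
Qed.

End RobustDuality.

(** * Choice of parameters and counting of oracle calls *)

Section Complexity.
Context {R : realType} (P : problem R) (E : bool) (D : R).
Let e : R := (E : nat)%:R.
Hypothesis cvxP : convex_problem P.
Hypothesis regP : regular P e D.
Hypothesis M_pos : (0 < M P)%N.
Hypothesis nI_pos : forall m : 'I_(M P), (0 < nI m)%N.
Hypothesis slater_x : exists2 xbar : xvec P, X P xbar &
  forall m : 'I_(M P), (max_over (Zt m) (fun z => g m xbar z) < 0)%E.
Variables (zbar : zvec P) (G : 'I_(M P) -> R).
Hypothesis slater_z : forall m : 'I_(M P),
  Zt m (zbar m) /\ forall i : 'I_(nI m), (h m i (zbar m) < 0)%E.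
Variable xstar : xvec P.
Hypothesis xstar_optimal : optimal xstar.
Hypothesis G_neg : forall m, G m < 0.
Hypothesis G_bound : forall (m : 'I_(M P)) (x : xvec P), X P x ->
  ((G m)%:E <= g m x (zbar m))%E.

Let a := abound zbar G.
Let a_gt0 m : 0 < a m := abound_gt0 cvxP nI_pos slater_z G_neg m.
Let e_ge0 : 0 <= e. Proof. by []. Qed.

Lemma eps_optimal_of_bound (B eps : R) (ls : 'I_(M P) -> R) (p : params P) (r : trace P) :
    (forall (m : 'I_(M P)) x mu (z : 'rV[R]_(J m)),
       X P x -> Mbox a mu -> Zt m z -> `|gtilde x mu z| <= B) ->
    (forall m, 0 <= ls m) ->
    (forall u : xvec P * muvec P, X P u.1 -> Mbox a u.2 ->
       0 <= fine (f0 P u.1) - fine (f0 P xstar) + \sum_m ls m * worst u m) ->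
    0 < eps -> (0 < pK p)%N ->
    (forall k, (k <= pK p)%N -> X P (ox r k) /\ Mbox a (omu r k)) ->
    (forall l : 'I_(M P) -> R, (forall m, 0 <= l m) -> \sum_m l m <= \sum_m ls m + 1 ->
       \sum_(1 <= k < (pK p).+1) (fine (f0 P (ox r k)) - fine (f0 P xstar)
         + \sum_m l m * worst (ox r k, omu r k) m) <= (pK p)%:R * eps) ->
  eps_optimal xstar eps (output p r).
Proof.
move=> gB ls0 lsP eps0 K0 dom bound.
have [[Xs _] _] := xstar_optimal.
have dom1 k : (0 < k <= pK p)%N -> X P (ox r k) /\ Mbox a (omu r k) by move=> /andP[_ /dom].
(* The algorithm outputs [x] only; the average of [omu] is the dual certificate that bounds [frob]
   at the output. *)
pose mub m := average (pK p) (fun k => omu r k m).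
have Xb : X P (output p r) by apply: convex_average (X_convex cvxP) _ _ => // k /dom1[].
have bb : Mbox a mub.
  by move=> m; apply: convex_average (@box_convex _ _ a m) _ _ => // k /dom1[_]; exact.
have final l : (forall m, 0 <= l m) -> \sum_m l m <= \sum_m ls m + 1 ->
    fine (f0 P (output p r)) - fine (f0 P xstar) + \sum_m l m * worst (output p r, mub) m <= eps.
  move=> l0 lS; have := bound l l0 lS.
  have h1 := f0_average cvxP K0 (fun k kK => (dom1 k kK).1).
  have h2 : \sum_m l m * worst (output p r, mub) m <=
      mean (pK p) (fun k => \sum_m l m * worst (ox r k, omu r k) m).
    rewrite mean_sum; apply: ler_sum => m _; rewrite meanZ ler_wpM2l//.
    exact: (worst_average cvxP gB m K0 dom1).
  rewrite -ler_pdivrMl ?ltr0n//.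
  rewrite [X in X <= _ -> _](_ : _ = mean (pK p) (fun k => fine (f0 P (ox r k))) - fine (f0 P xstar)
      + mean (pK p) (fun k => \sum_m l m * worst (ox r k, omu r k) m)); last first.
    by rewrite -[in RHS](mean_cst K0 (fine (f0 P xstar))) -meanN -!meanD.
  by move: h1 h2; rewrite -/(output p r); lra.
(* [l = 0] yields the optimality gap, [l = ls + delta_j] the violation of
   constraint [j]. *)
have opt_gap : fine (f0 P (output p r)) - fine (f0 P xstar) <= eps.
  have := final (fun=> 0) (fun=> lexx 0); rewrite big1// => /(_ (addr_ge0 (sumr_ge0 _ _) ler01)).
  rewrite big1 ?addr0 => [|m _]; last by rewrite mul0r.
  by apply=> m _.
have feas_gap j : worst (output p r, mub) j <= eps.
  pose l m : R := ls m + (m == j)%:R.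
  have l0 m : 0 <= l m by rewrite addr_ge0.
  have sd (F : 'I_(M P) -> R) : \sum_m (m == j)%:R * F m = F j.
    rewrite (bigD1 j)//= eqxx mul1r big1 ?addr0// => m /negbTE ->; exact: mul0r.
  have lS : \sum_m l m = \sum_m ls m + 1.
    rewrite big_split /=; congr (_ + _); rewrite -[RHS](sd (fun=> 1)).
    by apply: eq_bigr => m _; rewrite mulr1.
  have := final l l0; rewrite lS => /(_ (lexx _)).
  have -> : \sum_m l m * worst (output p r, mub) m =
      \sum_m ls m * worst (output p r, mub) m + worst (output p r, mub) j.
    by rewrite -(sd (worst (output p r, mub))) -big_split; apply: eq_bigr => m _; rewrite mulrDl.
  by have := lsP (output p r, mub) Xb bb; rewrite /=; lra.
split=> //.
  by rewrite -(fineK (f0_fin cvxP Xb)) -(fineK (f0_fin cvxP Xs)) -EFinB lee_fin.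
apply: bigmax_le => [|m _]; first by rewrite lee_fin ltW.
rewrite ge_max lee_fin (ltW eps0) andbT.
apply: (worst_frob cvxP (u := (output p r, mub))) => // [i|z Zz].
  by case/andP: (bb m i).
exact: le_trans (worst_ub cvxP gB (u := (output p r, mub)) Xb bb Zz) (feas_gap m).
Qed.

Lemma oracle_calls_le (CK Cn eps : R) (p : params P) (r : trace P) (n : nat -> nat) :
    0 <= CK -> 0 <= Cn -> 0 < eps -> (pK p)%:R <= CK / eps ->
    (forall k, pT p (olam r k.+1) = (n k ^ E.+1)%N) ->
    (forall k, (k < pK p)%N -> (n k)%:R <= Cn / eps) ->
  (oracle_calls p r)%:R <= CK * Cn ^+ E.+1 * (calls_per_step P)%:R * eps ^- (2 + E).
Proof.
move=> CK0 Cn0 eps0 KC TE nC; rewrite /oracle_calls natr_sum.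
apply: (@le_trans _ _ (\sum_(k < pK p) (Cn / eps) ^+ E.+1 * (calls_per_step P)%:R)).
  apply: ler_sum => k _; rewrite natrM ler_wpM2r// TE natrX lerXn2r ?nnegrE ?nC//.
  by rewrite divr_ge0// ltW.
rewrite sumr_const card_ord -[leLHS]mulr_natl.
apply: (@le_trans _ _ (CK / eps * ((Cn / eps) ^+ E.+1 * (calls_per_step P)%:R))).
  by rewrite ler_wpM2r// mulr_ge0// exprn_ge0// divr_ge0// ltW.
rewrite le_eqVlt; apply/orP; left; apply/eqP.
by rewrite expr_div_n (_ : (2 + E = 1 + E.+1)%N)// exprD expr1 invfM; ring.
Qed.

(** Divided by [T], the initial distance costs [8 * L * d ^+ 2 / n] and, if [E] is [1], the slack
    costs [L / (2 * n)]; with the boundary term these account for the summands in the hypothesis on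
    [n]. Absolute values keep [L] positive for every [lam], as valid parameters require. *)
Lemma inner_rate (d nu alpha : R) (n : nat) (lam : lamvec P) (xk : xvec P) (muk : muvec P)
    (tr : inner_trace P) (L := kappa a D * (1 + \sum_m `|lam 0 m|))
    (s := (8 * L * n%:R ^+ E)^-1) (T := (n ^ E.+1)%N) :
    0 < d -> (forall u u' : xvec P * muvec P, X P u.1 -> Mbox a u.2 -> X P u'.1 -> Mbox a u'.2 ->
       sqdist P u u' <= d ^+ 2) ->
    (forall z z', Ztprod P z -> Ztprod P z' -> zdist z z' <= d ^+ 2) ->
    0 < alpha -> (0 < n)%N -> L * (8 * d ^+ 2 + (3 * d + 1) * d + 1) <= n%:R * nu ->
    (forall m, 0 <= lam 0 m) -> inner_run a T alpha s s lam xk muk tr ->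
  strong_saddle (sqdist P) (X P `*` Mbox a) (Ztprod P)
    (prox_lagrangian alpha lam xk muk) alpha^-1 nu
    (inner_x T tr, inner_mu T tr) (inner_z T tr).
Proof.
move=> d0 hU hZ alpha0 n0 hn lam0 run.
have k0 : 0 < kappa a D := kappa_gt0 regP a_gt0.
have sl : 0 <= \sum_m `|lam 0 m| by exact: sumr_ge0.
have L0 : 0 < L by rewrite mulr_gt0// ltr_wpDr.
have nR : 0 < n%:R :> R by rewrite ltr0n.
have nE : 1 <= n%:R ^+ E :> R by rewrite exprn_ege1// ler1n.
have nE0 : 0 < n%:R ^+ E :> R by exact: lt_le_trans nE.
have c0 : 0 < 8 * L * n%:R ^+ E by rewrite pmulr_lgt0// mulr_gt0.
have s0 : 0 < s by rewrite invr_gt0.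
have T0 : (0 < T)%N by rewrite expn_gt0 n0.
have [Xu bu Zz] := inner_output_dom cvxP T0 run.
split=> // u z [Xu' bu'] Zz'.
apply: le_trans (inner_average cvxP alpha0 lam0 run T0 Xu' bu' Zz') _.
rewrite lerD2l; have LE : kappa a D * (1 + \sum_m lam 0 m) = L.
  by rewrite /L; congr (_ * (_ + _)); apply: eq_bigr => m _; rewrite ger0_norm.
have sL : s * (8 * (kappa a D * (1 + \sum_m lam 0 m))) <= 1.
  by rewrite LE mulrC /s ler_pdivrMr// mul1r ler_peMr// mulr_ge0// ltW.
have := inner_gap_sum cvxP regP a_gt0 e_ge0 alpha0 s0 lam0 run (ltW d0) hU hZ sL Xu' bu' Zz'.
rewrite LE => gs; rewrite ler_pdivrMl ?ltr0n//; apply: le_trans gs _.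
rewrite /s invrK /T natrX; move: nE hn; rewrite /e; case: (E) => /= nE hn.
- rewrite expr1 expr1n mulr1 (_ : _ * (4 * _ * _) = n%:R * (L / 2)); last first.
    by field; rewrite !gt_eqF.
  have := ler_wpM2l (ltW nR) hn; rewrite expr1 in nE.
  have dd : 0 <= (3 * d + 1) * d by have := sqr_ge0 d; have := ltW d0; lra.
  have := ler_peMl (mulr_ge0 (ltW L0) dd) nE.
  have := mulr_ge0 (ltW nR) (ltW L0).
  by lra.
- rewrite expr0 !mulr1 expr1 expr0n !mulr0 !addr0; have := ltW (mulr_gt0 L0 d0); lra.
Qed.

Lemma prom3_complexity : oracle_complexity a xstar (2 + E).
Proof.
have [d [H [B [d0 H0 B0 [hU hZ hH gB]]]]] := problem_bounds cvxP regP a_gt0.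
have [ls ls0 lsP] := outer_multipliers cvxP nI_pos slater_z G_neg gB slater_x xstar_optimal.
have [mus bmus musP] := optimal_mu cvxP nI_pos slater_z G_bound xstar_optimal.
have [[Xs fs] opt] := xstar_optimal.
have MR0 : 0 < (M P)%:R :> R by rewrite ltr0n.
have D0 := reg_gt0 regP.
have k0 : 0 < kappa a D := kappa_gt0 regP a_gt0.
pose V : R := (M P)%:R * (D + H).
have V0 : 0 < V by rewrite mulr_gt0// ltr_wpDr.
pose al := (3 * V)^-1.
have al0 : 0 < al by rewrite invr_gt0 mulr_gt0.
have alE : 3 * V * al = 1 by rewrite divff// gt_eqF// mulr_gt0.
pose S := \sum_m ls m.
have S0 : 0 <= S by exact: sumr_ge0.
(* The part of [outer_bound] that does not grow with [n], for all [l] of total at most [S + 1]; the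
   [1] makes room for [ls + delta_j]. *)
pose Cm := (2 * al)^-1 * d ^+ 2 + (2 * al)^-1 * (S + 1) ^+ 2 + 4 * al * (M P)%:R * B ^+ 2.
have i2 : 0 <= (2 * al)^-1 by rewrite invr_ge0 mulr_ge0// ltW.
have Cm0 : 0 <= Cm.
  have := mulr_ge0 i2 (sqr_ge0 d); have := mulr_ge0 i2 (sqr_ge0 (S + 1)).
  by have := mulr_ge0 (mulr_ge0 (ltW al0) (ltW MR0)) (sqr_ge0 B); rewrite /Cm; lra.
(* Enough steps for [Cm] to take at most half of the budget [K eps * eps]; [nu] and [theta] share
   the other half. *)
pose K (eps : R) := (Num.truncn (2 * Cm / eps)).+1.
pose Lam eps := (K eps)%:R * (3 * al * B).
have Lam0 eps : 0 <= Lam eps by rewrite !mulr_ge0// ltW.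
pose S2 eps := S + 1 + (M P)%:R * Lam eps.
have S20 eps : 0 < S2 eps by have := mulr_ge0 (ltW MR0) (Lam0 eps); rewrite /S2; lra.
(* [S2 eps] contains the crude bound on the multipliers, so that the maximization errors cost at
   most [eps / 4] per outer step. *)
pose theta eps := eps / (8 * S2 eps).
pose L (lam : lamvec P) := kappa a D * (1 + \sum_m `|lam 0 m|).
have L0 lam : 0 < L lam by rewrite mulr_gt0// ltr_wpDr// sumr_ge0.
pose C2 := 8 * d ^+ 2 + (3 * d + 1) * d + 1.
have C20 : 0 < C2 by rewrite /C2; have := sqr_ge0 d; have := ltW d0; nra.
pose n eps lam := (Num.truncn (L lam * C2 / (eps / 4))).+1.
pose s eps lam := (8 * L lam * (n eps lam)%:R ^+ E)^-1.
pose p eps := @Params R P (K eps) al al (eps / 4) (theta eps)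
  (fun lam => (n eps lam ^ E.+1)%N) (s eps) (s eps).
(* For [eps <= 1], [Q] will bound the squared distance from [ls] to all multipliers of the run. *)
pose Q := 4 * al * (2 * Cm + 1).
pose Lmax := kappa a D * (1 + (S + (M P)%:R * (Q + 1))).
pose Cn := 4 * Lmax * C2 + 1.
pose CK := 2 * Cm + 1.
(* For [eps <= 1] a unit added by rounding up is at most [1 / eps], whence the [+ 1] in [CK] and
   [Cn]; the [+ 1] here keeps the constant positive. *)
exists (CK * Cn ^+ E.+1 * (calls_per_step P)%:R + 1), 1.
have Q0 : 0 <= Q by rewrite /Q !mulr_ge0 ?addr_ge0 ?mulr_ge0// ltW.
have Lmax0 : 0 <= Lmax.
  by rewrite /Lmax mulr_ge0 ?(ltW k0)// !addr_ge0// mulr_ge0 ?addr_ge0// ltW.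
have Cn0 : 0 <= Cn by have := mulr_ge0 Lmax0 (ltW C20); rewrite /Cn; lra.
have CK0 : 0 <= CK by rewrite /CK; lra.
split=> //; first by rewrite ltr_wpDl// !mulr_ge0// exprn_ge0.
move=> eps eps0.
have e4 : 0 < eps / 4 by rewrite divr_gt0.
have th0 : 0 < theta eps by rewrite divr_gt0// mulr_gt0.
have pv : valid_params (p eps).
  split=> //= lam; have nE0 : 0 < (n eps lam)%:R ^+ E :> R by rewrite exprn_gt0// ltr0n.
  have s0 : 0 < s eps lam by rewrite invr_gt0 pmulr_lgt0// pmulr_rgt0.
  by split=> //; rewrite expn_gt0.
exists (p eps); split=> // [x mu Xx bmu|r run].
  by exists (execution a (p eps) x mu); split=> //; exact: (execution_run cvxP regP a_gt0 gB pv).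
have dom_lam k : (k < K eps)%N -> forall m, 0 <= olam r k.+1 0 m.
  move=> kK m; case: run => _ _ _ /(_ k kK)[_ -> _ _ _].
  by rewrite le_max lexx orbT.
have sad : saddle_updates a (p eps) r.
  move=> k kK; have [_ _ ir -> ->] := let: And4 _ _ _ st := run in st k kK.
  apply: (inner_rate d0 hU hZ al0 _ _ (dom_lam k kK) ir) => //=.
  by rewrite -ler_pdivrMr// ltW// truncnS_gt.
have K0 : 0 < (K eps)%:R :> R by rewrite ltr0n.
have KC : Cm <= (K eps)%:R * (eps / 2).
  by have := ltW (truncnS_gt (2 * Cm / eps)); rewrite ler_pdivrMr//; rewrite -/(K eps); lra.
(* Stated for every prefix [j], because intermediate multipliers must be bounded as well. *)
have bound l j : (j <= K eps)%N -> (forall m, 0 <= l m) -> \sum_m l m <= S + 1 ->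
    \sum_(1 <= k < j.+1) (fine (f0 P (ox r k)) - fine (f0 P xstar)
       + \sum_m l m * worst (ox r k, omu r k) m)
    + (4 * al)^-1 * lsq l (fun m => olam r j 0 m) <= Cm + j%:R * (eps / 2).
  move=> jK l0 lS.
  have := @outer_bound _ _ a e D H B d cvxP regP hH gB H0 B0 hU M_pos (p eps) r pv run sad alE alE
    l (xstar, mus) j jK l0 Xs bmus musP.
  move=> /le_trans; apply; rewrite /=; apply: lerD.
    rewrite /Cm lerD2r lerD2l ler_wpM2l//; apply: (@le_trans _ _ ((\sum_m l m) ^+ 2)).
      rewrite [leRHS]expr2 mulr_suml; apply: ler_sum => m _; rewrite expr2 ler_wpM2l//.
      exact: (ler_sum_pos m l0).
    by rewrite ler_pXn2r ?nnegrE ?sumr_ge0// addr_ge0.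
  rewrite ler_wpM2l// (_ : eps / 2 = eps / 4 + eps / 4); last by field.
  rewrite lerD2l -/(Lam eps) /theta.
  have -> : \sum_m (l m + Lam eps) = \sum_m l m + (M P)%:R * Lam eps.
    by rewrite big_split sumr_const card_ord mulr_natl.
  apply: (@le_trans _ _ (2 * (eps / (8 * S2 eps)) * S2 eps)); last first.
    by rewrite [leLHS](_ : _ = eps / 4)//; field; rewrite gt_eqF.
  by rewrite ler_wpM2l ?lerD2r// mulr_ge0// ltW.
have dom k : (k <= K eps)%N -> X P (ox r k) /\ Mbox a (omu r k).
  by move=> kK; exact: (outer_run_dom run sad kK).
split=> //.
  apply: (eps_optimal_of_bound (p := p eps) gB ls0 lsP) => //= l l0 lS.
  have := bound l (K eps) (leqnn _) l0 lS.
  have : 0 <= (4 * al)^-1 * lsq l (fun m => olam r (K eps) 0 m).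
    by rewrite mulr_ge0 ?lsq_ge0// invr_ge0 mulr_ge0// ltW.
  by lra.
move=> eps1.
have Keps : (K eps)%:R <= CK / eps.
  rewrite /K -natr1; have := truncn_le (2 * Cm / eps).
  rewrite divr_ge0 ?mulr_ge0// ?(ltW eps0)// => ht; rewrite ler_pdivlMr// mulrDl mul1r.
  by rewrite ler_pdivlMr// in ht; rewrite /CK; lra.
(* For [l = ls] the sum in [bound] is non-negative, which leaves a bound on the retained half of the
   dual distance. *)
have lam_bnd k m : (k <= K eps)%N -> olam r k 0 m <= ls m + (Q + 1).
  move=> kK; have := bound ls k kK ls0; rewrite -/S lerDl ler01 => /(_ isT).
  have pos : 0 <= \sum_(1 <= t < k.+1) (fine (f0 P (ox r t)) - fine (f0 P xstar)
       + \sum_m ls m * worst (ox r t, omu r t) m).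
    rewrite big_nat; apply: sumr_ge0 => t /andP[_ tk].
    by have [Xt bt] := dom t (leq_trans (tk : t <= k)%N kK); exact: (lsP (ox r t, omu r t)).
  have kE : k%:R * (eps / 2) <= (K eps)%:R * (eps / 2).
    by rewrite ler_wpM2r ?ler_nat// divr_ge0// ltW.
  have KE : (K eps)%:R * (eps / 2) <= CK / 2.
    by rewrite ler_pdivlMr// in Keps; lra.
  have lq := ler_sum_pos (F := fun m => (ls m - olam r k 0 m) ^+ 2) m (fun j => sqr_ge0 _).
  rewrite -/(lsq ls (fun m => olam r k 0 m)) in lq => hb.
  have : (4 * al)^-1 * lsq ls (fun m => olam r k 0 m) <= 2 * Cm + 1 by move: KE; rewrite /CK; lra.
  rewrite ler_pdivrMl ?mulr_gt0// -/Q => hQ.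
  (* With [x = ls m - olam r k 0 m], the square gives [- x <= x ^ 2 + 1 / 4], hence the linear bound
     [Q + 1]. *)
  by have := sqr_ge0 (ls m - olam r k 0 m + 1 / 2); move: (le_trans lq hQ); lra.
have T_bnd k : (k < K eps)%N -> (n eps (olam r k.+1))%:R <= Cn / eps.
  move=> kK; have LL : L (olam r k.+1) <= Lmax.
    rewrite /L /Lmax ler_wpM2l ?(ltW k0)// lerD2l mulr_natl -[in leRHS](card_ord (M P)) -sumr_const.
    rewrite -big_split; apply: ler_sum => m _; rewrite ger0_norm ?dom_lam//.
    exact: lam_bnd.
  rewrite /n -natr1; have := truncn_le (L (olam r k.+1) * C2 / (eps / 4)).
  rewrite (divr_ge0 (mulr_ge0 (ltW (L0 _)) (ltW C20)) (ltW e4)) => ht.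
  rewrite ler_pdivlMr// mulrDl mul1r; rewrite ler_pdivlMr// in ht.
  by have := ler_wpM2r (ltW C20) LL; rewrite /Cn; lra.
have := oracle_calls_le (p := p eps) (r := r) CK0 Cn0 eps0 Keps.
move=> /(_ (fun k => n eps (olam r k.+1)) (fun k => erefl) T_bnd) /le_trans; apply.
by rewrite ler_wpM2r ?lerDl// invr_ge0 exprn_ge0// ltW.
Qed.

End Complexity.

Theorem theorem6 (R : realType) (P : problem R)
    (M_pos : (0 < M P)%N)
    (nI_pos : forall m : 'I_(M P), (0 < nI m)%N)
    (X_set : [/\ X P !=set0, compact (X P)
               & convex_set (X P)])
    (Zt_set : forall m : 'I_(M P),
       [/\ Zt m !=set0, compact (Zt m)
         & convex_set (Zt m)])
    (f0_range : forall x, f0 P x != -oo%E)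
    (f0_convex : econvex (f0 P))
    (f0_dom : X P `<=` dom (f0 P))
    (g_convex : forall (m : 'I_(M P)) (z : 'rV[R]_(J m)), Zt m z ->
       econvex (fun x => g m x z))
    (g_concave : forall (m : 'I_(M P)) (x : xvec P), X P x ->
       econcave (fun z : 'rV[R]_(J m) => g m x z))
    (g_dom : forall (m : 'I_(M P)) (x : xvec P) (z : 'rV[R]_(J m)),
       X P x -> Zt m z -> g m x z \is a fin_num)
    (h_range : forall (m : 'I_(M P)) (i : 'I_(nI m)) z, h m i z != -oo%E)
    (h_convex : forall (m : 'I_(M P)) (i : 'I_(nI m)), econvex (h m i))
    (h_dom : forall (m : 'I_(M P)) (i : 'I_(nI m)),
       Zt m `<=` dom (h m i))
    (slater_x : exists2 xbar : xvec P, X P xbar &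
       forall m : 'I_(M P),
         (max_over (Zt m) (fun z => g m xbar z) < 0)%E)
    (zbar : zvec P)
    (slater_z : forall m : 'I_(M P),
       Zt m (zbar m) /\ forall i : 'I_(nI m), (h m i (zbar m) < 0)%E)
    (xstar : xvec P)
    (xstar_optimal : optimal xstar)
    (G : 'I_(M P) -> R)
    (G_neg : forall m, G m < 0)
    (G_bound : forall (m : 'I_(M P)) (x : xvec P), X P x ->
       ((G m)%:E <= g m x (zbar m))%E) :
  (nonsmooth_case P -> oracle_complexity (abound zbar G) xstar 3) /\
  (smooth_case P -> oracle_complexity (abound zbar G) xstar 2).
Proof.
have cvxP : convex_problem P.
  have [X0 Xcomp Xconv] := X_set; split=> //.
  - by move=> m; case: (Zt_set m).
  - by move=> m; case: (Zt_set m).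
  - by move=> m; case: (Zt_set m).
have rate (E : bool) D : regular P (E : nat)%:R D ->
    oracle_complexity (abound zbar G) xstar (2 + E).
  move=> regP; exact: (prom3_complexity cvxP regP M_pos nI_pos slater_x slater_z
    xstar_optimal G_neg G_bound).
split=> [nonsmoothP|smoothP].
  by have [D regP] := nonsmooth_regular nonsmoothP; exact: (rate true D regP).
have [D regP] := smooth_regular (X_compact cvxP) (@Zt_compact _ _ cvxP) f0_convex g_convex
  g_concave h_convex smoothP.
exact: (rate false D regP).
Qed.
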